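(* Let $\Sigma$ be a simplicial $(d-1)$-sphere with $n$ vertices. As $P$ varies over $\mathrm{Fano}(\Sigma)$ and $\bar x$ varies over $\mathrm{SF}^0(P)\cap\mathbb{Z}^{n+1}$, the assignment $\bar x\mapsto C(P,\bar x)$ gives rise to a bijective correspondence between the isomorphism classes of the regular reduced conic realizations of $\Delta(\Sigma)$ and the disjoint union $$\biguplus_{P\in\mathrm{Fano}(\Sigma)}\big(\mathrm{SF}^0(P)\cap\mathbb{Z}^{n+1}\big)/\mathrm{Aut}(P).$$
   Context: Cones and bottoms. A cone $C\subset\mathbb{R}^{m}$ is a set $\sum_i\mathbb{R}_+x_i$ (finite sum, $x_i\in\mathbb{Z}^m$) containing no positive-dimensional linear subspace. Two cones are lattice isomorphic if their monoids of lattice points are isomorphic. $\mathrm{Hilb}(C)$ is the set of indecomposable elements of $C\cap\mathbb{Z}^m$. The bottom $\mathrm{B}(C)$ is the union of the compact facets of $\mathrm{conv}((C\cap\mathbb{Z}^m)\setminus\{0\})$, and $\mathbb{B}(C)$ is the complex of lattice polytopes whose facets are the maximal polytopes in $\mathrm{B}(C)$, with the affine lattices $\mathrm{Aff}(F)\cap\mathbb{Z}^m$. Simplicial complexes. An abstract simplicial complex is regarded as a complex of lattice polytopes with the coarsest lattice structure, i.e., its simplices are unimodular. A reduced conic realization of a simplicial complex $\Delta$ is a cone $C$ such that $\mathbb{B}(C)$ is isomorphic to $\Delta$ (a bijection of supports, face-wise affine and respecting the affine lattices; in particular the simplices of $\mathbb{B}(C)$ are unimodular) and $\mathrm{Hilb}(\mathbb{R}_+F)\subset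 F$ for every facet $F$ of $\mathbb{B}(C)$. Two realizations are isomorphic if the cones are lattice isomorphic. A simplicial sphere is a simplicial complex whose geometric realization is homeomorphic to a sphere. For a simplicial $(d-1)$-sphere $\Sigma$, $\Delta(\Sigma)$ is the simplicial $d$-ball obtained by taking the pyramids with a common apex over the faces of $\Sigma$. A reduced conic realization $C\subset\mathbb{R}^{d+1}$ of $\Delta(\Sigma)$ is regular if $\bigcup_{x\in\mathrm{B}(C)}(x+\mathbb{R}O)\subset\mathbb{R}^{d+1}$ is convex, where $O$ is the interior vertex of $\mathrm{B}(C)$. Smooth Fano polytopes. A smooth Fano $d$-polytope is a lattice $d$-polytope $P\subset\mathbb{R}^d$ with $0\in\mathrm{int}(P)$ such that the vertices of every facet form a basis of $\mathbb{Z}^d$. $\mathrm{Fano}(\Sigma)$ is the set of unimodular equivalence classes of smooth Fano polytopes whose boundary complex is combinatorially equivalent to $\Sigma$ (one representative $P$ is used for each class). The sets $\mathrm{SF}$. Let $P\subset\mathbb{R}^d$ be a simplicial $d$-polytope with $0\in\mathrm{int}(P)$ and vertices $v_1,\dots,v_n$, labeled so that $\mathrm{conv}(v_1,\dots,v_d)$ is a facet. For adjacent facets $F=\mathrm{conv}(v_{i_1},\dots,v_{i_{d-1}},v_{i_d})$ and $G=\mathrm{conv}(v_{i_1},\dots,v_{i_{d-1}},v_{i_{d+1}})$ let $$\phi_{FG}:\mathbb{R}^{n+1}\to\mathbb{R},\quad (x_0,\dots,x_n)\mapsto\lambda_{i_{d+1}}x_{i_{d+1}}+\lambda_{i_d}x_{i_d}-\lambda_{i_{d-1}}x_{i_{d-1}}-\cdots-\lambda_{i_1}x_{i_1}-\lambda_0x_0,$$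 where the $\lambda$'s are uniquely determined by $\lambda_{i_d}v_{i_d}+\lambda_{i_{d+1}}v_{i_{d+1}}=\lambda_{i_1}v_{i_1}+\cdots+\lambda_{i_{d-1}}v_{i_{d-1}}$, $\lambda_{i_d}+\lambda_{i_{d+1}}=1$, $\lambda_0+\lambda_{i_1}+\cdots+\lambda_{i_{d-1}}=1$ (then $\lambda_0,\lambda_{i_d},\lambda_{i_{d+1}}>0$). Put $\mathrm{SF}(P)=\{\bar x\in\mathbb{R}^{n+1}\mid\phi_{FG}(\bar x)\ge0$ for every adjacent pair of facets $F,G\}$, $\mathrm{SF}^+(P)=\mathrm{int}(\mathrm{SF}(P))\cap\{x_0=0,\ x_1,\dots,x_n\ge0\}$ and $\mathrm{SF}^0(P)=\mathrm{int}(\mathrm{SF}(P))\cap\{x_0=\cdots=x_d=0,\ x_{d+1},\dots,x_n\ge0\}$. For $\bar x=(x_0,\dots,x_n)$ let $\mathrm{B}(\bar x)\subset P\times\mathbb{R}$ be the union, over all facets $\mathrm{conv}(v_{i_1},\dots,v_{i_d})$ of $P$, of $\mathrm{conv}((0,x_0),(v_{i_1},x_{i_1}),\dots,(v_{i_d},x_{i_d}))$, and let $C(P,\bar x)=\mathbb{R}_+(\mathrm{B}(\bar x)+e_{d+1})\subset\mathbb{R}^{d+1}$, where $\mathbb{R}_+X=\{ax\mid a\in\mathbb{R}_+,x\in X\}$ and $e_{d+1}$ is the last standard basis vector. The action. $\mathrm{Aut}(P)$ is the group of linear automorphisms of $P$. It acts on $\mathrm{SF}^+(P)$ by permuting coordinates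 via $\mathrm{B}(\alpha(\bar x))=\alpha(\mathrm{B}(\bar x))$, where $\alpha$ acts on $P\times\mathbb{R}$ fixing the last coordinate. For $\bar x\in\mathrm{SF}^+(P)$, $\rho(\bar x)\in\mathrm{SF}^0(P)$ is the point for which $C(P,\rho(\bar x))$ is the image of $C(P,\bar x)$ under a linear map $\phi$ of $\mathbb{R}^{d+1}$ with $\phi(e_{d+1})=e_{d+1}$ and $\mathrm{Im}(\mathbf 1-\phi)\subset\mathbb{R}e_{d+1}$; explicitly, for $k>d$, $\rho(\bar x)_k=x_k-\sum_{i=1}^da_ix_i$, where $v_k=\sum_{i=1}^da_iv_i$. $\mathrm{Aut}(P)$ acts on $\mathrm{SF}^0(P)$ by $\alpha\star\bar x=\rho(\alpha(\bar x))$; when $P$ is a smooth Fano polytope this restricts to an action on $\mathrm{SF}^0(P)\cap\mathbb{Z}^{n+1}$, and the quotient is the set of orbits.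
   Formalization: ''Regular'' here also requires that, for each face G of B(C) not containing O, G + RO is a face of the convex set B(C) + RO; with bare convexity the claim fails, e.g. for the cone over the Hirzebruch surface F_2 fan (d = 2, Σ a 4-cycle). *)

(* Defs.v *)
From HB Require Import structures.
From mathcomp Require Import all_boot all_order all_algebra.
From mathcomp Require Import all_classical all_reals all_analysis.

Set Implicit Arguments.
Unset Strict Implicit.
Unset Printing Implicit Defensive.

Import Order.TTheory GRing.Theory Num.Theory.
Import numFieldNormedType.Exports.

Local Open Scope classical_set_scope.
Local Open Scope ring_scope.

(** * Convexity, polyhedra, lattices *)

Section Convexity.
Context {R : realType} {m : nat}.
Implicit Types (A Q F P C D : set 'rV[R]_m).

Definition is_convex A : Prop := @convex_set R 'rV[R]_m A.

Definition is_affine A : Prop :=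
  forall x y (t : R), A x -> A y -> A (t *: x + (1 - t) *: y).

Definition conv A : set 'rV[R]_m := smallest is_convex A.

Definition aff A : set 'rV[R]_m := smallest is_affine A.

(* Improper faces are allowed: u = 0 gives Q itself (b = 0) and the empty
   face (b = -1). *)
Definition is_face Q F : Prop :=
  exists (u : 'cV[R]_m) (b : R),
    (forall x, Q x -> b <= (x *m u) 0 0) /\
    F = [set x | Q x /\ (x *m u) 0 0 = b].

Definition is_facet Q F : Prop :=
  [/\ is_face Q F, F <> Q &
      forall G, is_face Q G -> F `<=` G -> G = F \/ G = Q].

Definition vertices Q : set 'rV[R]_m := [set x | is_face Q [set x]].

Definition Zlat : set 'rV[R]_m := [set x | x \is a mxOver Num.int].

Definition lattice_polytope P : Prop :=
  exists X : set 'rV[R]_m, [/\ finite_set X, X `<=` Zlat & P = conv X].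

Definition Z_basis (S : set 'rV[R]_m) : Prop :=
  exists (k : nat) (b : 'I_k -> 'rV[R]_m),
    [/\ injective b, S = range b, (forall i, Zlat (b i)) &
        forall z, Zlat z ->
          exists! c : 'rV[int]_k, z = \sum_i (c 0 i)%:~R *: b i].

(* R_+ A *)
Definition pos_hull A : set 'rV[R]_m :=
  [set y | exists a : R, exists2 x, A x & 0 <= a /\ y = a *: x].

Definition is_cone C : Prop :=
  (exists (k : nat) (x : 'I_k -> 'rV[R]_m), (forall i, Zlat (x i)) /\
     C = [set y | exists a : 'I_k -> R,
                    (forall i, 0 <= a i) /\ y = \sum_i a i *: x i]) /\
  (forall v, (forall t : R, C (t *: v)) -> v = 0).

Definition Hilb C : set 'rV[R]_m :=
  [set x | [/\ C x, Zlat x, x <> 0 &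
     forall y z, C y -> Zlat y -> C z -> Zlat z -> x = y + z ->
       y = 0 \/ z = 0]].

End Convexity.

(* The lattice points of a cone form a cancellative monoid, so an additive
   bijection automatically preserves 0. *)
Definition lattice_iso {R : realType} {m m' : nat}
    (C : set 'rV[R]_m) (D : set 'rV[R]_m') : Prop :=
  exists f : 'rV[R]_m -> 'rV[R]_m',
    set_bij (C `&` Zlat) (D `&` Zlat) f /\
    (forall x y, C x -> Zlat x -> C y -> Zlat y -> f (x + y) = f x + f y).

(** * Complexes of lattice polytopes *)

(* A complex embedded in R^m is the set of its nonempty cells, each cell P
   carrying the affine lattice aff P `&` Zlat. *)

Definition support {R : realType} {m : nat}
    (K : set (set 'rV[R]_m)) : set 'rV[R]_m := \bigcup_(P in K) P.

Definition complex_iso {R : realType} {m m' : nat}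
    (K : set (set 'rV[R]_m)) (K' : set (set 'rV[R]_m')) : Prop :=
  exists f : 'rV[R]_m -> 'rV[R]_m',
    [/\ set_bij (support K) (support K') f,
        [set f @` P | P in K] = K' &
        forall P, K P -> exists (A : 'M[R]_(m, m')) (b : 'rV[R]_m'),
          (forall x, P x -> f x = x *m A + b) /\
          [set x *m A + b | x in aff P `&` Zlat] = aff (f @` P) `&` Zlat].

Section Bottom.
Context {R : realType} {m : nat} (C : set 'rV[R]_m).

Definition bottom_facets : set (set 'rV[R]_m) :=
  [set F | is_facet (conv ((C `&` Zlat) `\ 0)) F /\ compact F].

Definition bottom : set 'rV[R]_m := \bigcup_(F in bottom_facets) F.

Definition bottom_complex : set (set 'rV[R]_m) :=
  [set G | G !=set0 /\ exists2 F, bottom_facets F & is_face F G].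

End Bottom.

(** * Simplicial complexes and spheres *)

Definition homeomorphic {T U : topologicalType} (A : set T) (B : set U) : Prop :=
  exists (f : T -> U) (g : U -> T),
    [/\ {within A, continuous f}, {within B, continuous g},
        f @` A `<=` B, g @` B `<=` A &
        (forall x, A x -> g (f x) = x) /\ (forall y, B y -> f (g y) = y)].

Section Simplicial.
Context (R : realType) {T : finType}.

(* Every element of T is a vertex. *)
Definition simplicial_complex (K : {set {set T}}) : Prop :=
  [/\ finset.set0 \in K,
      (forall s t : {set T}, s \in K -> t \subset s -> t \in K) &
      forall v : T, [set v]%SET \in K].

(* The standard realization in R^T: its simplices are unimodular with respect
   to the lattice Z^T. *)
Definition std_simplex (s : {set T}) : set 'rV[R]_#|T| :=
  conv [set delta_mx 0 (enum_rank v) | v in [set` s]].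

Definition realization (K : {set {set T}}) : set (set 'rV[R]_#|T|) :=
  [set std_simplex s | s in [set s | (s \in K) && (s != finset.set0)]].

(* The unit sphere of dimension d - 1. *)
Definition usphere (d : nat) : set 'rV[R]_d :=
  [set x | \sum_i x 0 i ^+ 2 = 1].

Definition simplicial_sphere (K : {set {set T}}) (d : nat) : Prop :=
  simplicial_complex K /\
  homeomorphic (support (realization K)) (@usphere d).

End Simplicial.
Arguments realization R {T} K.

(* The d-ball Delta(Sigma); the apex is None. *)
Definition pyramid {T : finType} (K : {set {set T}}) : {set {set option T}} :=
  [set s : {set option T} | [exists t in K, s \subset None |: [set Some v | v in t]]]%SET.

(** * Reduced conic realizations *)

Definition reduced_realization {R : realType} {T : finType} {m : nat}
    (Delta : {set {set T}}) (C : set 'rV[R]_m) : Prop :=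
  [/\ is_cone C,
      complex_iso (realization R Delta) (bottom_complex C) &
      forall F, bottom_facets C F -> Hilb (pos_hull F) `<=` F].

(* x is in the interior of the d-dimensional topological manifold with
   boundary B. *)
Definition manifold_interior {R : realType} {m : nat} (d : nat)
    (B : set 'rV[R]_m) (x : 'rV[R]_m) : Prop :=
  B x /\
  exists (U : set 'rV[R]_m) (W : set 'rV[R]_d),
    [/\ open U, U x, open W & homeomorphic (B `&` U) W].

Definition interior_vertex {R : realType} {m : nat} (d : nat)
    (C : set 'rV[R]_m) (O : 'rV[R]_m) : Prop :=
  bottom_complex C [set O] /\ manifold_interior d (bottom C) O.

(* A + RO *)
Definition prism {R : realType} {m : nat}
    (A : set 'rV[R]_m) (O : 'rV[R]_m) : set 'rV[R]_m :=
  [set y | exists2 x, A x & exists t : R, y = x + t *: O].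

(* Convexity of prism (bottom C) O is meant as convexity of the sphere Sigma
   that bounds it modulo RO: its cells span proper faces of the prism, so that
   prism (bottom C) O modulo RO is a polytope with boundary complex Sigma.  The
   last clause says this; it is not implied by convexity of the underlying set.
   For the rays v1 = (1,0), v2 = (0,1), v3 = (-1,2), v4 = (0,-1) of the
   Hirzebruch surface F_2, the cone over (0,1), (v1,1), (v2,1), (v3,2), (v4,2)
   realizes the pyramid over a 4-cycle and projects onto a triangle with v2 in
   the middle of an edge of lattice length 2. *)
Definition is_regular {R : realType} {d : nat} (C : set 'rV[R]_(d + 1)) : Prop :=
  exists O, [/\ interior_vertex d C O,
                is_convex (prism (bottom C) O) &
                forall G, bottom_complex C G -> ~ G O ->
                  is_face (prism (bottom C) O) (prism G O)].

Definition regular_realization {R : realType} {T : finType} {d : nat}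
    (Sigma : {set {set T}}) (C : set 'rV[R]_(d + 1)) : Prop :=
  reduced_realization (pyramid Sigma) C /\ is_regular C.

Definition iso_class {R : realType} {T : finType} {d : nat}
    (Sigma : {set {set T}}) (C : set 'rV[R]_(d + 1)) :
    set (set 'rV[R]_(d + 1)) :=
  [set D | regular_realization Sigma D /\ lattice_iso C D].

(** * Smooth Fano polytopes *)

Section Fano.
Context {R : realType} {d : nat}.
Implicit Types P Q : set 'rV[R]_d.

Definition smooth_fano P : Prop :=
  [/\ lattice_polytope P, P° 0 &
      forall F, is_facet P F -> Z_basis (vertices F)].

Definition boundary_equiv {T : finType} (Sigma : {set {set T}}) P : Prop :=
  exists f : {set T} -> set 'rV[R]_d,
    set_bij [set s | s \in Sigma] [set F | is_face P F /\ F <> P] f /\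
    (forall s t, s \in Sigma -> t \in Sigma ->
       (s \subset t <-> f s `<=` f t)).

Definition unimodular_equiv P Q : Prop :=
  exists (U : 'M[int]_d) (b : 'rV[int]_d), U \in unitmx /\
    Q = [set x *m map_mx intr U + map_mx intr b | x in P].

End Fano.

(** * The sets SF, the cones C(P, x) and the action of Aut(P) *)

(* A polytope with labelled vertices v_1, ..., v_n is given by
   v : 'I_n -> 'rV[R]_d, where v i stands for v_{i+1}.  A point
   (x_0, ..., x_n) is x : 'rV[R]_n.+1, with x_0 = x 0 ord0 and
   x_{i+1} = x 0 (lift ord0 i). *)
Section Labelled.
Context {R : realType} {n d : nat} (v : 'I_n -> 'rV[R]_d).
Implicit Types (x y z : 'rV[R]_n.+1) (I J : {set 'I_n}) (p q : 'I_n).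

Definition vpoly : set 'rV[R]_d := conv (range v).

Definition vconv J : set 'rV[R]_d := conv [set v i | i in [set` J]].

Definition facet_index J : Prop := #|J| = d /\ is_facet vpoly (vconv J).

Definition well_labelled : Prop :=
  [/\ injective v, range v = vertices vpoly &
      is_facet vpoly (vconv [set i : 'I_n | (i < d)%N]%SET)].

(* The facets spanned by q |: I and p |: I are adjacent; q and p play the
   roles of i_d and i_{d+1}. *)
Definition adjacent I q p : Prop :=
  [/\ q \notin I, p \notin I, q != p &
      facet_index (q |: I)%SET /\ facet_index (p |: I)%SET].

Definition ridge_coeffs I q p (l0 : R) (l : 'I_n -> R) : Prop :=
  [/\ l q *: v q + l p *: v p = \sum_(i in I) l i *: v i,
      l q + l p = 1 & l0 + \sum_(i in I) l i = 1].

Definition phi_FG I q p (l0 : R) (l : 'I_n -> R) x : R :=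
  l p * x 0 (lift ord0 p) + l q * x 0 (lift ord0 q)
  - \sum_(i in I) l i * x 0 (lift ord0 i) - l0 * x 0 ord0.

Definition SF : set 'rV[R]_n.+1 :=
  [set x | forall I q p l0 l,
     adjacent I q p -> ridge_coeffs I q p l0 l -> 0 <= phi_FG I q p l0 l x].

Definition SFplus : set 'rV[R]_n.+1 :=
  SF° `&` [set x | x 0 ord0 = 0 /\ forall i : 'I_n, 0 <= x 0 (lift ord0 i)].

Definition SF0 : set 'rV[R]_n.+1 :=
  SF° `&` [set x | [/\ x 0 ord0 = 0,
     (forall i : 'I_n, (i < d)%N -> x 0 (lift ord0 i) = 0) &
     forall i : 'I_n, (d <= i)%N -> 0 <= x 0 (lift ord0 i)]].

Definition at_height (y : 'rV[R]_d) (t : R) : 'rV[R]_(d + 1) :=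
  row_mx y (const_mx t).

Definition Bgraph x : set 'rV[R]_(d + 1) :=
  \bigcup_(J in facet_index)
    conv (at_height 0 (x 0 ord0) |`
          [set at_height (v i) (x 0 (lift ord0 i)) | i in [set` J]]).

Definition Ccone x : set 'rV[R]_(d + 1) :=
  pos_hull [set y + at_height 0 1 | y in Bgraph x].

Definition Aut (a : 'M[R]_d) : Prop :=
  a \in unitmx /\ [set y *m a | y in vpoly] = vpoly.

Definition lift_lin (a : 'M[R]_d) (y : 'rV[R]_(d + 1)) : 'rV[R]_(d + 1) :=
  row_mx (lsubmx y *m a) (rsubmx y).

(* y = a(x) *)
Definition act_eq (a : 'M[R]_d) x y : Prop :=
  SFplus y /\ Bgraph y = [set lift_lin a w | w in Bgraph x].

(* z = rho(x) *)
Definition rho_eq x z : Prop :=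
  [/\ z 0 ord0 = 0,
      (forall i : 'I_n, (i < d)%N -> z 0 (lift ord0 i) = 0) &
      forall k : 'I_n, (d <= k)%N -> exists c : 'I_n -> R,
        v k = \sum_(i < n | (i < d)%N) c i *: v i /\
        z 0 (lift ord0 k) = x 0 (lift ord0 k)
          - \sum_(i < n | (i < d)%N) c i * x 0 (lift ord0 i)].

(* The orbit of x under (a, x) |-> rho(a(x)), a in Aut(P). *)
Definition aut_orbit x : set 'rV[R]_n.+1 :=
  [set z | exists a y, [/\ Aut a, act_eq a x y & rho_eq y z]].

End Labelled.

(* V consists of exactly one labelled representative of every class in
   Fano(Sigma). *)
Definition fano_representatives {R : realType} {T : finType} {n d : nat}
    (Sigma : {set {set T}}) (V : set ('I_n -> 'rV[R]_d)) : Prop :=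
  (forall v, V v ->
     [/\ well_labelled v, smooth_fano (vpoly v) &
         boundary_equiv Sigma (vpoly v)])
  /\
  (forall P : set 'rV[R]_d, smooth_fano P -> boundary_equiv Sigma P ->
     exists! v, V v /\ unimodular_equiv P (vpoly v)).

(* Main.v *)
(* A height function [x] that is linear on the cones over the facets of a smooth
   Fano polytope P, strictly convex and integral, lifts the fan of P to a complex
   of unimodular cones filling C(P, x); every facet has an integral functional
   that is 1 on its vertices and larger than 1 on the other generators, which
   identifies the bottom, the Hilbert basis and the prism of C(P, x).

   Conversely, let C be a regular realization and O its interior vertex.  The
   bottom of C is mapped injectively along O, so by invariance of domain (deduced
   from Brouwer's theorem, which follows from Scarf's lemma) its image is a
   neighbourhood of the origin.  Hence O is the apex of the pyramid, and the
   supporting functionals of the prism over the simplices of Sigma show that the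
   image of the bottom is a polytope star-shaped about the origin with boundary
   complex Sigma.  The condition on Hilbert bases makes the simplices unimodular,
   so that the image is a smooth Fano polytope.  If C were larger than the union
   of the cones over the bottom, one could rotate the supporting hyperplane of a
   facet about its face opposite to O and get a compact facet that avoids O.  The
   heights of the vertices of C are measured by the functional of one facet.

   An isomorphism of such cones permutes the Hilbert bases, is linear, maps
   facets to facets and fixes O, the only vertex common to all facets; modulo O
   it is an isomorphism of Fano polytopes, and the heights then differ by a
   linear function, which rho removes. *)

From mathcomp Require Import all_boot all_order all_algebra.
From mathcomp Require Import all_classical all_reals all_analysis.
From mathcomp Require Import ring lra zify.
Require Import Defs.

Set Implicit Arguments.
Unset Strict Implicit.
Unset Printing Implicit Defensive.

Import Order.TTheory GRing.Theory Num.Theory.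
Import numFieldNormedType.Exports.

Local Open Scope classical_set_scope.
Local Open Scope ring_scope.

(** * Brouwer's theorem *)

(** Both directions pass through two predicates: [fano_fan] for the complete unimodular fan of a
    polytope and [cone_fan] for the subdivision of a cone into unimodular cones. The faces of the
    polytope, and the bottom, the Hilbert basis and the isomorphisms of the cone, are derived from
    these predicates; a height function on a labelled polytope and an abstract regular realization
    only have to be shown to satisfy them.

    The obstacle lies in the realization: its interior vertex is given by a topological condition, a
    chart of the bottom around [O], and nothing says beforehand that the cones over the bottom
    surround the origin modulo [O]. Invariance of domain supplies this. Its analytic ingredients are
    explicit: an infimum formula gives a Lipschitz approximate inverse in place of an extension
    theorem, and counting small cubes shows that a Lipschitz image of the boundary of a cube has
    empty interior. Scarf's lemma concerns finite sets with several linear orders, so Brouwer's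
    theorem is reached with no triangulation. *)

Section Scarf.
Local Open Scope nat_scope.
Import mathcomp.boot.fintype mathcomp.boot.finset.
Local Open Scope set_scope.
Variables (A I : finType) (dum : I -> A) (rk : I -> A -> nat) (col : A -> I).
Hypothesis rk_inj : forall i, injective (rk i).
Hypothesis rk_low : forall i a, a != dum i -> rk i (dum i) < rk i a.
Hypothesis rk_high : forall i k a,
  k != i -> a \notin codom dum -> rk i a < rk i (dum k).
Hypothesis col_dum : forall i, col (dum i) = i.
Hypothesis ex_nondum : exists a, a \notin codom dum.
Implicit Types (X D : {set A}).

(** Scarf's primitive sets: no point is above the minimum of [X] in every order at once. Those with
    [|I|] elements take the part of the full cells of a triangulation. *)
Definition dominant X :=
  [forall y, exists i, [forall x in X, rk i y <= rk i x]].

Definition room X := (#|X| == #|I|) && dominant X.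

Let ismin i X a := (a \in X) && [forall x in X, rk i a <= rk i x].

Let isminP i X a :
  reflect (a \in X /\ forall x, x \in X -> rk i a <= rk i x) (ismin i X a).
Proof.
apply: (iffP andP) => -[aX h]; split=> //; first exact/forall_inP.
exact/forall_inP.
Qed.

Let dominantP X :
  reflect (forall y, exists i, forall x, x \in X -> rk i y <= rk i x)
          (dominant X).
Proof.
apply: (iffP forallP) => h y.
  by have /existsP[i /forall_inP hi] := h y; exists i.
by have [i hi] := h y; apply/existsP; exists i; apply/forall_inP.
Qed.

Let dum_inj : injective dum.
Proof. exact: can_inj col_dum. Qed.

Let exmin X : X != set0 -> exists m : I -> A, forall i, ismin i X (m i).
Proof.
case/set0Pn=> x0 x0X.
exists (fun i => [arg min_(x < x0 in X) rk i x]) => i.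
by case: arg_minnP => // a aX h; apply/isminP.
Qed.

Let ismin_eq i X a b : ismin i X a -> ismin i X b -> a = b.
Proof.
case/isminP=> aX ha /isminP[bX hb]; apply: (@rk_inj i); apply/eqP.
by rewrite eqn_leq ha ?hb.
Qed.

Let ismin_lt i X a x : ismin i X a -> x \in X -> x != a -> rk i a < rk i x.
Proof.
case/isminP=> aX ha xX ne; rewrite ltn_neqAle ha // andbT.
by apply: contraNneq ne => /rk_inj ->.
Qed.

(** Dominance applied to a point of [X] itself makes it the minimum of [X] in some order. So the
    [|I|] minima exhaust [X], and by cardinality they are distinct. *)
Let room_min X (m : I -> A) : room X -> (forall i, ismin i X (m i)) ->
  injective m /\ forall x, x \in X -> exists i, x = m i.
Proof.
case/andP=> /eqP cX /dominantP dX hm.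
have onto x : x \in X -> exists i, x = m i.
  move=> xX; have [i hi] := dX x; exists i.
  by apply: (@ismin_eq i X) (hm i); apply/isminP.
split=> //.
have sX : X = m @: setT.
  apply/eqP; rewrite eqEsubset; apply/andP; split; apply/subsetP => x.
    by case/onto=> i ->; apply: imset_f.
  by case/imsetP=> i _ ->; case/isminP: (hm i).
have /imset_injP h : #|m @: setT| == #|[set: I]| by rewrite -sX cX cardsT.
by move=> i j; apply: h; rewrite inE.
Qed.

Let completions D := [set x in ~: D | room (x |: D)].

Let card_room_door D x : x \in completions D -> #|D|.+1 = #|I|.
Proof.
by rewrite !inE => /andP[xD /andP[/eqP <- _]]; rewrite cardsU1 xD.
Qed.

Section Door.
Variables (D : {set A}) (m : I -> A) (i j : I).
Hypothesis minD : forall k, ismin k D (m k).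
Hypothesis ij : i != j.
Hypothesis mij : m i = m j.
Hypothesis minj : forall k l, k != i -> l != i -> m k = m l -> k = l.
Hypothesis monto : forall x, x \in D -> exists2 k, k != i & x = m k.
Hypothesis domD : forall y, exists k, rk k y <= rk k (m k).
Hypothesis cD : #|D|.+1 = #|I|.

(** The points whose addition to [D] leaves the minima of all orders but [i] unchanged. *)
Let M := [set y | [forall k, (k != i) ==> (rk k (m k) < rk k y)]].

Let MP y : reflect (forall k, k != i -> rk k (m k) < rk k y) (y \in M).
Proof.
rewrite inE; apply: (iffP forallP) => h k; last by apply/implyP; exact: h.
by move/implyP: (h k).
Qed.

(** An [i]-largest element of [M] completes [D]: points of [M] are below it in order [i], and a
    point outside [M] is below some minimum [m k] with [k != i]. *)
Lemma completion_exists : dum i \in M ->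
  exists x, [/\ x \in completions D, x \in M & forall y, y \in M -> rk i y <= rk i x].
Proof.
move=> dM.
pose x := [arg max_(x > dum i in M) rk i x].
have [xM xmax] : x \in M /\ forall y, y \in M -> rk i y <= rk i x.
  by rewrite /x; case: arg_maxnP.
exists x; split=> //.
have xD : x \notin D.
  apply/negP => /monto[k ki xk]; move/MP: xM => /(_ k ki).
  by rewrite xk ltnn.
rewrite !inE xD /=; apply/andP; split; first by rewrite cardsU1 xD add1n cD.
apply/dominantP => y; case: (boolP (y \in M)) => [yM|].
  exists i => z /setU1P[->|zD]; first exact: xmax.
  have [k hk] := domD y; have [ki|ki] := eqVneq k i; last first.
    by move/MP: yM => /(_ k ki); rewrite ltnNge hk.
  rewrite -ki; apply: leq_trans hk _; rewrite ki.
  by have /isminP[_] := minD i; apply.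
rewrite inE negb_forall => /existsP[k]; rewrite negb_imply -leqNgt.
case/andP=> ki hk; exists k => z /setU1P[->|zD].
  by apply: leq_trans hk _; apply: ltnW; move/MP: xM; apply.
by apply: leq_trans hk _; have /isminP[_] := minD k; apply.
Qed.

Lemma completion_max x y : x \in M -> (forall z, z \in M -> rk i z <= rk i x) ->
  y \in M -> (forall z, z \in M -> rk i z <= rk i y) -> x = y.
Proof.
by move=> xM xm yM ym; apply: (@rk_inj i); apply/eqP; rewrite eqn_leq xm ?ym.
Qed.

(** Either failure, [dum i] in [D] or not above some [m k], forces [D] to be the set of all dummies
    but one. In the first case the colours identify it with the excluded set; in the second it would
    contain [dum i] after all. *)
Lemma dum_mem_M (i0 : I) : col @: D = [set~ i0] -> D != dum @: [set~ i0] ->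
  dum i \in M.
Proof.
move=> colD neD.
(* In order [k] a dummy other than [dum k] is above all non-dummies; when it is the minimum of [D],
   only dummies other than [dum k] are left in [D]. *)
have sub k k' : ismin k D (dum k') -> k' != k -> D \subset dum @: [set~ k].
  move=> hm kk; apply/subsetP => z zD.
  have : z \in codom dum.
    apply/negPn/negP => zn; case/isminP: hm => _ /(_ _ zD).
    by rewrite leqNgt (rk_high kk zn).
  case/codomP => l zl; rewrite zl imset_f // !inE; apply/eqP => lk.
  case/isminP: hm => _ /(_ _ zD); rewrite zl lk leqNgt rk_low //.
  by rewrite (inj_eq dum_inj).
have diD : dum i \notin D.
  apply/negP => diD.
  have mi : m i = dum i.
    apply: (ismin_eq (minD i)); apply/isminP; split=> // x xD.
    by have [->//|/rk_low/ltnW] := eqVneq x (dum i).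
  have sD : D \subset dum @: [set~ j].
    by apply: (sub j i) ij; rewrite -mi mij.
  have : [set~ i0] \subset [set~ j].
    rewrite -colD; apply/subsetP => _ /imsetP[z /(subsetP sD) + ->].
    by case/imsetP => k kj ->; rewrite col_dum.
  rewrite setCS sub1set inE => /eqP ji0; move/eqP: neD; apply; apply/eqP.
  rewrite eqEcard -ji0 sD /= card_imset // cardsC1 -cD /=.
  by [].
apply/MP => k ki.
have [/codomP[k' mk]|] := boolP (m k \in codom dum); last first.
  by move=> h; apply: rk_high => //; rewrite eq_sym.
have [kk|kk] := eqVneq k' k.
  by rewrite mk kk rk_low // (inj_eq dum_inj) eq_sym.
have sD : D \subset dum @: [set~ k] by apply: (sub k k') kk; rewrite -mk.
have eD : D = dum @: [set~ k].
  by apply/eqP; rewrite eqEcard sD /= card_imset // cardsC1 -cD.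
by case/negP: diD; rewrite eD imset_f // !inE eq_sym.
Qed.

End Door.

(** In a room [x |: D] the new point [x] is the minimum in exactly one order [i], and the old
    minimum [m i] survives as the minimum in another order [j]. Dominance of the room then says that
    [x] is the [i]-largest point above the other minima. *)
Let door_data D x : D != set0 -> x \in completions D ->
  exists (m : I -> A) (i j : I),
  [/\ forall k, ismin k D (m k), i != j, m i = m j,
      (forall k l, k != i -> l != i -> m k = m l -> k = l) &
      forall z, z \in D -> exists2 k, k != i & z = m k] /\
  [/\ forall k, k != i -> rk k (m k) < rk k x,
      (forall y, (forall k, k != i -> rk k (m k) < rk k y) -> rk i y <= rk i x) &
      forall y, exists k, rk k y <= rk k (m k)].
Proof.
move=> D0; rewrite !inE => /andP[xD rX]; set X := x |: D in rX *.
have [m hm] := exmin D0.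
have X0 : X != set0 by apply/set0Pn; exists x; rewrite setU11.
have [mu hmu] := exmin X0.
have [muI muO] := room_min rX hmu.
have [i xi] := muO x (setU11 _ _).
have mmu k : k != i -> mu k = m k.
  move=> ki; have /isminP[/setU1P[muk|muD] h] := hmu k.
    by case/eqP: ki; apply: muI; rewrite muk xi.
  apply: (@ismin_eq k D) (hm k); apply/isminP; split=> // z zD.
  by apply: h; rewrite inE zD orbT.
have [j mij] := muO (m i) (setU1r _ (proj1 (elimT (isminP _ _ _) (hm i)))).
have ji : j != i.
  apply/eqP => e; rewrite e -xi in mij; case/negP: xD; rewrite -mij.
  by case/isminP: (hm i).
exists m, i, j; split; split=> //.
- by rewrite eq_sym.
- by rewrite mij mmu.
- by move=> k l ki li; rewrite -!mmu //; apply: muI.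
- move=> z zD; have [k zk] := muO z (setU1r _ zD); exists k.
    by apply: contraNneq xD => e; rewrite xi -e -zk.
  rewrite zk mmu //; apply: contraNneq xD => e; rewrite xi -e -zk //.
- move=> k ki; rewrite -mmu //; apply: ismin_lt (hmu k) _ _; first exact: setU11.
  by rewrite xi (inj_eq muI) eq_sym.
- move=> y hy; case/andP: rX => _ /dominantP/(_ y)[k hk].
  have [ki|ki] := eqVneq k i; first by rewrite -ki; apply: hk; apply: setU11.
  have := hy k ki; rewrite ltnNge hk // inE.
  by case/isminP: (hm k) => ->; rewrite orbT.
- move=> y; case/andP: rX => _ /dominantP/(_ y)[k hk]; exists k; apply: hk.
  by case/isminP: (hm k) => mD _; rewrite inE mD orbT.
Qed.

(** The set of all dummies but [dum i0] is completed only by the [i0]-largest non-dummy. Any other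
    set with these colours has no completion or exactly two, because the new point takes over one of
    the two orders that share a minimum of [D]. *)
Let odd_completions D (i0 : I) : col @: D = [set~ i0] ->
  odd #|completions D| = (D == dum @: [set~ i0]).
Proof.
move=> colD; have [eD|neD] := eqVneq D (dum @: [set~ i0]).
  have [a0 na0] := ex_nondum.
  pose x := [arg max_(x > a0 in ~: [set a in codom dum]) rk i0 x].
  have [xn xm] : x \notin codom dum /\
      forall y, y \notin codom dum -> rk i0 y <= rk i0 x.
    rewrite /x; case: arg_maxnP => [|b]; first by rewrite !inE.
    by rewrite !inE => -> h; split=> // y yn; apply: h; rewrite !inE.
  suff -> : completions D = [set x] by rewrite cards1.
  apply/eqP; rewrite eqEsubset sub1set; apply/andP; split.
    apply/subsetP => z; rewrite !inE => /andP[zD /andP[_ /dominantP dz]].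
    have zn : z \notin codom dum.
      apply/negP => /codomP[k zk].
      have ki : k = i0.
        by apply/eqP; apply: contraNT zD => ki; rewrite eD zk imset_f // !inE.
      have [k' hk] := dz a0.
      have := hk (dum k'); rewrite leqNgt rk_low; last first.
        by apply: contraNneq na0 => ->; apply: codom_f.
      suff -> : dum k' \in z |: D by move=> /(_ isT).
      rewrite !inE eD zk ki; have [->|ne] := eqVneq k' i0; first by rewrite eqxx.
      by rewrite imset_f ?orbT // !inE.
    have [k hk] := dz x.
    have ki : k = i0.
      apply/eqP; apply: contraT => ki.
      have := hk (dum k); rewrite leqNgt rk_low; last first.
        by apply: contraNneq xn => ->; apply: codom_f.
      suff -> : dum k \in z |: D by move=> /(_ isT).
      by rewrite !inE eD imset_f ?orbT // !inE.
    apply/eqP; apply: (@rk_inj i0); apply/eqP; rewrite eqn_leq xm //= -ki hk //.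
    by rewrite setU11.
  rewrite !inE; have xD : x \notin D.
    apply: contra xn; rewrite eD => /imsetP[k _ ->]; exact: codom_f.
  rewrite xD /=; apply/andP; split.
    rewrite cardsU1 xD eD card_imset // cardsC1 add1n prednK //.
    by apply/card_gt0P; exists i0.
  apply/dominantP => y.
  have [/codomP[k ->]|yn] := boolP (y \in codom dum).
    exists k => z _; have [->//|] := eqVneq z (dum k).
    by move/rk_low/ltnW.
  exists i0 => z /setU1P[->|]; first exact: xm.
  rewrite eD => /imsetP[k + ->]; rewrite !inE => ki.
  by apply/ltnW/rk_high.
have D0 : D != set0.
  apply: contraNneq neD => e; rewrite -colD e !imset0 //.
have [->|] := set_0Vmem (completions D); first by rewrite cards0.
case=> x0 x0C; have cD := card_room_door x0C.
have [m [i [j [[hm ij mij minj monto] [_ _ domD]]]]] := door_data D0 x0C.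
have ji : j != i by rewrite eq_sym.
have minj' k l : k != j -> l != j -> m k = m l -> k = l.
  have [->|ki] := eqVneq k i; have [->|li] := eqVneq l i => //.
  - by move=> _ lj e; case/eqP: lj; apply/esym; apply: (minj _ _ ji li); rewrite -mij.
  - by move=> kj _ e; case/eqP: kj; apply: (minj _ _ ki ji); rewrite e.
  - by move=> _ _; apply: minj.
have monto' z : z \in D -> exists2 k, k != j & z = m k.
  move=> /monto[k ki zk]; have [kj|] := eqVneq k j; last by exists k.
  by exists i => //; rewrite zk kj mij.
have di := dum_mem_M hm ij mij cD colD neD.
have dj := dum_mem_M hm ji (esym mij) cD colD neD.
have [x [xC xM xmax]] := completion_exists hm monto domD cD di.
have [y [yC yM ymax]] := completion_exists hm monto' domD cD dj.
(* A common value would be above every minimum of [D], against [domD]. *)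
have xy : x != y.
  apply/negP => /eqP e; have [k] := domD x; rewrite leqNgt.
  have [->|ki] := eqVneq k i.
    by move: yM; rewrite -e inE => /forallP/(_ i); rewrite ij /= => ->.
  by move: xM; rewrite inE => /forallP/(_ k); rewrite ki /= => ->.
suff -> : completions D = [set x; y] by rewrite cards2 xy.
apply/eqP; rewrite eqEsubset; apply/andP; split; last first.
  by apply/subsetP => z /set2P[] ->.
apply/subsetP => z zC; rewrite !inE.
have [m' [i' [j' [[hm' ij' mij' _ _] [zM zmax _]]]]] := door_data D0 zC.
have em k : m' k = m k by apply: (@ismin_eq k D).
rewrite !em in mij'.
have i'ij : (i' == i) || (i' == j).
  apply: contraT; rewrite negb_or => /andP[ii jj].
  have [e|ne] := eqVneq j' i.
    by case/eqP: jj; apply: (minj _ _ ii ji); rewrite mij' e mij.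
  by case/eqP: ij'; apply: (minj _ _ ii ne).
case/orP: i'ij => /eqP ei; subst i'.
  have zM' : z \in [set y | [forall k, (k != i) ==> (rk k (m k) < rk k y)]].
    by rewrite inE; apply/forall_inP => k ki; rewrite -em zM.
  have -> : z = x.
    apply: (completion_max zM') xM xmax => w; rewrite inE => /forall_inP hw.
    by apply: zmax => k ki; rewrite em hw.
  by rewrite eqxx.
have zM' : z \in [set y | [forall k, (k != j) ==> (rk k (m k) < rk k y)]].
  by rewrite inE; apply/forall_inP => k ki; rewrite -em zM.
have -> : z = y.
  apply: (completion_max zM') yM ymax => w; rewrite inE => /forall_inP hw.
  by apply: zmax => k ki; rewrite em hw.
by rewrite eqxx orbT.
Qed.

Let typed (i0 : I) X x := col @: (X :\ x) == [set~ i0].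

(** If some point can be removed, then [X] has all colours but [i0], one of them twice, and the
    removable points are the two of that colour. *)
Let even_typed X i0 : room X -> col @: X != setT ->
  ~~ odd #|[set x in X | typed i0 X x]|.
Proof.
move=> /andP[/eqP cX _] ncol.
have [->|[x]] := set_0Vmem [set x in X | typed i0 X x]; first by rewrite cards0.
rewrite inE => /andP[xX /eqP tx].
have cXx : #|X :\ x|.+1 = #|I| by rewrite -cX (cardsD1 x X) xX.
have inj : {in X :\ x &, injective col}.
  by apply/imset_injP; rewrite tx cardsC1 -cXx.
have cx : col x != i0.
  apply: contraNneq ncol => e; rewrite -(setD1K xX) imsetU1 tx e.
  by rewrite setUCr.
have : col x \in col @: (X :\ x) by rewrite tx !inE.
case/imsetP => y yXx cxy; have /setD1P[yx yX] := yXx.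
suff -> : [set x in X | typed i0 X x] = [set x; y] by rewrite cards2 eq_sym yx.
apply/eqP; rewrite eqEsubset; apply/andP; split; last first.
  apply/subsetP => z0 /set2P[] ->; rewrite inE ?xX ?yX /typed.
    by rewrite tx eqxx.
  rewrite -tx; apply/eqP/setP => k; apply/imsetP/imsetP => -[z /setD1P[zy zX] ->].
    have [->|zx] := eqVneq z x; first by exists y.
    by exists z => //; rewrite !inE zx.
  have [->|zy'] := eqVneq z y; first by exists x; rewrite // !inE eq_sym yx.
  by exists z => //; rewrite !inE zy'.
apply/subsetP => z; rewrite !inE => /andP[zX /eqP tz]; apply: contraT.
rewrite negb_or => /andP[zx zy].
have : col z \in col @: (X :\ z).
  by rewrite tz -tx imset_f // !inE zx.
case/imsetP => w /setD1P[wz wX] czw.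
have [e|wx] := eqVneq w x.
  by rewrite e cxy in czw; case/eqP: zy; apply: inj czw; rewrite // !inE zx.
by case/eqP: wz; apply/esym; apply: inj czw; rewrite !inE ?zx ?wx.
Qed.

(* Pairs of a room [X] and a point [x] of [X] such that [X :\ x] has all colours
   but [i0] are counted modulo 2 by the sets [X :\ x]: these lie in two rooms,
   except the set of all dummies but one, which lies in one. *)
Lemma scarf : (0 < #|I|) -> exists2 X, room X & col @: X = setT.
Proof.
move=> /card_gt0P[i0 _].
pose N1 := \sum_(X | room X) #|[set x in X | typed i0 X x]|.
pose N2 := \sum_(D : {set A} | col @: D == [set~ i0]) #|completions D|.
have N12 : N1 = N2.
  pose P X x := [&& room X, x \in X & typed i0 X x].
  transitivity (\sum_x \sum_(X | P X x) 1).
    rewrite (exchange_big_dep xpredT) //= [RHS](bigID (fun X => room X)) /= [X in _ = _ + X]big1 ?addn0.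
      apply: eq_big => [X|X rX]; first by [].
      by rewrite -sum1_card; apply: eq_bigl => x; rewrite !inE /P rX.
    by move=> X nX; rewrite big_pred0 // => x; rewrite /P (negPf nX).
  transitivity (\sum_x \sum_(D : {set A} | (x \in completions D) && (col @: D == [set~ i0])) 1).
    apply: eq_bigr => x _.
    rewrite (reindex_onto (fun D : {set A} => x |: D) (fun X => X :\ x)) /=; last first.
      by move=> X /and3P[_ xX _]; rewrite setD1K.
    apply: eq_bigl => D; rewrite /P /typed !inE eqxx /=.
    have [xD|xD] := boolP (x \in D) => /=.
      apply/negbTE; rewrite negb_and; apply/orP; right; apply/eqP => e.
      by move: xD; rewrite -e !inE eqxx.
    by rewrite setU1K // eqxx andbT.
  rewrite (exchange_big_dep xpredT) //= [LHS](bigID (fun D : {set A} => col @: D == [set~ i0])) /=.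
  rewrite [X in _ + X]big1 ?addn0; last first.
    by move=> D nD; rewrite big_pred0 // => x; rewrite (negPf nD) andbF.
  apply: eq_bigr => D /eqP cD; rewrite sum1_card; apply: eq_card => x.
  by rewrite unfold_in /= cD eqxx andbT.
have odd2 : odd N2.
  pose D0 := dum @: [set~ i0].
  have cD0 : col @: D0 = [set~ i0].
    rewrite -imset_comp -[RHS]imset_id; apply: eq_imset => k /=; exact: col_dum.
  rewrite /N2 (bigD1 D0) /=; last by rewrite cD0.
  rewrite oddD (odd_completions cD0) eqxx /=.
  apply: (big_ind (fun k => ~~ odd k)) => // [a b /negPf ha /negPf hb|D].
    by rewrite oddD ha hb.
  by case/andP=> /eqP cD /negPf nD; rewrite (odd_completions cD) nD.
have [/existsP[X /andP[rX /eqP cX]]|] :=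
    boolP [exists X : {set A}, room X && (col @: X == setT)].
  by exists X.
rewrite negb_exists => /forallP none.
suff : ~~ odd N1 by rewrite N12 odd2.
apply: (big_ind (fun k => ~~ odd k)) => // [a b /negPf ha /negPf hb|X rX].
  by rewrite oddD ha hb.
by apply: even_typed => //; move: (none X); rewrite rX.
Qed.

End Scarf.

(** * Scarf's lemma on the grid points of a simplex *)

Section Grid.
Local Open Scope nat_scope.
Variables d N : nat.
Local Notation I := 'I_d.+1.
Local Notation grid := {ffun I -> 'I_N.+1}.

(** Discrete form of Brouwer's theorem. A room with all colours provides for each [i] a grid point
    of colour [i], unless this colour is carried by the dummy of [i]; then every grid point of the
    room has a small [i]-th coordinate. *)
Lemma grid_cell (c : grid -> I) :
  exists h : I -> grid,
  [/\ forall i, \sum_k h i k = N,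
      forall i k l, h i l <= h k l + d &
      forall i, c (h i) = i \/ h i i <= d].
Proof.
pose T : finType := {g : grid | \sum_k g k == N}.
pose mk (g : grid) (gP : \sum_k g k == N) : T :=
  exist (fun g : grid => \sum_k g k == N) g gP.
pose A : finType := (T + I)%type.
pose K := #|T|.
(* Grid points are ordered by a coordinate, with ties broken by [enum_rank]; the value 0 is kept for
   the dummy of the order itself, and the other dummies come after all grid points. *)
pose rk (i : I) (a : A) : nat := match a with
  | inl g => (val g i * K + enum_rank g).+1
  | inr k => if k == i then 0 else (N.+1 * K + k).+1 end.
pose dum (i : I) : A := inr i.
pose col (a : A) : I := match a with inl g => c (val g) | inr i => i end.
have lt_big (g : T) i : val g i * K + enum_rank g < N.+1 * K.
  have h1 : val g i < N.+1 by [].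
  have h2 : enum_rank g < K by [].
  apply: (@leq_trans ((val g i).+1 * K)); first by rewrite mulSn; lia.
  by rewrite leq_mul2r h1 orbT.
have nd (g : T) : inl g \notin codom dum by apply/negP => /codomP[].
have rk_inj i : injective (rk i).
  move=> [g|k] [g'|k'] //=.
  - case=> e; congr inl; apply: enum_rank_inj; apply: val_inj => /=.
    have h1 : enum_rank g < K by [].
    have h2 : enum_rank g' < K by [].
    move/(congr1 (modn^~ K)): e; rewrite !modnMDl !modn_small //.
  - case: ifP => // _ [] e; have := lt_big g i; rewrite e; lia.
  - case: ifP => // _ [] e; have := lt_big g' i; rewrite -e; lia.
  - case: eqP => [->|_]; case: eqP => [->|_] // [] e.
    by congr inr; apply: val_inj => /=; lia.
have rk_low i a : a != dum i -> rk i (dum i) < rk i a.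
  rewrite /= eqxx; case: a => [//|k] /=; case: (eqVneq k i) => [->|//].
  by rewrite eqxx.
have rk_high i k a : k != i -> a \notin codom dum -> rk i a < rk i (dum k).
  rewrite /dum /= => /negPf ->; case: a => [g _|l]; last by rewrite codom_f.
  have := lt_big g i; rewrite /=; lia.
have g0P : \sum_k (finfun (fun k : I => if k == ord0 then ord_max else ord0) : grid) k == N.
  rewrite (bigD1 ord0) //= ffunE eqxx big1 /= ?addn0 // => k /negPf k0.
  by rewrite ffunE k0.
pose g0 : T := mk _ g0P.
have [||X /andP[_ /forallP domX] colX] :=
    @scarf A I dum rk col rk_inj rk_low rk_high (fun=> erefl).
- by exists (inl g0); apply: nd.
- by rewrite card_ord.
have hcol i : exists2 x, x \in X & i = col x.
  have : i \in [set col x | x in X]%SET by rewrite colX inE.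
  by case/imsetP => x; exists x.
have dom (g : T) : exists2 i, inr i \notin X &
    forall g' : T, inl g' \in X -> val g i <= val g' i.
  have /existsP[i /forall_inP hi] := domX (inl g); exists i.
    by apply/negP => /hi; rewrite /= eqxx.
  move=> g' /hi hh; rewrite leqNgt; apply/negP => lt.
  have h2 : enum_rank g' < K by [].
  have h3 : (val g' i).+1 * K <= val g i * K by rewrite leq_mul2r lt orbT.
  move: (leq_trans h3 (leq_trans (leq_addr (enum_rank g) _) hh)).
  by rewrite mulSn addnC leq_add2l leqNgt h2.
have [i0 i0X _] := dom g0.
have [s sX] : exists s : T, inl s \in X.
  have [[s|k] xX /= e] := hcol i0; first by exists s.
  by rewrite e xX in i0X.
pose C := [set i : I | inr i \notin X]%SET.
pose m (i : I) : nat := val [arg min_(g < s | inl g \in X) val g i] i.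
have [mle mex] : (forall g : T, inl g \in X -> forall i, m i <= val g i) /\
    (forall i, exists2 g : T, inl g \in X & m i = val g i :> nat).
  split=> [g gX i|i]; rewrite /m; case: arg_minnP => // g' g'X h; first exact: h.
  by exists g'.
(* Otherwise the surplus [r], put on the coordinate [i0], yields a grid point above the minima [m i]
   for all [i] in [C], against dominance. *)
have sumC : N < \sum_(i in C) (m i).+1.
  rewrite ltnNge; apply/negP => leN.
  pose r := N - \sum_(i in C) (m i).+1.
  pose f (i : I) := if i \in C then (m i).+1 + (if i == i0 then r else 0) else 0.
  have sf : \sum_i f i = N.
    rewrite -big_mkcond /= big_split /= -big_mkcondr /=.
    rewrite [X in _ + X = _](bigD1 i0) ?inE ?i0X ?eqxx //= [X in _ + (_ + X)]big1; last first.
      by move=> i /andP[/andP[_ /eqP ->]]; rewrite eqxx.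
    by rewrite addn0 subnKC.
  have fle i : f i <= N by rewrite -sf (bigD1 i) //= leq_addr.
  have gP : \sum_k (finfun (fun k : I => inord (f k) : 'I_N.+1) : grid) k == N.
    by rewrite -[X in _ == X]sf; apply/eqP/eq_bigr => k _; rewrite ffunE inordK ?ltnS.
  have [i iX] := dom (mk _ gP).
  have [g gX mg] := mex i.
  move=> /(_ g gX); rewrite /= ffunE inordK ?ltnS // -mg /f inE iX.
  lia.
have cC : #|C| <= d.+1 by have := max_card (mem C); rewrite card_ord.
have sumC' : N <= \sum_(i in C) m i + d.
  move: sumC; under eq_bigr do rewrite -addn1.
  by rewrite big_split /= sum1_card; lia.
have close (g : T) : inl g \in X -> forall i, val g i <= (if i \in C then m i else 0) + d.
  move=> gX i; have /eqP sg := valP g.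
  have h : \sum_(k | k != i) (if k \in C then m k else 0) <= \sum_(k | k != i) val g k.
    by apply: leq_sum => k _; case: ifP => // _; apply: mle.
  rewrite -(leq_add2r (\sum_(k | k != i) val g k)).
  have -> : (val g i + \sum_(k | k != i) val g k)%N = N.
    by rewrite -[RHS]sg [RHS](bigD1 i).
  apply: leq_trans sumC' _; rewrite big_mkcond (bigD1 i) //= -addnA [X in _ <= X]addnAC -addnA.
  by rewrite leq_add2l leq_add2r.
have pick i : exists g : T, inl g \in X /\ (c (val g) = i \/ val g i <= d).
  have [iC|iC] := boolP (i \in C); last first.
    by exists s; split=> //; right; have := close s sX i; rewrite (negPf iC).
  have [[g|k] gX e] := hcol i; first by exists g; split=> //; left.
  by move: iC; rewrite inE e /= gX.
have [h hP] := choice pick.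
exists (fun i => val (h i)); split=> [i|i k l|i].
- exact/eqP/(valP (h i)).
- apply: leq_trans (close _ (proj1 (hP i)) l) _; rewrite leq_add2r.
  by case: ifP => // _; apply: mle; case: (hP k).
- by case: (hP i).
Qed.

End Grid.

(** * Norms and continuity on row vectors *)

Section RowVectors.
Context {R : realType}.

Lemma coord_le_norm m (x : 'rV[R]_m) j : `|x 0 j| <= `|x|.
Proof.
rewrite [leRHS]/Num.norm /= mx_normrE.
exact: (le_bigmax _ (fun ij => `|x ij.1 ij.2|) (0, j)).
Qed.

Lemma norm_rV_le m (x : 'rV[R]_m) c :
  0 <= c -> (forall j, `|x 0 j| <= c) -> `|x| <= c.
Proof.
move=> c0 h; rewrite /Num.norm /= mx_normrE; apply/bigmax_leP; split=> //.
by move=> [i j] _ /=; rewrite ord1.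
Qed.

Lemma norm_rV_lt m (x : 'rV[R]_m) c :
  0 < c -> (forall j, `|x 0 j| < c) -> `|x| < c.
Proof.
move=> c0 h; rewrite /Num.norm /= mx_normrE; apply/bigmax_ltP; split=> //.
by move=> [i j] _ /=; rewrite ord1.
Qed.

Lemma lipschitz_continuous (V W : normedModType R) (f : V -> W) k :
  (forall x y, `|f x - f y| <= k * `|x - y|) -> continuous f.
Proof.
move=> hf x; apply/cvgrPdist_lt => e e0.
have k1 : 0 < `|k| + 1 by rewrite ltr_wpDl.
near=> y; apply: le_lt_trans (hf x y) _.
apply: le_lt_trans (_ : (`|k| + 1) * `|x - y| < _).
  by rewrite ler_wpM2r // (le_trans (ler_norm k)) // lerDl.
rewrite -ltr_pdivlMl //; near: y.
have r0 : 0 < (`|k| + 1)^-1 * e by rewrite mulr_gt0 // invr_gt0.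
by have := nbhsx_ballx x _ r0; rewrite -ball_normE.
Unshelve. all: by end_near. Qed.

Lemma mulmx_continuous m n (M : 'M[R]_(m, n)) :
  continuous (fun x : 'rV[R]_m => x *m M).
Proof.
apply: (@lipschitz_continuous _ _ _ (\sum_i \sum_j `|M i j|)) => x y.
rewrite -mulmxBl mulrC; apply: norm_rV_le => [|j].
  by rewrite mulr_ge0 // sumr_ge0 // => i _; rewrite sumr_ge0.
rewrite mxE mulr_sumr; apply: le_trans (ler_norm_sum _ _ _) _.
apply: ler_sum => i _; rewrite normrM.
apply: ler_pM => //; first exact: coord_le_norm.
by rewrite (bigD1 j) //= lerDl sumr_ge0.
Qed.

Lemma functional_continuous m (u : 'cV[R]_m) :
  continuous (fun x : 'rV[R]_m => (x *m u) 0 0).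
Proof.
have c : continuous ((fun y : 'M[R]_(1, 1) => y 0 0) \o (fun x => x *m u)).
  move=> x; apply: continuous_comp; first exact: mulmx_continuous.
  exact: coord_continuous.
exact: c.
Qed.

End RowVectors.

Section Brouwer.
Context {R : realType} {d : nat}.
Implicit Types (z w : 'rV[R]_d).

(* Barycentric coordinates of the corner simplex of R^d, the origin being the
   vertex of index 0. *)
Let bary z (i : 'I_d.+1) : R :=
  if unlift ord0 i is Some j then z 0 j else 1 - \sum_j z 0 j.

Let corner : set 'rV[R]_d := [set z | forall i, 0 <= bary z i].

Let bary0 z : bary z ord0 = 1 - \sum_j z 0 j.
Proof. by rewrite /bary unlift_none. Qed.

Let baryS z j : bary z (lift ord0 j) = z 0 j.
Proof. by rewrite /bary liftK. Qed.

Let sum_bary z : \sum_i bary z i = 1.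
Proof.
rewrite big_ord_recl bary0 [X in _ + X](eq_bigr (fun j => z 0 j)) ?subrK //.
Qed.

Let bary_continuous i : continuous (fun z => bary z i).
Proof.
case: (unliftP ord0 i) => [j ->|->].
  rewrite (_ : (fun z => _) = (fun z => z 0 j)); last first.
    by apply/funext => z; rewrite baryS.
  exact: (@coord_continuous R 1 d 0 j).
rewrite (_ : (fun z => _) = (fun z => 1 - (z *m const_mx 1 : 'rV_1) 0 0)); last first.
  apply/funext => z; rewrite bary0 mxE; congr (_ - _).
  by apply: eq_bigr => j _; rewrite mxE mulr1.
move=> z; apply: continuousB; first exact: cst_continuous.
exact: functional_continuous.
Qed.

Let corner_compact : compact corner.
Proof.
apply: bounded_closed_compact.
  exists 1; split=> // M M1 z /= hz.
  apply: norm_rV_le => [|j]; first lra.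
  rewrite ger0_norm; last by rewrite -baryS.
  rewrite -baryS; apply: le_trans (ltW M1); rewrite -(sum_bary z).
  by rewrite (bigD1 (lift ord0 j)) //= lerDl sumr_ge0.
rewrite (_ : corner = \bigcap_i ((fun z => bary z i) @^-1` [set r | 0 <= r])).
  apply: closed_bigI => i _; apply: closed_comp => [z _|]; last exact: closed_ge.
  exact: bary_continuous.
by apply/seteqP; split=> z hz; [move=> i _; apply: hz|move=> i; apply: hz].
Qed.

(** Without a fixed point, some barycentric coordinate drops at each point because the sum is 1, and
    by compactness it drops by more than a uniform [e] on a whole ball of radius [e]. Colour the
    grid points by a coordinate that does not drop. In the small cell given by [grid_cell], the
    coordinate [i] that drops around [h ord0] also drops at [h i]; but there it does not drop, or is
    at most [d / N < e]. *)
Lemma brouwer_corner (G : 'rV[R]_d -> 'rV[R]_d) :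
  continuous G -> (forall z, corner (G z)) -> exists z, G z = z.
Proof.
move=> cG hG; apply: contrapT => nfix.
have drop z : exists i, bary (G z) i < bary z i.
  apply: contrapT => h; apply: nfix; exists z.
  have le i : bary z i <= bary (G z) i.
    by rewrite leNgt; apply/negP => lt; apply: h; exists i.
  have eq i : bary (G z) i = bary z i.
    apply/eqP; rewrite eq_sym; have /eqP := sum_bary (G z).
    rewrite -(sum_bary z) eq_sym => /eqP/esym.
    move=> /eqP; rewrite -subr_eq0 -sumrB psumr_eq0; last first.
      by move=> k _; rewrite subr_ge0.
    by move=> /allP/(_ i); rewrite mem_index_enum subr_eq0 eq_sym; apply.
  by apply/rowP => j; rewrite -baryS eq baryS.
pose P (e : R) z := exists i, forall w, `|z - w| < e -> bary (G w) i < bary w i - e.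
have : \forall e \near 0^'+, corner `<=` P e.
  move/compact_near_coveringP: corner_compact; apply => x _.
  have [i hi] := drop x.
  pose g w := bary w i - bary (G w) i.
  have cg : {for x, continuous g}.
    apply: continuousB; first exact: bary_continuous.
    apply: (@continuous_comp _ _ _ G (fun z => bary z i)); first exact: cG.
    exact: bary_continuous.
  pose t := g x / 2; have t0 : 0 < t by rewrite divr_gt0 // subr_gt0.
  have : \forall w \near x, t < g w.
    move/cvgrPdist_lt: cg => /(_ _ t0); apply: filterS => w.
    by rewrite ltr_norml => /andP[_]; rewrite /t; lra.
  case/nbhs_ballP => r /= r0 hr.
  exists (ball x (r / 2), [set e | 0 < e < Num.min (r / 2) t]).
    split=> /=; first by apply: nbhsx_ballx; rewrite divr_gt0.
    near=> e; apply/andP; split=> //; near: e; apply: nbhs_right_lt.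
    by rewrite lt_min t0 divr_gt0.
  move=> [z e] [/= xz /andP[e0]]; rewrite lt_min => /andP[er et]; exists i => w zw.
  suff : t < g w by rewrite /g => h; lra.
  apply: hr; rewrite [r]splitr; apply: ball_triangle xz _.
  by rewrite -ball_normE /=; apply: lt_trans er.
move=> he.
have [e [e0 hP]] : exists e : R, 0 < e /\ corner `<=` P e.
  near (0 : R)^'+ => e; exists e; split; first by [].
  by near: e.
pose N := (Num.bound (d%:R / e)).+1.
have N0 : 0 < N%:R :> R by rewrite ltr0n.
have dN : d%:R / N%:R < e.
  rewrite ltr_pdivrMr // mulrC -ltr_pdivrMr //.
  apply: lt_trans (unstable.ltr_bound _) _; rewrite ltr_nat //.
pose pt (g : {ffun 'I_d.+1 -> 'I_N.+1}) : 'rV[R]_d :=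
  \row_j ((g (lift ord0 j) : nat)%:R / N%:R).
have bary_pt (g : {ffun 'I_d.+1 -> 'I_N.+1}) : (\sum_k g k = N)%N -> forall i, bary (pt g) i = (g i : nat)%:R / N%:R.
  move=> sg i; case: (unliftP ord0 i) => [j ->|->]; first by rewrite baryS mxE.
  rewrite bary0; under eq_bigr do rewrite mxE.
  rewrite -mulr_suml -natr_sum -{1}(divff (lt0r_neq0 N0)) -mulrBl; congr (_ / _).
  by rewrite -[X in X%:R - _]sg big_ord_recl natrD addrK.
have exc (g : {ffun 'I_d.+1 -> 'I_N.+1}) :
    exists i, (\sum_k g k = N)%N -> bary (pt g) i <= bary (G (pt g)) i.
  apply: contrapT => h.
  have : \sum_i bary (G (pt g)) i < \sum_i bary (pt g) i.
    apply: ltr_sum; first by apply/hasP; exists ord0; rewrite // mem_index_enum.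
    move=> i _; rewrite ltNge; apply/negP => le; apply: h; by exists i.
  by rewrite !sum_bary ltxx.
have [c hc] := choice exc.
have [h [hs hh hl]] := grid_cell c.
have corner_pt i : corner (pt (h i)).
  by move=> k; rewrite bary_pt // divr_ge0.
have [i hi] := hP _ (corner_pt ord0).
have : `|pt (h ord0) - pt (h i)| < e.
  apply: le_lt_trans dN.
  apply: norm_rV_le => [|j]; first by rewrite divr_ge0.
  rewrite !mxE -mulrBl normrM.
  rewrite [X in _ * X]ger0_norm ?invr_ge0 // ler_pM2r ?invr_gt0 //.
  rewrite ler_norml; apply/andP; split.
    rewrite lerNl opprB lerBlDr -natrD ler_nat addnC; exact: hh.
  by rewrite lerBlDr -natrD ler_nat addnC; exact: hh.
move/hi; rewrite ltNge => /negP; apply.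
case: (hl i) => [e1|le].
  rewrite lerBlDr; apply: le_trans (_ : bary (G (pt (h i))) i <= _).
    by have := hc (h i) (hs i); rewrite e1.
  by rewrite lerDl ltW.
rewrite lerBlDr; apply: le_trans (_ : e <= _); last by rewrite lerDr hG.
rewrite bary_pt //; apply: le_trans (ltW dN).
by rewrite ler_pM2r ?invr_gt0 // ler_nat.
Unshelve. all: by end_near. Qed.

End Brouwer.

Theorem brouwer (R : realType) (d : nat) (G : 'rV[R]_d -> 'rV[R]_d) :
  continuous G -> (forall z, `|G z| <= 1) -> exists z, G z = z.
Proof.
case: d G => [|d] G cG hG.
  by exists 0; apply/rowP => -[].
pose D : R := d.+1%:R *+ 2.
have D0 : 0 < D by rewrite pmulrn_lgt0 // ltr0n.
(* With [n = d.+1] coordinates, [g] maps the cube [[-1, 1]^n] onto [[0, 1/n]^n], which lies in the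
   corner simplex. *)
pose f (z : 'rV[R]_d.+1) : 'rV[R]_d.+1 := D *: z - const_mx 1.
pose g (z : 'rV[R]_d.+1) : 'rV[R]_d.+1 := D^-1 *: (z + const_mx 1).
have fg z : f (g z) = z.
  by rewrite /f /g scalerA mulfV ?gt_eqF // scale1r addrK.
have [||z hz] := @brouwer_corner R d.+1 (g \o G \o f); last first.
- by exists (f z); rewrite -{2}hz fg.
- move=> z; rewrite /comp; have hG' j : -1 <= G (f z) 0 j <= 1.
    by rewrite -ler_norml; apply: le_trans (hG (f z)); apply: coord_le_norm.
  have ge j : 0 <= g (G (f z)) 0 j.
    rewrite !mxE mulr_ge0 ?invr_ge0 ?(ltW D0) //.
    by have /andP[h _] := hG' j; rewrite -lerBlDr sub0r.
  move=> i; case: unliftP => [j _|_]; first exact: ge.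
  rewrite subr_ge0; apply: le_trans (_ : \sum_(j < d.+1) (d.+1%:R)^-1 <= _).
    apply: ler_sum => j _; rewrite !mxE mulrC ler_pdivrMr //.
    rewrite /D -[X in _ <= _ * X]mulr_natr mulrA mulVf ?pnatr_eq0 // mul1r.
    by have /andP[_ h] := hG' j; rewrite mulr2n lerD2r.
  by rewrite sumr_const card_ord -[X in X <= _]mulr_natr mulVf ?pnatr_eq0.
- move=> z; apply: (@continuous_comp _ _ _ f (g \o G)).
    apply: continuousB; last exact: cst_continuous.
    exact: scaler_continuous.
  apply: (@continuous_comp _ _ _ G g); first exact: cG.
  apply: (@lipschitz_continuous _ _ _ _ `|D^-1|) => x y.
  by rewrite -scalerBr opprD addrACA subrr addr0 normrZ.
Qed.

(** * Invariance of domain *)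

Section InvarianceOfDomain.
Context {R : realType}.

(* A Lipschitz image of the boundary of a cube of R^d, which is covered by
   O(N^(d-1)) cubes of size 1/N, has empty interior. *)
Lemma lipschitz_misses d (P : 'rV[R]_d -> 'rV[R]_d) L c r t :
  (forall y z, `|P y - P z| <= L * `|y - z|) -> 0 < r -> 0 < t ->
  exists2 e, `|e| < t & forall y, `|y - c| = r -> P y <> e.
Proof.
move=> lipP r0 t0; apply: contrapT => nex.
have hit e : exists y, `|e| < t -> `|y - c| = r /\ P y = e.
  apply: contrapT => h; apply: nex; exists e.
    by apply: contrapT => h'; apply: h; exists 0.
  by move=> y yc Pe; apply: h; exists y.
have [yy hy] := choice hit => {hit nex}.
case: d P c lipP yy hy => [|k] P c lipP yy hy.
  have [|+ _] := hy 0; first by rewrite normr0.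
  rewrite (_ : yy 0 - c = 0) ?normr0; last by apply/rowP => -[].
  by move=> r_eq; rewrite r_eq ltxx in r0.
have L0 : 0 <= L.
  rewrite leNgt; apply/negP => L0; have := lipP (const_mx 1) 0.
  rewrite subr0; apply/negP; rewrite -ltNge; apply: lt_le_trans (normr_ge0 _).
  rewrite nmulr_rlt0 // normr_gt0; apply/negP => /eqP/rowP/(_ ord0).
  by rewrite !mxE => /eqP; rewrite oner_eq0.
(* [K] ensures that preimages at distance at most [2 * r / m] have images at distance less than
   [t / q], the mesh of the grid of points [e g]. The choice of [q] makes these [q ^ k.+1] points
   more numerous than the [2 * k.+1 * m.+1 ^ k] codes. *)
pose K := (Num.bound (2 * r * L / t)).+1.
have hK : 2 * r * L / t < K%:R.
  apply: lt_trans (unstable.ltr_bound _) _; rewrite ltr_nat //.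
pose q := (2 * k.+1 * K.+1 ^ k).+1.
have q0 : 0 < q%:R :> R by rewrite ltr0n.
pose m := (K * q)%N.
have m0 : 0 < m%:R :> R by rewrite ltr0n /m muln_gt0.
pose e (g : {ffun 'I_k.+1 -> 'I_q}) : 'rV[R]_k.+1 :=
  \row_j (t * (g j : nat)%:R / q%:R).
have e_lt g : `|e g| < t.
  apply: norm_rV_lt => // j; rewrite mxE ger0_norm; last first.
    by rewrite divr_ge0 // mulr_ge0 // ltW.
  by rewrite ltr_pdivrMr // ltr_pM2l // ltr_nat.
pose y g := yy (e g) - c.
have yn g : `|y g| = r by have [] := hy _ (e_lt g).
have Pe g : P (yy (e g)) = e g by have [] := hy _ (e_lt g).
have ex_i g : exists i, `|y g 0 i| = r.
  apply: contrapT => h.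
  suff : `|y g| < r by rewrite yn ltxx.
  apply: norm_rV_lt => // i; rewrite lt_neqAle -[X in _ <= X](yn g) coord_le_norm andbT.
  by apply/eqP => e1; apply: h; exists i.
have [ii hi] := choice ex_i.
have ylim g j : - r <= y g 0 j <= r by rewrite -ler_norml -[X in _ <= X](yn g) coord_le_norm.
pose f g j := Num.truncn ((y g 0 j + r) * m%:R / (2 * r)).
have r2 : 0 < 2 * r by rewrite mulr_gt0.
have fpos g j : 0 <= (y g 0 j + r) * m%:R / (2 * r).
  by apply: divr_ge0; rewrite ?(ltW r2) // mulr_ge0 // -lerBlDr sub0r; case/andP: (ylim g j).
have f_le g j : (f g j <= m)%N.
  rewrite -(ler_nat R); have /andP[+ _] := Num.Theory.truncn_itv (fpos g j).
  move=> h; apply: le_trans h _; rewrite ler_pdivrMr // mulrC ler_pM2l //.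
  by rewrite mulr2n mulrDl !mul1r lerD2r; case/andP: (ylim g j).
(* A boundary point of the cube is coded by a face, that is a coordinate of absolute value [r] and
   its sign, and by a cell of size [2 * r / m] in that face. *)
pose code g : 'I_k.+1 * bool * {ffun 'I_k -> 'I_m.+1} :=
  (ii g, 0 <= y g 0 (ii g), [ffun j => inord (f g (lift (ii g) j))]).
have close g g' j : f g j = f g' j -> `|y g 0 j - y g' 0 j| <= 2 * r / m%:R.
  move=> fe; have := Num.Theory.truncn_itv (fpos g j).
  have := Num.Theory.truncn_itv (fpos g' j); rewrite -/(f g j) -/(f g' j) fe.
  set a := _ * _ / _ => /andP[a1 a2]; set b := _ * _ / _ => /andP[b1 b2].
  have -> : y g 0 j - y g' 0 j = (b - a) * (2 * r / m%:R).
    by rewrite /a /b; field; rewrite !gt_eqF.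
  rewrite normrM [X in _ * X]ger0_norm; last by rewrite divr_ge0 // ltW.
  rewrite ler_piMl //; first by rewrite divr_ge0 // ltW.
  rewrite -[X in (_ < X%:R)%R]addn1 natrD in a2 b2.
  by rewrite ler_norml; lra.
suff inj : injective code.
  have := leq_card _ inj; rewrite card_ffun !card_prod card_bool !card_ffun !card_ord.
  rewrite leqNgt => /negP; apply.
  have h1 : (m.+1 ^ k <= (K.+1 * q) ^ k)%N.
    by case: (k) => [|k'] //; rewrite leq_exp2r // mulSn; lia.
  apply: (@leq_ltn_trans (k.+1 * 2 * (K.+1 * q) ^ k)); first by rewrite leq_mul2l h1 orbT.
  rewrite expnMn expnS mulnA ltn_pmul2r ?expn_gt0 //.
  by rewrite /q ltnS [(k.+1 * 2)%N]mulnC.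
move=> g g' ce.
have [cei ces cef] : [/\ ii g = ii g', (0 <= y g 0 (ii g)) = (0 <= y g' 0 (ii g')) &
   forall j, f g (lift (ii g) j) = f g' (lift (ii g) j)].
  case: ce => h1 h2 /ffunP h3; split=> // j.
  move: (h3 j); rewrite !ffunE -h1 => /(congr1 val) /=.
  by rewrite !inordK ?ltnS // f_le.
have yd : `|y g - y g'| <= 2 * r / m%:R.
  apply: norm_rV_le => [|j]; first by rewrite divr_ge0 // ltW.
  rewrite !mxE; case: (unliftP (ii g) j) => [j' ->|->].
    by have := close _ _ _ (cef j'); rewrite !mxE.
  have : y g 0 (ii g) = y g' 0 (ii g).
    rewrite -cei in ces; have := hi g; have := hi g'; rewrite -cei.
    have [h1|h1] := lerP 0 (y g 0 (ii g)).
      by rewrite h1 in ces; rewrite !ger0_norm // => -> ->.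
    rewrite leNgt h1 /= in ces; move/esym/negbT: ces; rewrite -ltNge => h2.
    by rewrite !ltr0_norm // => h3 h4; apply: oppr_inj; rewrite h3 h4.
  rewrite !mxE => ->; rewrite subrr normr0 divr_ge0 // ltW //.
have ed : `|e g - e g'| < t / q%:R.
  have := lipP (yy (e g)) (yy (e g')); rewrite !Pe => /le_lt_trans; apply.
  rewrite (_ : yy (e g) - yy (e g') = y g - y g'); last first.
    by rewrite /y opprB addrA subrK.
  apply: le_lt_trans (ler_wpM2l L0 yd) _.
  rewrite /m natrM; move: hK; rewrite ltr_pdivrMr // => hK.
  rewrite (_ : L * _ = (2 * r * L) / K%:R / q%:R); last first.
    by field; rewrite !pnatr_eq0.
  by rewrite ltr_pM2r ?invr_gt0 // ltr_pdivrMr ?ltr0n // [t * _]mulrC.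
apply/ffunP => j; apply: val_inj => /=; apply: contrapT => ne.
have : `|e g 0 j - e g' 0 j| < t / q%:R.
  by apply: le_lt_trans ed; have := coord_le_norm (e g - e g') j; rewrite !mxE.
rewrite !mxE -!mulrA -mulrBr -mulrBl normrM gtr0_norm // ltr_pM2l // normrM.
rewrite [X in _ * X]gtr0_norm ?invr_gt0 // -[X in _ < X]mul1r ltr_pM2r ?invr_gt0 //.
have : (1 : R) <= `|(g j : nat)%:Z - (g' j : nat)%:Z|%:~R.
  rewrite -[1]/(1%:~R) ler_int; have : (g j : nat)%:Z - (g' j : nat)%:Z != 0.
    by rewrite subr_eq0; apply/eqP => -[].
  by rewrite -normr_gt0.
by rewrite intr_norm rmorphB /= => h1 h2; move: (le_lt_trans h1 h2); rewrite ltxx.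
Qed.

Definition ball1 d : set 'rV[R]_d := [set x | `|x| <= 1].

Lemma ball1_compact d : compact (@ball1 d).
Proof.
apply: bounded_closed_compact.
  by exists 1; split=> // M M1 z /= hz; apply: le_trans hz (ltW M1).
rewrite (_ : @ball1 d = (fun x => `|x|) @^-1` [set r | r <= 1]) //.
apply: closed_comp => [x _|]; [exact: norm_continuous|exact: closed_le].
Qed.

(** Uniform continuity of the inverse, by a covering argument on pairs: a pair is either closer than
    [a], or its images are distinct and remain apart nearby. *)
Lemma uniform_inverse d (f : 'rV[R]_d -> 'rV[R]_d) (a : R) : continuous f ->
  {in @ball1 d &, injective f} -> 0 < a -> exists2 b, 0 < b &
  forall x y, ball1 x -> ball1 y -> `|f x - f y| < b -> `|x - y| < a.
Proof.
move=> cf inj a0.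
pose Q (b : R) (p : 'rV[R]_d * 'rV[R]_d) :=
  `|f p.1 - f p.2| < b -> `|p.1 - p.2| < a.
have : \forall b \near 0^'+, @ball1 d `*` @ball1 d `<=` Q b.
  have /compact_near_coveringP := compact_setX (@ball1_compact d) (@ball1_compact d).
  apply => -[x y] [/= hx hy].
  have cvn (g : 'rV[R]_d -> 'rV[R]_d) : continuous g ->
      {for (x, y), continuous (fun p => `|g p.1 - g p.2|)}.
    move=> cg; apply: (@continuous_comp _ _ _ (fun p => g p.1 - g p.2) Num.norm).
      apply: continuousB.
        by apply: (@continuous_comp _ _ _ fst g); [exact: cvg_fst|exact: cg].
      by apply: (@continuous_comp _ _ _ snd g); [exact: cvg_snd|exact: cg].
    exact: norm_continuous.
  have [xy|xy] := ltP `|x - y| a.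
    have /cvgrPdist_lt := cvn id (fun x => cvg_id).
    move=> /(_ (a - `|x - y|)); rewrite subr_gt0 => /(_ xy) h.
    exists ([set p | `|(`|x - y|) - `|p.1 - p.2| | < a - `|x - y|], setT).
      by split=> //=; apply: filterT.
    move=> [p b] [/= h1 _] _; move: h1; rewrite distrC => /(le_lt_trans (ler_norm _)).
    by rewrite ltrD2r.
  have fxy : 0 < `|f x - f y| / 2.
    rewrite divr_gt0 // normr_gt0 subr_eq0; apply/eqP => e.
    have xy0 := inj _ _ (mem_set hx) (mem_set hy) e.
    by move: xy; rewrite xy0 subrr normr0 leNgt a0.
  have /cvgrPdist_lt/(_ _ fxy) h := cvn f cf.
  exists ([set p | `|(`|f x - f y|) - `|f p.1 - f p.2| | < `|f x - f y| / 2],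
     [set b | b < `|f x - f y| / 2]).
    by split=> //=; apply: nbhs_right_lt.
  move=> [p b] [/= h1 h2] h3; exfalso.
  have := le_lt_trans (ler_norm _) h1; rewrite /= in h3 *.
  by lra.
move=> hb.
have [b [b0 hQ]] : exists b : R, 0 < b /\ @ball1 d `*` @ball1 d `<=` Q b.
  near (0 : R)^'+ => b; exists b; split; first by [].
  by near: b.
by exists b => // x y hx hy; apply: (hQ (x, y)).
Unshelve. all: by end_near. Qed.

(** Each coordinate of [P y] is the infimum of [x 0 j + L * |y - f x|] over the cube, which is
    Lipschitz in [y] and defined everywhere. With [L = 2 / b], a point whose image is at distance at
    least [b] pays a penalty of at least 2, the width of the cube, so only points close to the true
    preimage compete. *)
Lemma lipschitz_inverse d (f : 'rV[R]_d -> 'rV[R]_d) (a : R) : continuous f ->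
  {in @ball1 d &, injective f} -> 0 < a ->
  exists P : 'rV[R]_d -> 'rV[R]_d, exists2 L,
  forall y z, `|P y - P z| <= L * `|y - z| &
  forall x, ball1 x -> `|P (f x) - x| <= a.
Proof.
move=> cf inj a0; have [b b0 hb] := uniform_inverse cf inj a0.
pose L := 2 / b; have L0 : 0 < L by rewrite divr_gt0.
pose S y j := [set x 0 j + L * `|y - f x| | x in @ball1 d].
have Sge y j : lbound (S y j) (-1).
  move=> _ [x hx <-]; apply: (@le_trans _ _ (x 0 j)).
    by have := le_trans (coord_le_norm x j) hx; rewrite ler_norml => /andP[].
  by rewrite lerDl mulr_ge0 // ltW.
have b10 : @ball1 d 0 by rewrite /ball1 /= normr0.
have Sne y j : S y j !=set0 by eexists; exists 0.
have Sinf y j : has_inf (S y j) by split=> //; exists (-1).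
pose P y : 'rV[R]_d := \row_j inf (S y j).
have half y z j : P y 0 j - P z 0 j <= L * `|y - z|.
  rewrite !mxE lerBlDr -lerBlDl; apply: lb_le_inf => // _ [x hx <-].
  rewrite lerBlDl; apply: le_trans (_ : x 0 j + L * `|y - f x| <= _).
    by apply: ge_inf => //; [exists (-1)|exists x].
  rewrite addrCA lerD2l -mulrDr ler_wpM2l ?(ltW L0) //.
  by rewrite (le_trans _ (ler_normD _ _)) // addrA subrK.
exists P, L => [y z|x hx].
  apply: norm_rV_le => [|j]; first by rewrite mulr_ge0 // ltW.
  rewrite mxE [X in _ + X]mxE ler_norml half andbT.
  by rewrite lerNl opprB distrC half.
apply: norm_rV_le => [|j]; first exact: ltW.
rewrite !mxE ler_norml; apply/andP; split; last first.
  rewrite lerBlDr; apply: le_trans (_ : x 0 j <= _); last by rewrite lerDr ltW.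
  by apply: ge_inf; [exists (-1)|exists x => //; rewrite subrr normr0 mulr0 addr0].
rewrite lerBrDr; apply: lb_le_inf => // _ [y hy <-].
have [lt|ge] := ltP `|f x - f y| b.
  have := le_trans (coord_le_norm (x - y) j) (ltW (hb _ _ hx hy lt)).
  rewrite !mxE ler_norml => /andP[_]; have : 0 <= L * `|f x - f y|.
    by rewrite mulr_ge0 // ltW.
  by move=> h1 h2; lra.
have h2 : 2 <= L * `|f x - f y|.
  by apply: le_trans (_ : L * b <= _); rewrite ?ler_pM2l // /L divfK // gt_eqF.
have := le_trans (coord_le_norm x j) hx; have := le_trans (coord_le_norm y j) hy.
by rewrite !ler_norml => /andP[h3 _] /andP[_ h4]; lra.
Qed.

End InvarianceOfDomain.

Section InvarianceOfDomain.
Context {R : realType}.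

Lemma norm_comp_continuous (T : topologicalType) d (f : T -> 'rV[R]_d) x :
  {for x, continuous f} -> {for x, continuous (fun y => `|f y|)}.
Proof.
move=> cf; apply: (@continuous_comp _ _ _ f Num.norm); first exact: cf.
exact: norm_continuous.
Qed.

(* If the image of a cube around [c] missed points [c0] arbitrarily close to
   [h c], one could modify a Lipschitz approximation of the inverse map, by
   composing it with a push away from [c0], into a zero-free map [V] such that
   [V (f x)] is at distance at most 1 of [x]; then [x - V (f x)] contradicts
   Brouwer's theorem. *)
Theorem invariance_of_domain d (W : set 'rV[R]_d) (h : 'rV[R]_d -> 'rV[R]_d) c :
  nbhs c W -> (forall x, W x -> {for x, continuous h}) ->
  {in W &, injective h} -> nbhs (h c) (h @` W).
Proof.
move=> /nbhs_ballP[r0 /= r00 hW] ch inj.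
pose r := r0 / 2; have r_gt0 : 0 < r by rewrite divr_gt0.
(* A retraction onto the unit cube, which extends the problem to maps defined on the whole space as
   Brouwer's theorem requires. *)
pose cl (x : 'rV[R]_d) := (Num.max 1 `|x|)^-1 *: x.
have max1 (x : 'rV[R]_d) : 0 < Num.max 1 `|x| by rewrite lt_max ltr01.
have cl_le x : `|cl x| <= 1.
  rewrite normrZ ger0_norm ?invr_ge0 ?(ltW (max1 x)) //.
  by rewrite mulrC ler_pdivrMr // mul1r le_max lexx orbT.
have cl_id x : `|x| <= 1 -> cl x = x.
  by move=> x1; rewrite /cl max_l // invr1 scale1r.
have cl_cont : continuous cl.
  move=> x; apply: (@continuousZ _ _ _ (fun x => (Num.max 1 `|x|)^-1) id).
    apply: (@continuousV _ _ (fun x => Num.max 1 `|x|)); first by rewrite gt_eqF.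
    apply: (@continuous_max _ _ (cst 1) Num.norm); first exact: cst_continuous.
    exact: norm_continuous.
  exact: cvg_id.
have inW x : W (c + r *: cl x).
  apply: hW; rewrite -ball_normE /= opprD addNKr normrN normrZ gtr0_norm //.
  rewrite /r mulrC (le_lt_trans (ler_piMl _ (cl_le x))) ?(ltW r_gt0) //.
  by rewrite ltr_pdivrMr // ltr_pMr // ltr1n.
pose f x := h (c + r *: cl x).
have cf : continuous f.
  move=> x; apply: (@continuous_comp _ _ _ (fun x => c + r *: cl x) h); last exact: ch.
  apply: (@continuousD _ _ _ (cst c) (fun x => r *: cl x)).
    exact: cst_continuous.
  by apply: (@continuousZ _ _ _ (cst r) cl); [exact: cst_continuous|exact: cl_cont].
have f_cl x : f (cl x) = f x by rewrite /f [cl (cl x)]cl_id.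
have f_inj : {in @ball1 R d &, injective f}.
  move=> x y; rewrite !inE /= => hx hy fxy.
  have := inj _ _ (mem_set (inW x)) (mem_set (inW y)) fxy.
  by move/addrI/(scalerI (lt0r_neq0 r_gt0)); rewrite !cl_id.
have b10 : @ball1 R d 0 by rewrite /ball1 /= normr0.
have f0 : f 0 = h c by rewrite /f cl_id // scaler0 addr0.
apply: contrapT => nW.
have a1 : 0 < (10%:R : R)^-1 by rewrite invr_gt0.
have [b b0 hb] := uniform_inverse cf f_inj a1.
(* With [b = 3 * ep], the bound [N x < 2 * ep] keeps [f x] within [2 * ep + ep / 2 < b] of [f 0], so
   that [cl x] has norm less than 1/10. *)
pose ep := b / 3; have ep0 : 0 < ep by rewrite divr_gt0.
have [dl [dl0 dl1 hdl]] : exists dl : R, [/\ 0 < dl, dl <= 10%:R^-1 &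
    forall x, `|x| < dl -> `|f x - f 0| < ep / 2].
  have ep2 : 0 < ep / 2 by rewrite divr_gt0.
  have /cvgrPdist_lt/(_ _ ep2) := cf 0.
  move/nbhs_ballP => [a /= a0 ha]; exists (Num.min a 10%:R^-1).
  split; [by rewrite lt_min a0|by rewrite ge_min lexx orbT|].
  move=> x; rewrite lt_min => /andP[xa _]; rewrite distrC; apply: ha.
  by rewrite -ball_normE /= sub0r normrN.
have [c0 c0f nc0] : exists2 c0, `|c0 - f 0| < ep / 2 & forall x, f x <> c0.
  apply: contrapT => hn; apply: nW; apply/nbhs_ballP; exists (ep / 2) => /=.
    by rewrite divr_gt0.
  move=> y; rewrite -ball_normE /= => hy; apply: contrapT => ny; apply: hn.
  exists y; first by rewrite distrC f0.
  by move=> x fx; apply: ny; exists (c + r *: cl x).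
have dl4 : 0 < dl / 4 by rewrite divr_gt0.
have [P [L lipP hP]] := lipschitz_inverse cf f_inj dl4.
have [e el he] := lipschitz_misses c0 lipP ep0 dl4.
pose N x := `|f x - c0|.
have N0 x : 0 < N x by rewrite normr_gt0 subr_eq0; apply/eqP.
(* [Phi] pushes the values of [f] away from [c0] to distance at least [ep]. Those that move land on
   the sphere of radius [ep], where [P] avoids [e]. *)
pose Phi x := c0 + Num.max (ep / N x) 1 *: (f x - c0).
pose v x := P (Phi x) - e.
(* A bound for the norm of [V]: 1/2 near [c0], where [v] is nonzero but not controlled, and more
   than 2 once [N x >= 2 * ep], where [v] is close to [cl x] and must not be shortened. *)
pose s x := 2^-1 + 2 / ep * Num.max 0 (N x - ep).
have Phi_far x : ep <= N x -> Phi x = f x.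
  move=> h1; rewrite /Phi max_r; first by rewrite scale1r addrC subrK.
  by rewrite ler_pdivrMr // mul1r.
have Phi_near x : N x <= ep -> `|Phi x - c0| = ep.
  move=> h1; rewrite /Phi addrC addKr normrZ max_l; last by rewrite ler_pdivlMr // mul1r.
  by rewrite gtr0_norm ?divr_gt0 // divfK // gt_eqF.
have v_far x : ep <= N x -> `|v x - cl x| <= dl / 2.
  move=> h1; rewrite /v Phi_far // addrAC; apply: le_trans (ler_normB _ _) _.
  have := hP (cl x) (cl_le x); rewrite f_cl => h2.
  by apply: le_trans (lerD h2 (ltW el)) _; lra.
have cl_small x : N x < 2 * ep -> `|cl x| < 10%:R^-1.
  move=> h1; rewrite -[cl x]subr0; apply: (hb _ _ (cl_le x) b10); rewrite f_cl.
  rewrite (_ : f x - f 0 = (f x - c0) + (c0 - f 0)); last by rewrite addrA subrK.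
  apply: le_lt_trans (ler_normD _ _) _; rewrite -/(N x).
  by move: c0f h1; rewrite /ep; lra.
have v0 x : v x != 0.
  apply/eqP => vx; have [le|lt] := leP (N x) ep.
    by apply: (he (Phi x) (Phi_near x le)); apply/eqP; rewrite -subr_eq0; apply/eqP.
  have := v_far x (ltW lt); rewrite vx sub0r normrN => h1.
  have h2 : `|cl x| < dl by apply: le_lt_trans h1 _; rewrite ltr_pdivrMr // ltr_pMr // ltr1n.
  have := hdl _ h2; rewrite f_cl => h3.
  have : N x < ep.
    rewrite /N (_ : f x - c0 = (f x - f 0) - (c0 - f 0)); last by rewrite opprB addrA subrK.
    by apply: le_lt_trans (ler_normB _ _) _; rewrite [ltRHS]splitr ltrD.
  by rewrite ltNge ltW.
have s0 x : 0 < s x.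
  have : 0 <= 2 / ep * Num.max 0 (N x - ep).
    by rewrite mulr_ge0 ?le_max ?lexx // divr_ge0 // ltW.
  by rewrite /s; lra.
pose V x := Num.min 1 (s x / `|v x|) *: v x.
have vn x : 0 < `|v x| by rewrite normr_gt0.
have V0 x : V x != 0.
  by rewrite scaler_eq0 (negPf (v0 x)) orbF gt_eqF // lt_min ltr01 divr_gt0.
have V_le x : `|V x| <= s x.
  rewrite normrZ ger0_norm; last by rewrite le_min ler01 divr_ge0 ?ltW.
  by rewrite -ler_pdivlMr // ge_min lexx orbT.
have V_id x : `|v x| <= s x -> V x = v x.
  by move=> h1; rewrite /V min_l ?scale1r // ler_pdivlMr // mul1r.
have close x : `|cl x - V x| <= 1.
  have [le|lt] := leP (N x) ep.
    have sx : s x = 2^-1 by rewrite /s max_l ?mulr0 ?addr0 // subr_le0.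
    apply: le_trans (ler_normB _ _) _; have := V_le x; rewrite sx.
    have : N x < 2 * ep by apply: le_lt_trans le _; rewrite ltr_pMl // ltr1n.
    by move/cl_small; lra.
  have vc := v_far x (ltW lt).
  have vl : `|v x| <= `|cl x| + dl / 2.
    rewrite -[v x](subrK (cl x)) addrC; apply: le_trans (ler_normD _ _) _.
    by rewrite lerD2l.
  rewrite V_id; first by rewrite distrC; apply: le_trans vc _; move: dl1; lra.
  have s_ge : 2^-1 <= s x.
    by rewrite /s lerDl mulr_ge0 ?le_max ?lexx // divr_ge0 // ltW.
  have [h1|h1] := ltP (N x) (2 * ep).
    by have := cl_small x h1; move: dl1 vl s_ge; lra.
  have : 2 <= 2 / ep * Num.max 0 (N x - ep).
    rewrite -[X in X <= _](divfK (lt0r_neq0 ep0)) ler_pM2l ?divr_gt0 //.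
    by rewrite le_max; apply/orP; right; lra.
  by have := cl_le x; move: dl1 vl; rewrite /s; lra.
have cN x : {for x, continuous N}.
  apply: (@norm_comp_continuous _ _ (fun x => f x - c0)).
  apply: (@continuousB _ _ _ f (cst c0)); [exact: cf|exact: cst_continuous].
have cPhi x : {for x, continuous Phi}.
  apply: (@continuousD _ _ _ (cst c0) (fun x => Num.max (ep / N x) 1 *: (f x - c0))).
    exact: cst_continuous.
  apply: (@continuousZ _ _ _ (fun x => Num.max (ep / N x) 1) (fun x => f x - c0)).
    apply: (@continuous_max _ _ (fun x => ep / N x) (cst 1)); last exact: cst_continuous.
    apply: (@continuousM _ _ (cst ep) (fun x => (N x)^-1)); first exact: cst_continuous.
    by apply: (@continuousV _ _ N); rewrite ?gt_eqF //; apply: cN.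
  apply: (@continuousB _ _ _ f (cst c0)); [exact: cf|exact: cst_continuous].
have cv x : {for x, continuous v}.
  apply: (@continuousB _ _ _ (fun x => P (Phi x)) (cst e)); last exact: cst_continuous.
  apply: (@continuous_comp _ _ _ Phi P); first exact: cPhi.
  exact: (lipschitz_continuous lipP).
have cs x : {for x, continuous s}.
  apply: (@continuousD R R^o _ (cst 2^-1) (fun x => 2 / ep * Num.max 0 (N x - ep))).
    exact: cst_continuous.
  apply: (@continuousM _ _ (cst (2 / ep)) (fun x => Num.max 0 (N x - ep))).
    exact: cst_continuous.
  apply: (@continuous_max _ _ (cst 0) (fun x => N x - ep)); first exact: cst_continuous.
  by apply: (@continuousB R R^o _ N (cst ep)); [exact: cN|exact: cst_continuous].
have cV : continuous V.
  move=> x; apply: (@continuousZ _ _ _ (fun x => Num.min 1 (s x / `|v x|)) v).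
    apply: (@continuous_min _ _ (cst 1) (fun x => s x / `|v x|)).
      exact: cst_continuous.
    apply: (@continuousM _ _ s (fun x => `|v x|^-1)); first exact: cs.
    apply: (@continuousV _ _ (fun x => `|v x|)); first by rewrite gt_eqF.
    by apply: (@norm_comp_continuous _ _ v); apply: cv.
  exact: cv.
have [z hz] := @brouwer R d (fun x => cl x - V x)
  (fun x => continuousB (cl_cont x) (cV x)) close.
have /eqP := hz; rewrite cl_id; last by rewrite -hz close.
by rewrite -subr_eq0 addrC addKr oppr_eq0 (negPf (V0 z)).
Qed.

End InvarianceOfDomain.

(** * Convex hulls of finite families *)

Local Notation dot x u := ((x *m u) 0 0).

Section Dot.
Context {R : realType} {m : nat}.
Implicit Types (x y : 'rV[R]_m) (u v : 'cV[R]_m).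

Lemma dotDl x y u : dot (x + y) u = dot x u + dot y u.
Proof. by rewrite mulmxDl mxE. Qed.

Lemma dotZl a x u : dot (a *: x) u = a * dot x u.
Proof. by rewrite -scalemxAl mxE. Qed.

Lemma dotNl x u : dot (- x) u = - dot x u.
Proof. by rewrite mulNmx mxE. Qed.

Lemma dotBl x y u : dot (x - y) u = dot x u - dot y u.
Proof. by rewrite dotDl dotNl. Qed.

Lemma dot0l u : dot (0 : 'rV[R]_m) u = 0.
Proof. by rewrite mul0mx mxE. Qed.

Lemma dotDr x u v : dot x (u + v) = dot x u + dot x v.
Proof. by rewrite mulmxDr mxE. Qed.

Lemma dotZr a x u : dot x (a *: u) = a * dot x u.
Proof. by rewrite -scalemxAr mxE. Qed.

Lemma dotNr x u : dot x (- u) = - dot x u.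
Proof. by rewrite mulmxN mxE. Qed.

Lemma dotBr x u v : dot x (u - v) = dot x u - dot x v.
Proof. by rewrite dotDr dotNr. Qed.

Lemma dot0r x : dot x (0 : 'cV[R]_m) = 0.
Proof. by rewrite mulmx0 mxE. Qed.

Lemma dot_suml (I : Type) (r : seq I) (P : pred I) (F : I -> 'rV[R]_m) u :
  dot (\sum_(i <- r | P i) F i) u = \sum_(i <- r | P i) dot (F i) u.
Proof. by rewrite mulmx_suml summxE. Qed.

Lemma dot_sumr (I : Type) (r : seq I) (P : pred I) x (F : I -> 'cV[R]_m) :
  dot x (\sum_(i <- r | P i) F i) = \sum_(i <- r | P i) dot x (F i).
Proof. by rewrite mulmx_sumr summxE. Qed.

End Dot.

Lemma exists_small (R : realType) (I : finType) (P : pred I) (a b : I -> R) :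
  (forall i, P i -> 0 < a i) ->
  exists2 e : R, 0 < e & forall i, P i -> e * b i < a i.
Proof.
move=> apos; pose f i := (`|b i| + 1) / a i.
have f0 i : P i -> 0 < f i by move=> Pi; rewrite divr_gt0 ?apos // ltr_wpDl.
pose s := 1 + \sum_(i | P i) f i.
have s0 : 0 < s by rewrite ltr_wpDr // sumr_ge0 // => i /f0/ltW.
exists s^-1; first by rewrite invr_gt0.
move=> i Pi; rewrite mulrC ltr_pdivrMr //.
apply: le_lt_trans (ler_norm _) _; apply: lt_le_trans (_ : a i * f i <= _).
  by rewrite /f mulrC divfK ?ltrDl // gt_eqF // apos.
rewrite ler_pM2l ?apos // /s (bigD1 i) //= addrCA lerDl addr_ge0 //.
by rewrite sumr_ge0 // => j /andP[/f0/ltW].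
Qed.

Section Hull.
Context {R : realType} {m : nat} {K : finType}.
Implicit Types (A : set 'rV[R]_m) (w : K -> 'rV[R]_m) (S : {set K}).

Lemma is_convexP A : is_convex A <->
  forall x y (t : R), 0 < t < 1 -> A x -> A y -> A (t *: x + (1 - t) *: y).
Proof.
rewrite /is_convex convex_setW; split=> [cA x y t /andP[t0 t1] Ax Ay|cA x y xA yA k k0 k1].
  have t01 : 0 <= t <= 1 by rewrite !ltW.
  have := cA x y (mem_set Ax) (mem_set Ay) (Itv01 (ltW t0) (ltW t1)) t0 t1.
  by rewrite inE.
have k01 : 0 < k%:num < 1 by rewrite k0 k1.
rewrite !inE in xA yA *; exact: (cA x y k%:num k01 xA yA).
Qed.

Lemma conv_convex A : is_convex (conv A).
Proof.
apply/is_convexP => x y t t01 hx hy B [cB AB].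
by move/is_convexP: (cB); apply=> //; [apply: hx|apply: hy].
Qed.

Lemma sub_conv A : A `<=` conv A.
Proof. exact: sub_gen_smallest. Qed.

Lemma conv_min A B : is_convex B -> A `<=` B -> conv A `<=` B.
Proof. exact: smallest_sub. Qed.

Lemma conv_mono A B : A `<=` B -> conv A `<=` conv B.
Proof. by move=> AB; apply: conv_min (@conv_convex B) (subset_trans AB (@sub_conv B)). Qed.

Lemma conv0 : conv set0 = set0 :> set 'rV[R]_m.
Proof. by apply/seteqP; split=> //; apply: conv_min => //; apply/is_convexP. Qed.

Lemma conv1 (x : 'rV[R]_m) : conv [set x] = [set x].
Proof.
apply/seteqP; split; last exact: sub_conv.
apply: conv_min => //; apply/is_convexP => y z t _ -> ->.
by rewrite -scalerDl addrC subrK scale1r.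
Qed.

Lemma conv_nonempty A : conv A !=set0 -> A !=set0.
Proof.
move=> [x xA]; apply: contrapT => /nonemptyPn A0.
by rewrite A0 conv0 in xA.
Qed.

Lemma convex_sum A w S (a : K -> R) : is_convex A ->
  (forall k, k \in S -> A (w k)) -> (forall k, 0 <= a k) ->
  \sum_(k in S) a k = 1 -> A (\sum_(k in S) a k *: w k).
Proof.
move=> /is_convexP cA wA a0.
(* The induction runs over normalised partial sums, since a partial sum itself need not lie in
   [A]. *)
suff [_ [_]] : 0 <= \sum_(k in S) a k /\ (\sum_(k in S) a k = 0 ->
    \sum_(k in S) a k *: w k = 0) /\ (0 < \sum_(k in S) a k ->
    A ((\sum_(k in S) a k)^-1 *: \sum_(k in S) a k *: w k)).
  by move=> + s1; rewrite s1 invr1 scale1r; apply; rewrite ltr01.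
apply: (big_rec2 (fun x s => 0 <= s /\ (s = 0 -> x = 0) /\ (0 < s -> A (s^-1 *: x)))).
  by rewrite ltxx.
move=> k x s kS [s0 [sx0 sA]]; split; first by rewrite addr_ge0.
have [ak|ak] := eqVneq (a k) 0.
  by rewrite ak scale0r !add0r.
have ak0 : 0 < a k by rewrite lt_neqAle eq_sym ak a0.
split; first by move/eqP; rewrite gt_eqF // ltr_wpDr.
move=> aks; move: s0; rewrite le_eqVlt => /orP[/eqP s0|s0].
  by rewrite -s0 sx0 // !addr0 scalerA mulVf // scale1r; apply: wA.
have t01 : 0 < a k / (a k + s) < 1.
  by rewrite divr_gt0 //= ltr_pdivrMr // mul1r ltrDl.
have := cA _ _ _ t01 (wA _ kS) (sA s0); congr (A _).
rewrite scalerDr !scalerA [_^-1 * _]mulrC; congr (_ + _ *: _).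
by field; rewrite !gt_eqF.
Qed.

Definition hull w S : set 'rV[R]_m :=
  [set y | exists a : K -> R, [/\ forall k, 0 <= a k, \sum_(k in S) a k = 1 &
     y = \sum_(k in S) a k *: w k]].

Definition cone_hull w S : set 'rV[R]_m :=
  [set y | exists2 a : K -> R, forall k, 0 <= a k & y = \sum_(k in S) a k *: w k].

Lemma hull_cone w S : hull w S `<=` cone_hull w S.
Proof. by move=> y [a [a0 _ ->]]; exists a. Qed.

Lemma sum_indicator (V : lmodType R) (F : K -> V) S l : l \in S ->
  \sum_(k in S) (k == l)%:R *: F k = F l.
Proof.
move=> lS; rewrite (bigD1 l) //= eqxx scale1r big1 ?addr0 //.
by move=> k /andP[_ /negPf ->]; rewrite scale0r.
Qed.

Lemma sum_indicator1 S (l : K) : l \in S -> \sum_(k in S) (k == l)%:R = 1 :> R.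
Proof.
move=> lS; rewrite (bigD1 l) //= eqxx big1 ?addr0 //.
by move=> k /andP[_ /negPf ->].
Qed.

Lemma conv_fin w S : conv [set w k | k in [set` S]] = hull w S.
Proof.
apply/seteqP; split.
  apply: conv_min.
    apply/is_convexP => x y t /andP[t0 t1] [a [a0 a1 ->]] [b [b0 b1 ->]].
    exists (fun k => t * a k + (1 - t) * b k); split.
    - by move=> k; rewrite addr_ge0 // mulr_ge0 // ?subr_ge0 ltW.
    - by rewrite big_split /= -!mulr_sumr a1 b1 !mulr1 addrC subrK.
    - rewrite !scaler_sumr -big_split; apply: eq_bigr => k _ /=.
      by rewrite !scalerA scalerDl.
  move=> _ [l lS <-]; exists (fun k => (k == l)%:R); split=> //.
  - by rewrite sum_indicator1.
  - by rewrite sum_indicator.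
move=> _ [a [a0 a1 ->]]; apply: convex_sum => //; first exact: conv_convex.
by move=> k kS; apply: sub_conv; exists k.
Qed.

Lemma hull_mem w S k : k \in S -> hull w S (w k).
Proof. by move=> kS; rewrite -conv_fin; apply: sub_conv; exists k. Qed.

Lemma hull_subset w S S' : S \subset S' -> hull w S `<=` hull w S'.
Proof.
move=> SS'; rewrite -!conv_fin; apply: conv_mono => _ [k kS <-].
by exists k => //; apply: (fintype.subsetP SS').
Qed.

Lemma hull_set0 w : hull w finset.set0 = set0.
Proof.
apply/seteqP; split=> // y [a [_ s1 _]]; move: s1.
by rewrite big_set0 => /eqP; rewrite eq_sym oner_eq0.
Qed.

Lemma cone_hull_subset w S S' : S \subset S' -> cone_hull w S `<=` cone_hull w S'.
Proof.
move=> SS' _ [a a0 ->]; exists (fun k => if k \in S then a k else 0).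
  by move=> k; case: ifP.
rewrite [RHS](bigID (mem S)) /= [X in _ = _ + X]big1 ?addr0; last first.
  by move=> k /andP[_ /negPf ->]; rewrite scale0r.
apply: eq_big => k; last by move=> ->.
by apply/idP/andP => [kS|[]//]; split=> //; apply: (fintype.subsetP SS').
Qed.

Lemma cone_hullD w S x y : cone_hull w S x -> cone_hull w S y -> cone_hull w S (x + y).
Proof.
move=> [a a0 ->] [b b0 ->]; exists (fun k => a k + b k).
  by move=> k; rewrite addr_ge0.
by rewrite -big_split; apply: eq_bigr => k _; rewrite scalerDl.
Qed.

Lemma cone_hullZ w S t x : 0 <= t -> cone_hull w S x -> cone_hull w S (t *: x).
Proof.
move=> t0 [a a0 ->]; exists (fun k => t * a k); first by move=> k; rewrite mulr_ge0.
by rewrite scaler_sumr; apply: eq_bigr => k _; rewrite scalerA.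
Qed.

Lemma cone_hull_mem w S k : k \in S -> cone_hull w S (w k).
Proof. by move/hull_mem/hull_cone. Qed.

Lemma cone_hull0 w S : cone_hull w S 0.
Proof.
by exists (fun=> 0) => //; rewrite big1 // => k _; rewrite scale0r.
Qed.

Lemma cone_hull_sum w S (I : Type) (r : seq I) (P : pred I) (F : I -> 'rV[R]_m) :
  (forall i, P i -> cone_hull w S (F i)) -> cone_hull w S (\sum_(i <- r | P i) F i).
Proof.
move=> h; apply: big_ind => //; [exact: cone_hull0|exact: cone_hullD].
Qed.

Lemma pos_hull_hull w S y : S != finset.set0 -> 
  pos_hull (hull w S) y <-> cone_hull w S y.
Proof.
move=> /set0Pn[l lS]; split=> [[t [x [a [a0 _ ->]] [t0 ->]]]|[a a0 ->]].
  by apply: cone_hullZ => //; exists a.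
pose s := \sum_(k in S) a k.
have [s0|s0] := eqVneq s 0.
  exists 0; exists (w l); first exact: hull_mem.
  rewrite scale0r lexx; split=> //; apply: big1 => k kS.
  move/eqP: s0; rewrite psumr_eq0 // => /allP/(_ k).
  by rewrite mem_index_enum kS /= => /(_ isT)/eqP ->; rewrite scale0r.
exists s; exists (\sum_(k in S) (s^-1 * a k) *: w k).
  exists (fun k => s^-1 * a k); split=> //.
    by move=> k; rewrite mulr_ge0 // invr_ge0 sumr_ge0.
  by rewrite -mulr_sumr mulVf.
split; first by rewrite sumr_ge0.
by rewrite scaler_sumr; apply: eq_bigr => k _; rewrite scalerA mulrA divff // mul1r.
Qed.

End Hull.

Section Faces.
Context {R : realType} {m : nat}.
Implicit Types (A Q F G : set 'rV[R]_m).

Lemma conv_ge A (u : 'cV[R]_m) (b : R) :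
  (forall x, A x -> b <= dot x u) -> forall x, conv A x -> b <= dot x u.
Proof.
move=> h; apply: (conv_min (B := [set x | b <= dot x u])) => //.
apply/is_convexP => x y t /andP[t0 t1] /= hx hy.
rewrite dotDl !dotZl; have t1' : 0 <= 1 - t by rewrite subr_ge0 ltW.
by have := ler_wpM2l (ltW t0) hx; have := ler_wpM2l t1' hy; lra.
Qed.

(** A proper convex combination attains the bound only if both points do. The set [A] may be
    infinite, as it is for the lattice points of a cone, so the argument uses the minimality of the
    hull instead of finite combinations. *)
Lemma conv_face A (u : 'cV[R]_m) (b : R) : (forall x, A x -> b <= dot x u) ->
  [set x | conv A x /\ dot x u = b] = conv [set x | A x /\ dot x u = b].
Proof.
move=> h; apply/seteqP; split=> [x [xA xb]|].
  pose B := [set x | b <= dot x u /\ (dot x u = b -> conv [set x | A x /\ dot x u = b] x)].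
  suff /(_ x xA) [_] : conv A `<=` B by apply.
  apply: conv_min => [|z zA]; last first.
    by split=> [|zb]; [exact: h|apply: sub_conv].
  apply/is_convexP => y z t /andP[t0 t1] [hy cy] [hz cz]; rewrite /B /= dotDl !dotZl.
  have t1' : 0 < 1 - t by rewrite subr_gt0.
  have hy' := ler_wpM2l (ltW t0) hy; have hz' := ler_wpM2l (ltW t1') hz.
  split; first by lra.
  move=> e.
  have ey : dot y u = b.
    apply/eqP; rewrite -subr_eq0; have : t * (dot y u - b) = 0 by lra.
    by move/eqP; rewrite mulf_eq0 gt_eqF.
  have ez : dot z u = b.
    apply/eqP; rewrite -subr_eq0; have : (1 - t) * (dot z u - b) = 0 by lra.
    by move/eqP; rewrite mulf_eq0 gt_eqF.
  move/is_convexP: (@conv_convex R m [set x | A x /\ dot x u = b]); apply.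
  - by rewrite t0 t1.
  - exact: cy.
  - exact: cz.
apply: conv_min.
  apply/is_convexP => y z t /andP[t0 t1] [yA yb] [zA zb]; split.
    by move/is_convexP: (@conv_convex R m A); apply; rewrite ?t0.
  by rewrite dotDl !dotZl yb zb -mulrDl addrC subrK mul1r.
by move=> x [xA xb]; split=> //; apply: sub_conv.
Qed.

Lemma face_conv A F : is_face (conv A) F -> exists2 B, B `<=` A & F = conv B.
Proof.
move=> [u [b [h ->]]]; exists [set x | A x /\ dot x u = b].
  by move=> x [].
by apply: conv_face => x xA; apply: h; apply: sub_conv.
Qed.

Lemma vertices_conv A : vertices (conv A) `<=` A.
Proof.
move=> x /face_conv[B BA xB].
have [y yB] : B !=set0 by apply: conv_nonempty; exists x; rewrite -xB.
suff -> : x = y by apply: BA.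
by have : [set x] y; [rewrite xB; apply: sub_conv|move=> ->].
Qed.

Lemma face_subset Q F G : is_face Q G -> G `<=` F -> F `<=` Q -> is_face F G.
Proof.
move=> [u [b [h ->]]] GF FQ; exists u, b; split=> [x /FQ/h //|].
by apply/seteqP; split=> x [xQ xb]; split=> //; [apply: GF|apply: FQ].
Qed.

Lemma is_face_sub Q F : is_face Q F -> F `<=` Q.
Proof. by move=> [u [b [_ ->]]] x []. Qed.

Lemma face_of_le Q (u : 'cV[R]_m) (b : R) :
  (forall x, Q x -> dot x u <= b) -> is_face Q [set x | Q x /\ dot x u = b].
Proof.
move=> h; exists (- u), (- b); split=> [x xQ|]; first by rewrite dotNr lerN2 h.
apply/seteqP; split=> x /= [xQ xb]; split=> //; first by rewrite dotNr xb.
by move: xb; rewrite dotNr => /oppr_inj.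
Qed.

Lemma is_face_refl Q : is_face Q Q.
Proof.
exists 0, 0; split=> [x _|]; first by rewrite dot0r.
by apply/seteqP; split=> [x xQ|x []//]; rewrite /= dot0r.
Qed.

End Faces.

(** * Dual bases and unimodular bases *)

Section Lattice.
Context {R : realType} {m : nat}.
Implicit Types (x y : 'rV[R]_m).

Lemma ZlatP x : Zlat x <-> forall j, x 0 j \is a Num.int.
Proof.
split=> [/mxOverP h j|h]; first exact: h.
by apply/mxOverP => i j; rewrite ord1.
Qed.

Lemma Zlat0 : Zlat (0 : 'rV[R]_m).
Proof. by apply/ZlatP => j; rewrite mxE rpred0. Qed.

Lemma ZlatD x y : Zlat x -> Zlat y -> Zlat (x + y).
Proof. by move=> /ZlatP hx /ZlatP hy; apply/ZlatP => j; rewrite mxE rpredD. Qed.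

Lemma ZlatZ a x : a \is a Num.int -> Zlat x -> Zlat (a *: x).
Proof. by move=> ha /ZlatP hx; apply/ZlatP => j; rewrite mxE rpredM. Qed.

Lemma Zlat_sum (I : Type) (r : seq I) (P : pred I) (F : I -> 'rV[R]_m) :
  (forall i, P i -> Zlat (F i)) -> Zlat (\sum_(i <- r | P i) F i).
Proof. by move=> h; apply: big_ind => //; [exact: Zlat0|exact: ZlatD]. Qed.

Lemma Zlat_delta j : Zlat (delta_mx 0 j : 'rV[R]_m).
Proof. by apply/ZlatP => k; rewrite mxE rpred_nat. Qed.

Lemma int_ge1 (a : R) : a \is a Num.int -> 0 < a -> 1 <= a.
Proof.
by move=> /intrP[z ->]; rewrite ltr0z ler1z.
Qed.

Lemma int_nat (a : R) : a \is a Num.int -> 0 <= a -> exists n : nat, a = n%:R.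
Proof.
move=> /intrP[z ->]; rewrite ler0z; case: z => // n _; exists n.
by rewrite -pmulrn.
Qed.

Lemma rowE_delta x : x = \sum_j x 0 j *: delta_mx 0 j.
Proof. exact: row_sum_delta. Qed.

End Lattice.

Section Dual.
Context {R : realType} {m : nat} {K : finType}.
Implicit Types (w : K -> 'rV[R]_m) (e : K -> 'cV[R]_m) (J S : {set K}).

(** The columns [e k] are the coordinate functionals of the basis formed by the [w k] with [k] in
    [J]. The index set is a subset of [K], so that exchanging one vertex needs no renumbering. *)
Definition dual w J e : Prop :=
  (forall y, y = \sum_(k in J) dot y (e k) *: w k) /\
  (forall k l, k \in J -> l \in J -> dot (w k) (e l) = (k == l)%:R).

Definition unibasis w J : Prop :=
  (forall k, k \in J -> Zlat (w k)) /\ exists2 e, dual w J e &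
  forall y, Zlat y -> forall k, k \in J -> dot y (e k) \is a Num.int.

Variables (w : K -> 'rV[R]_m) (J : {set K}) (e : K -> 'cV[R]_m).
Hypothesis dwe : dual w J e.

Let ext y : y = \sum_(k in J) dot y (e k) *: w k.
Proof. exact: dwe.1. Qed.

Let ort k l : k \in J -> l \in J -> dot (w k) (e l) = (k == l)%:R.
Proof. exact: dwe.2. Qed.

Lemma dual_coeff S (a : K -> R) l : S \subset J -> l \in J ->
  dot (\sum_(k in S) a k *: w k) (e l) = if l \in S then a l else 0.
Proof.
move=> /fintype.subsetP SJ lJ; rewrite dot_suml.
rewrite (eq_bigr (fun k => (k == l)%:R *: a k)); last first.
  by move=> k /SJ kJ; rewrite dotZl ort // mulrC.
case: ifP => lS; first exact: sum_indicator.
rewrite big1 // => k kS; have [kl|] := eqVneq k l; last by rewrite scale0r.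
by rewrite -kl kS in lS.
Qed.

Lemma dual_functional (c : K -> R) k :
  k \in J -> dot (w k) (\sum_(l in J) c l *: e l) = c k.
Proof.
move=> kJ; rewrite dot_sumr (eq_bigr (fun l => (l == k)%:R *: c l)).
  exact: sum_indicator.
by move=> l lJ; rewrite dotZr ort // eq_sym mulrC.
Qed.

Lemma dual_eq (u u' : 'cV[R]_m) :
  (forall k, k \in J -> dot (w k) u = dot (w k) u') -> u = u'.
Proof.
move=> h; have hy (y : 'rV[R]_m) : dot y u = dot y u'.
  rewrite (ext y) !dot_suml; apply: eq_bigr => k kJ; rewrite !dotZl h //.
apply/colP => j; have := hy (delta_mx 0 j).
by rewrite -!rowE !mxE.
Qed.

(** Compare traces in the decomposition of the identity as the sum of the [e k *m w k]. *)
Lemma dual_card : #|J| = m.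
Proof.
have h : \sum_(k in J) e k *m w k = 1%:M.
  apply/row_matrixP => i; rewrite row1 [RHS]ext linear_sum /=.
  apply: eq_bigr => k kJ.
  by rewrite row_mul [row i (e k)]mx11_scalar mul_scalar_mx -rowE.
have := congr1 mxtrace h; rewrite mxtrace1 linear_sum /=.
rewrite (eq_bigr (fun=> 1)); last first.
  by move=> k kJ; rewrite mxtrace_mulC /mxtrace big_ord1 ort // eqxx.
by rewrite sumr_const => /eqP; rewrite eqr_nat => /eqP.
Qed.

Lemma cone_hull_dual y : cone_hull w J y <-> forall k, k \in J -> 0 <= dot y (e k).
Proof.
split=> [[a a0 ->] k kJ|h]; first by rewrite dual_coeff // kJ.
exists (fun k => if k \in J then dot y (e k) else 0).
  by move=> k; case: ifP => // /h.
by rewrite [LHS]ext; apply: eq_bigr => k ->.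
Qed.

Lemma hull_dual S y : S \subset J -> hull w J y ->
  (forall k, k \in J -> k \notin S -> dot y (e k) = 0) -> hull w S y.
Proof.
move=> SJ [a [a0 a1 yE]] h.
have az k : k \in J -> k \notin S -> a k = 0.
  by move=> kJ kS; have := h k kJ kS; rewrite yE dual_coeff // kJ.
have drop (V : lmodType R) (F : K -> V) :
    \sum_(k in J) a k *: F k = \sum_(k in S) a k *: F k.
  rewrite (bigID (mem S)) /= [X in _ + X]big1 ?addr0; last first.
    by move=> k /andP[kJ kS]; rewrite az // scale0r.
  apply: eq_bigl => k; apply/andP/idP => [[]//|kS]; split=> //.
  exact: (fintype.subsetP SJ).
exists a; split=> //; last by rewrite yE drop.
have := drop R^o (fun=> 1); rewrite /= => h1.
rewrite -a1; apply/esym; move: h1.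
by under eq_bigr do rewrite /GRing.scale /= mulr1; under [RHS]eq_bigr do rewrite /GRing.scale /= mulr1.
Qed.

(** The face spanned by [S] is cut out by the sum of the coordinates outside [S]. *)
Lemma face_simplex G : is_face (hull w J) G <->
  G = hull w J \/ exists2 S : {set K}, S \subset J & G = hull w S.
Proof.
split=> [|[->|[S SJ ->]]]; last 1 first.
- exists (\sum_(k in J :\: S) e k), 0; split=> [x hx|].
    rewrite dot_sumr sumr_ge0 // => k /setDP[kJ _].
    by move/hull_cone/cone_hull_dual: hx; apply.
  apply/seteqP; split=> [x hx|x [hx]].
    split; first exact: hull_subset hx.
    rewrite dot_sumr big1 // => k /setDP[kJ kS].
    by case: hx => a [_ _ ->]; rewrite dual_coeff // (negPf kS).
  rewrite dot_sumr => /eqP; rewrite psumr_eq0; last first.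
    by move=> k /setDP[kJ _]; move/hull_cone/cone_hull_dual: hx; apply.
  move/allP => h; apply: hull_dual => // k kJ kS.
  by have := h k; rewrite mem_index_enum inE kJ kS => /(_ isT)/eqP.
- rewrite -conv_fin => -[u [b [h ->]]]; right.
  exists [set k in J | dot (w k) u == b]%SET.
    by apply/fintype.subsetP => k; rewrite inE => /andP[].
  rewrite -conv_fin conv_face; last by move=> x xJ; apply: h; apply: sub_conv.
  congr (conv _); apply/seteqP; split=> [_ [[k kJ <-] kb]|_ [k + <-]].
    by exists k => //=; rewrite inE -in_setE inE kb eqxx andbT.
  by rewrite /= inE => /andP[kJ /eqP kb]; split=> //; exists k.
- exact: is_face_refl.
Qed.

(** The functional of a larger face is constant on the basis [w k], and so is [u] with a nonzero
    value; hence the former is a multiple of [u]. *)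
Lemma facet_criterion (Q : set 'rV[R]_m) (u : 'cV[R]_m) (b : R) :
  (forall x, Q x -> b <= dot x u) -> b != 0 ->
  (forall k, k \in J -> Q (w k) /\ dot (w k) u = b) ->
  (exists2 x, Q x & dot x u != b) ->
  is_facet Q [set x | Q x /\ dot x u = b].
Proof.
move=> hu b0 hJ [x0 x0Q x0b]; split.
- by exists u, b.
- by move=> FQ; move: x0Q; rewrite -{1}FQ => -[_ /eqP]; apply/negP.
- move=> G [u' [b' [hu' GE]]] FG.
  have u'E : u' = (b' / b) *: u.
    apply: dual_eq => k kJ; have [kQ kb] := hJ k kJ.
    have : G (w k) by apply: FG.
    by rewrite GE => -[_ ->]; rewrite dotZr kb divfK.
  have [b'0|b'0] := eqVneq b' 0; [right|left].
    rewrite GE u'E b'0 mul0r scale0r; apply/seteqP; split=> [x []//|x xQ].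
    by rewrite /= dot0r.
  rewrite GE u'E; apply/seteqP; split=> x [xQ xb]; split=> //.
    move: xb; rewrite dotZr => /(canRL (mulKf _)) -> //.
      by rewrite invf_div divfK.
    by rewrite mulf_neq0 // invr_eq0.
  by rewrite dotZr xb divfK.
Qed.

End Dual.

Section ZBasis.
Context {R : realType} {m : nat} {K : finType}.
Implicit Types (w : K -> 'rV[R]_m) (J S : {set K}).

(** The coordinate functionals are read off from the integral coordinates of the unit vectors;
    uniqueness makes these coordinates additive, so the formulas extend from lattice points to real
    vectors. *)
Lemma Z_basis_unibasis w J : {in J &, injective w} ->
  Z_basis [set w k | k in [set` J]] -> unibasis w J.
Proof.
move=> winj [k [b [binj bE bZ bU]]].
have wb l : l \in J -> exists i, b i = w l.
  by move=> lJ; have : [set w k | k in [set` J]] (w l) by [exists l]; rewrite bE => -[i _ <-]; exists i.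
have bw i : exists2 l, l \in J & w l = b i.
  have : range b (b i) by exists i.
  by rewrite -bE => -[l lJ <-]; exists l.
have wZ l : l \in J -> Zlat (w l) by move=> /wb[i <-].
split=> //.
have ci z : exists c : 'rV[int]_k, Zlat z ->
    z = \sum_i (c 0 i)%:~R *: b i /\
    forall c' : 'rV[int]_k, z = \sum_i (c' 0 i)%:~R *: b i -> c = c'.
  have [zZ|zZ] := pselect (Zlat z); last by exists 0.
  by have [c [cz cu]] := bU z zZ; exists c => _; split.
have [c hc] := choice ci => {ci}.
pose C z l : R := \sum_i (b i == w l)%:R * (c z 0 i)%:~R.
have Cint z l : C z l \is a Num.int.
  by rewrite rpred_sum // => i _; rewrite rpredM // ?rpred_nat ?intr_int.
have Csum z : Zlat z -> z = \sum_(l in J) C z l *: w l.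
  move=> zZ; rewrite {1}(hc z zZ).1.
  under [RHS]eq_bigr do rewrite scaler_suml.
  rewrite exchange_big /=; apply: eq_bigr => i _.
  have [l lJ wl] := bw i.
  rewrite (bigD1 l) //= wl eqxx mul1r big1 ?addr0 // => l' /andP[l'J l'l].
  case: eqP => [bl|_]; last by rewrite mul0r scale0r.
  by case/eqP: l'l; apply: winj => //; rewrite -bl wl.
pose e l : 'cV[R]_m := \col_j C (delta_mx 0 j) l.
have eE z l : Zlat z -> dot z (e l) = C z l.
  move=> zZ; have /ZlatP zi := zZ.
  have az j : exists a : int, z 0 j = a%:~R by apply/intrP.
  have [a ha] := choice az.
  have cz : c z = \sum_j a j *: c (delta_mx 0 j).
    apply: (hc z zZ).2; rewrite {1}[z]rowE_delta.
    transitivity (\sum_j z 0 j *: \sum_i (c (delta_mx 0 j) 0 i)%:~R *: b i).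
      by apply: eq_bigr => j _; rewrite -(hc _ (Zlat_delta _)).1.
    under eq_bigr do rewrite scaler_sumr.
    rewrite exchange_big /=; apply: eq_bigr => i _.
    rewrite summxE rmorph_sum /= scaler_suml; apply: eq_bigr => j _.
    by rewrite mxE rmorphM /= ha scalerA.
  rewrite mxE /C cz; under [RHS]eq_bigr do rewrite summxE rmorph_sum mulr_sumr /=.
  rewrite exchange_big /=; apply: eq_bigr => j _.
  rewrite mxE ha mulr_sumr; apply: eq_bigr => i _.
  by rewrite mxE rmorphM /= mulrCA.
exists e; last by move=> y yZ l lJ; rewrite eE.
split=> [y|l l' lJ l'J].
  rewrite {1}[y]rowE_delta.
  transitivity (\sum_j y 0 j *: \sum_(l in J) C (delta_mx 0 j) l *: w l).
    by apply: eq_bigr => j _; rewrite -Csum //; apply: Zlat_delta.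
  under eq_bigr do rewrite scaler_sumr.
  rewrite exchange_big /=; apply: eq_bigr => l _.
  rewrite mxE scaler_suml; apply: eq_bigr => j _.
  by rewrite mxE scalerA.
rewrite eE; last exact: wZ.
have [i0 bi0] := wb l lJ.
have cw : c (w l) = delta_mx 0 i0.
  apply: (hc (w l) (wZ l lJ)).2; rewrite (bigD1 i0) //= mxE !eqxx scale1r.
  by rewrite big1 ?addr0 // => i /negPf ii; rewrite mxE ii andbF scale0r.
rewrite /C cw (bigD1 i0) //= mxE !eqxx mulr1 big1 ?addr0; last first.
  by move=> i /negPf ii; rewrite mxE ii andbF mulr0.
by rewrite bi0 (inj_in_eq winj).
Qed.

Lemma unibasis_Z_basis w J : {in J &, injective w} -> unibasis w J ->
  Z_basis [set w k | k in [set` J]].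
Proof.
move=> winj [wZ [e de eZ]].
have enJ (i : 'I_#|J|) : enum_val i \in J by apply: enum_valP.
exists #|J|, (fun i => w (enum_val i)); split.
- by move=> i j /(winj _ _ (enJ i) (enJ j))/enum_val_inj.
- apply/seteqP; split=> [_ [k kJ <-]|_ [i _ <-]].
    by exists (enum_rank_in kJ k) => //; rewrite enum_rankK_in.
  by exists (enum_val i) => //=; apply: enJ.
- by move=> i; apply: wZ.
- move=> z zZ.
  have az (i : 'I_#|J|) : exists a : int, dot z (e (enum_val i)) = a%:~R.
    by apply/intrP/eZ.
  have [a ha] := choice az.
  have sumE (f : K -> R) : \sum_(k in J) f k *: w k =
      \sum_(i < #|J|) f (enum_val i) *: w (enum_val i).
    by rewrite big_enum_val.
  exists (\row_i a i); split=> [|c' zE].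
    rewrite {1}[z](de.1) sumE; apply: eq_bigr => i _.
    by rewrite mxE ha.
  apply/rowP => i; rewrite mxE; apply: (intr_inj (R := R)); rewrite -ha.
  pose f k : R := if [pick j | enum_val j == k] is Some j then (c' 0 j)%:~R else 0.
  have fE j : f (enum_val j) = (c' 0 j)%:~R.
    rewrite /f; case: pickP => [j' /eqP/enum_val_inj -> //|/(_ j)].
    by rewrite eqxx.
  have -> : z = \sum_(k in J) f k *: w k.
    by rewrite zE sumE; apply: eq_bigr => j _; rewrite fE.
  by rewrite (dual_coeff de) ?enJ // fE.
Qed.

End ZBasis.

(** * Complete unimodular fans of smooth Fano polytopes *)

Section Tight.
Context {R : realType} {m : nat} {K : finType}.

(* Evaluate [V] and the functional of [J] at the sum of the [w k], [k \in S],
   which lies in the cone over some [J]. *)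
Lemma tight_subset (w : K -> 'rV[R]_m) (JJ : {set K} -> Prop) (s : R)
    (V : 'cV[R]_m) (S : {set K}) :
  (forall J, JJ J -> exists2 u : 'cV[R]_m, forall k, k \in J -> dot (w k) u = 1 &
     forall k, k \notin J -> 0 < s * (dot (w k) u - 1)) ->
  (forall k, 0 <= s * (dot (w k) V - 1)) ->
  (forall k, k \in S -> dot (w k) V = 1) ->
  (exists2 J, JJ J & cone_hull w J (\sum_(k in S) w k)) ->
  exists2 J, JJ J & S \subset J.
Proof.
move=> hJJ V_ge V_S [J JJJ [a a0 E]]; exists J => //.
have [u uJ u_out] := hJJ J JJJ.
have u_ge k : 0 <= s * (dot (w k) u - 1).
  by have [/uJ ->|/u_out/ltW//] := boolP (k \in J); rewrite subrr mulr0.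
have E1 : \sum_(k in S) s * (dot (w k) u - 1) =
    - \sum_(k in J) a k * (s * (dot (w k) V - 1)).
  have h1 := congr1 (fun y => dot y u) E; have h2 := congr1 (fun y => dot y V) E.
  rewrite !dot_suml in h1 h2.
  rewrite (eq_bigr (fun=> 1)) // in h2; rewrite [RHS](eq_bigr a) in h1; last first.
    by move=> k kJ; rewrite dotZl uJ // mulr1.
  transitivity (s * (\sum_(k in J) a k - \sum_(k in J) dot (a k *: w k) V)).
    by rewrite -mulr_sumr sumrB h1 h2.
  by rewrite -sumrB mulr_sumr -sumrN; apply: eq_bigr => k _; rewrite dotZl; ring.
have E0 : \sum_(k in S) s * (dot (w k) u - 1) = 0.
  apply/eqP; rewrite eq_le E1 oppr_le0 sumr_ge0 /=; last first.
    by move=> k _; rewrite mulr_ge0.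
  by rewrite -E1 sumr_ge0.
apply/fintype.subsetP => k kS; apply: contraT => /u_out.
move/eqP: E0; rewrite psumr_eq0 // => /allP/(_ k).
by rewrite mem_index_enum kS /= => /(_ isT)/eqP ->; rewrite ltxx.
Qed.

Lemma interior_functional (P : set 'rV[R]_m) (u : 'cV[R]_m) :
  P° 0 -> (forall x, P x -> 0 <= dot x u) -> u = 0.
Proof.
move=> /nbhs_ballP[r /= r0 hr] hu.
have small j (t : R) : `|t| < r -> P (t *: delta_mx 0 j).
  move=> tr; apply: hr; rewrite -ball_normE /= sub0r normrN.
  apply: norm_rV_lt => // k; rewrite !mxE eqxx /=.
  by case: eqP => _; rewrite ?mulr1 // mulr0 normr0.
have r2 : `|r / 2| < r by rewrite gtr0_norm ?divr_gt0 // ltr_pdivrMr // ltr_pMr // ltr1n.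
have r2' : `|- (r / 2)| < r by rewrite normrN.
apply/colP => j; rewrite mxE.
have h1 := hu _ (small j _ r2); have h2 := hu _ (small j _ r2').
rewrite !dotZl -!rowE !mxE mulNr oppr_ge0 in h1 h2.
have r20 : 0 < r / 2 by rewrite divr_gt0.
by apply/eqP; rewrite eq_le -(pmulr_rge0 _ r20) -(pmulr_rle0 _ r20) h1 h2.
Qed.

End Tight.

Section Fano.
Context {R : realType} {d : nat} {K : finType}.

(** Besides labelled smooth Fano polytopes, the images of regular realizations modulo the apex are
    shown to satisfy these clauses, before it is known that they are polytopes of this kind. *)
Definition fano_fan (w : K -> 'rV[R]_d) (JJ : {set K} -> Prop) : Prop :=
  [/\ forall J, JJ J -> unibasis w J,
      forall J, JJ J -> exists2 u : 'cV[R]_d, forall k, k \in J -> dot (w k) u = 1 &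
        forall k, k \notin J -> dot (w k) u < 1,
      forall k, exists2 J, JJ J & k \in J &
      forall y, exists2 J, JJ J & cone_hull w J y].

Variables (w : K -> 'rV[R]_d) (JJ : {set K} -> Prop).
Hypotheses (d_gt0 : (0 < d)%N) (fan : fano_fan w JJ).
Local Notation P := (conv (range w)).

Lemma range_setT : range w = [set w k | k in [set` [set: K]%SET]].
Proof. by apply/seteqP; split=> _ [k _ <-]; exists k => //=; rewrite inE. Qed.

Lemma fano_hullT : P = hull w [set: K]%SET.
Proof. by rewrite range_setT conv_fin. Qed.

Lemma fano_uni J : JJ J -> unibasis w J.
Proof. by case: fan => + _ _ _; apply. Qed.

Lemma fano_cover y : exists2 J, JJ J & cone_hull w J y.
Proof. by case: fan => _ _ _; apply. Qed.

Lemma fano_functional J : JJ J -> exists2 u : 'cV[R]_d,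
  forall k, k \in J -> dot (w k) u = 1 & forall k, k \notin J -> dot (w k) u < 1.
Proof. by case: fan => _ + _ _; apply. Qed.

Lemma fano_mem k : exists2 J, JJ J & k \in J.
Proof. by case: fan => _ _ + _; apply. Qed.

Lemma fano_Zlat k : Zlat (w k).
Proof. by have [J /fano_uni[wZ _] kJ] := fano_mem k; apply: wZ. Qed.

Lemma fano_card J : JJ J -> #|J| = d.
Proof. by move=> /fano_uni[_ [e de _]]; apply: dual_card de. Qed.

Lemma fano_inj : injective w.
Proof.
move=> k l wkl; have [J JJJ kJ] := fano_mem k.
have [lJ|lJ] := boolP (l \in J); last first.
  have [u uJ u_out] := fano_functional JJJ.
  by have := u_out l lJ; rewrite -wkl uJ // ltxx.
have [_ [e de _]] := fano_uni JJJ.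
have := de.2 k l kJ lJ; rewrite wkl de.2 // eqxx.
by case: eqP => // _ /eqP; rewrite oner_eq0.
Qed.

(** Writing minus the sum of all [w k] in a cone of the fan gives a relation with coefficients at
    least 1, which is then normalised. *)
Lemma fano_zero : P 0.
Proof.
have [J JJJ [a a0 E]] := fano_cover (- \sum_k w k).
have [k0 k0J] : exists k, k \in J.
  by apply/card_gt0P; rewrite (fano_card JJJ).
pose b k := 1 + (if k \in J then a k else 0).
have b0 k : 0 < b k by rewrite /b ltr_wpDr //; case: ifP.
have Eb : \sum_k b k *: w k = 0.
  under eq_bigr do rewrite /b scalerDl scale1r.
  rewrite big_split /= -[X in X + _]opprK E addrC; apply/eqP; rewrite subr_eq0; apply/eqP.
  rewrite [RHS]big_mkcond; apply: eq_bigr => k _; case: ifP => // _.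
  by rewrite scale0r.
have s0 : 0 < \sum_k b k.
  rewrite (bigD1 k0) //= ltr_wpDr // sumr_ge0 // => k _; exact: ltW.
rewrite fano_hullT; exists (fun k => (\sum_k b k)^-1 * b k); split.
- by move=> k; rewrite mulr_ge0 ?invr_ge0 ?ltW.
- rewrite -mulr_sumr [X in _ * X](eq_bigl predT) ?mulVf ?gt_eqF // => k; by rewrite inE.
- transitivity ((\sum_k b k)^-1 *: \sum_k b k *: w k); first by rewrite Eb scaler0.
  by rewrite scaler_sumr; apply: eq_big => [k|k _]; rewrite ?inE ?scalerA.
Qed.

Lemma fano_poly_mem (J : {set K}) (a : K -> R) : (forall k, 0 <= a k) -> \sum_(k in J) a k <= 1 ->
  P (\sum_(k in J) a k *: w k).
Proof.
move=> a0 a1; pose s := \sum_(k in J) a k.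
have [s0|s0] := eqVneq s 0.
  rewrite big1; first exact: fano_zero.
  move=> k kJ; move/eqP: s0; rewrite psumr_eq0 // => /allP/(_ k).
  by rewrite mem_index_enum kJ /= => /(_ isT)/eqP ->; rewrite scale0r.
have s_gt0 : 0 < s by rewrite lt_neqAle eq_sym s0 sumr_ge0.
have Pn : P (\sum_(k in J) (s^-1 * a k) *: w k).
  apply: convex_sum; first exact: conv_convex.
  - by move=> k _; apply: sub_conv; exists k.
  - by move=> k; rewrite mulr_ge0 // invr_ge0 ltW.
  - by rewrite -mulr_sumr mulVf.
have -> : \sum_(k in J) a k *: w k = s *: (\sum_(k in J) (s^-1 * a k) *: w k).
  rewrite scaler_sumr; apply: eq_bigr => k _.
  by rewrite scalerA mulrA divff // mul1r.
move: a1; rewrite -/s le_eqVlt => /orP[/eqP s1|s1]; first by rewrite {1}s1 scale1r.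
have /is_convexP/(_ _ _ s _ Pn fano_zero) := @conv_convex R d (range w).
by rewrite scaler0 addr0; apply; rewrite s_gt0.
Qed.

(** In the cone over [J] the sum of the coefficients of [y] is the value of the functional of [J];
    the constant [B] bounds the functionals of all [J] at once. *)
Lemma fano_interior : P° 0.
Proof.
have hu J : exists u : 'cV[R]_d, JJ J -> forall k, k \in J -> dot (w k) u = 1.
  have [/fano_functional[u hu _]|nJ] := pselect (JJ J); first by exists u.
  by exists 0.
have [u hu'] := choice hu.
pose B := 1 + \sum_(J : {set K}) \sum_l `|u J l 0|.
have B0 : 0 < B by rewrite ltr_wpDr // sumr_ge0 // => J _; rewrite sumr_ge0.
apply/nbhs_ballP; exists B^-1 => /=; first by rewrite invr_gt0.
move=> y; rewrite -ball_normE /= sub0r normrN => yB.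
have [J JJJ [a a0 yE]] := fano_cover y.
rewrite yE; apply: fano_poly_mem => //.
have <- : dot y (u J) = \sum_(k in J) a k.
  rewrite yE dot_suml; apply: eq_bigr => k kJ.
  by rewrite dotZl hu' // mulr1.
rewrite mxE; apply: le_trans (ler_norm _) _; apply: le_trans (ler_norm_sum _ _ _) _.
apply: le_trans (_ : `|y| * (\sum_l `|u J l 0|) <= _).
  rewrite mulr_sumr; apply: ler_sum => l _; rewrite normrM.
  by apply: ler_wpM2r => //; apply: coord_le_norm.
have h : \sum_l `|u J l 0| <= B.
  rewrite /B (bigD1 J) //= addrCA lerDl addr_ge0 // sumr_ge0 // => J' _.
  by rewrite sumr_ge0.
apply: le_trans (ler_wpM2l (normr_ge0 y) h) _.
by rewrite -ler_pdivlMr // mul1r ltW.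
Qed.

Lemma fano_tight (V : 'cV[R]_d) (S : {set K}) : (forall k, dot (w k) V <= 1) ->
  (forall k, k \in S -> dot (w k) V = 1) -> exists2 J, JJ J & S \subset J.
Proof.
move=> V1 VS; apply: (@tight_subset _ _ _ w JJ (-1) V S) => //; last exact: fano_cover.
  move=> J /fano_functional[u uJ u_out]; exists u => // k /u_out.
  by rewrite mulN1r oppr_gt0 subr_lt0.
by move=> k; rewrite mulN1r oppr_ge0 subr_le0.
Qed.

Lemma poly_le1 (V : 'cV[R]_d) : (forall k, dot (w k) V <= 1) -> forall x, P x -> dot x V <= 1.
Proof.
move=> h x xP; rewrite -lerN2 -dotNr; apply: conv_ge xP => _ [k _ <-].
by rewrite dotNr lerN2.
Qed.

Lemma poly_face1 (V : 'cV[R]_d) : (forall k, dot (w k) V <= 1) ->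
  [set x | P x /\ dot x V = 1] = hull w [set k | dot (w k) V == 1]%SET.
Proof.
move=> h; rewrite -conv_fin.
have -> : [set w k | k in [set` [set k | dot (w k) V == 1]%SET]] =
    [set x | range w x /\ dot x (- V) = -1].
  apply/seteqP; split=> [_ [k + <-]|_ [[k _ <-] e]].
    by rewrite /= inE => /eqP e; split; [exists k|rewrite dotNr e].
  by exists k => //=; rewrite inE -[dot _ _]opprK -dotNr e opprK.
rewrite -conv_face; last first.
  by move=> _ [k _ <-]; rewrite dotNr lerN2.
apply/seteqP; split=> x /= [xP xV]; split=> //; first by rewrite dotNr xV.
by move: xV; rewrite dotNr => /oppr_inj.
Qed.

(** The bound [b] is negative, for a functional that is nonnegative around the origin vanishes.
    After scaling it to height 1, the vertices on the face lie in a common [J] by [fano_tight]. *)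
Lemma fano_proper_face F : is_face P F -> F <> P ->
  exists J (S : {set K}), [/\ JJ J, S \subset J & F = hull w S].
Proof.
move=> [u [b [hu FE]]] FP.
have [J0 JJJ0 _] := fano_cover 0.
have b0 : b <= 0 by have := hu 0 fano_zero; rewrite dot0l.
have bn : b != 0.
  apply/eqP => b_eq; apply: FP; rewrite FE b_eq.
  have -> : u = 0.
    by apply: interior_functional fano_interior _ => x /hu; rewrite b_eq.
  by apply/seteqP; split=> [x []//|x xP]; split=> //; rewrite dot0r.
have blt : b < 0 by rewrite lt_neqAle bn.
pose V := b^-1 *: u.
have V1 k : dot (w k) V <= 1.
  rewrite dotZr -(mulVf bn) ler_nM2l ?invr_lt0 //; apply: hu.
  by apply: sub_conv; exists k.
have [J JJJ SJ] := @fano_tight V [set k | dot (w k) V == 1]%SET V1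
  (fun k => ltac:(by rewrite inE => /eqP)).
exists J, [set k | dot (w k) V == 1]%SET; split=> //.
rewrite -poly_face1 // FE; apply/seteqP; split=> x [xP xb]; split=> //.
  by rewrite dotZr xb mulVf.
by move: xb; rewrite dotZr => /(canRL (mulKf (invr_neq0 bn))); rewrite invrK mulr1.
Qed.

(** Tilt the functional of [J] by a small multiple of the coordinates outside [S], too small to
    spoil the strict inequalities outside [J]. *)
Lemma fano_subface_functional J (S : {set K}) : JJ J -> S \subset J ->
  exists2 V : 'cV[R]_d, forall k, k \in S -> dot (w k) V = 1 &
  forall k, k \notin S -> dot (w k) V < 1.
Proof.
move=> JJJ SJ; have [u uJ u_out] := fano_functional JJJ.
have [_ [e de _]] := fano_uni JJJ.
pose g := \sum_(k in J :\: S) e k.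
have [t t0 ht] := @exists_small R K (fun k => k \notin J) (fun k => 1 - dot (w k) u)
  (fun k => - dot (w k) g) (fun k => ltac:(by move/u_out; rewrite subr_gt0)).
have gE k : k \in J -> dot (w k) g = (k \notin S)%:R.
  move=> kJ; rewrite dot_sumr (eq_bigr (fun l => (l == k)%:R)); last first.
    by move=> l /setDP[lJ _]; rewrite de.2 // eq_sym.
  have [kS|kS] := boolP (k \in S).
    by rewrite big1 // => l /setDP[_ lS]; case: eqP => // lk; rewrite lk kS in lS.
  by rewrite sum_indicator1 // inE kS.
exists (u - t *: g) => k kS; rewrite dotBr dotZr.
  have kJ := fintype.subsetP SJ k kS.
  by rewrite uJ // gE // kS mulr0 subr0.
have [kJ|kJ] := boolP (k \in J).
  by rewrite uJ // gE // kS mulr1 gtrBl.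
by have := ht k kJ; lra.
Qed.

Lemma fano_face J (S : {set K}) : JJ J -> S \subset J ->
  is_face P (hull w S) /\ hull w S <> P.
Proof.
move=> JJJ SJ; have [V VS V_out] := fano_subface_functional JJJ SJ.
have V1 k : dot (w k) V <= 1.
  by have [/VS ->|/V_out/ltW] := boolP (k \in S).
have E : hull w S = [set x | P x /\ dot x V = 1].
  rewrite poly_face1 //; congr hull; apply/setP => k; rewrite inE.
  by have [/VS ->|/V_out/lt_eqF ->//] := boolP (k \in S); rewrite eqxx.
rewrite E; split; first by apply: face_of_le; apply: poly_le1.
move=> E'; have := fano_zero; rewrite -E' => -[_ /eqP].
by rewrite dot0l eq_sym oner_eq0.
Qed.

Lemma fano_hull_mem J (S : {set K}) k : JJ J -> S \subset J -> hull w S (w k) -> k \in S.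
Proof.
move=> JJJ SJ [a [a0 a1 wk]]; apply: contraT => kS.
have [V VS V_out] := fano_subface_functional JJJ SJ.
have := V_out k kS; rewrite wk dot_suml (eq_bigr a) ?a1 ?ltxx // => l lS.
by rewrite dotZl VS // mulr1.
Qed.

Lemma fano_hull_le J (S S' : {set K}) : JJ J -> S' \subset J ->
  hull w S `<=` hull w S' -> S \subset S'.
Proof.
move=> JJJ SJ' h; apply/fintype.subsetP => k kS.
by apply: (fano_hull_mem JJJ SJ'); apply: h; apply: hull_mem.
Qed.

Lemma fano_facet F : is_facet P F <-> exists2 J, JJ J & F = hull w J.
Proof.
split=> [[Ff FP Fmax]|[J JJJ ->]].
  have [J [S [JJJ SJ FE]]] := fano_proper_face Ff FP.
  exists J => //; have [Jf JP] := fano_face JJJ (fintype.subxx J).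
  have [|->//|//] := Fmax _ Jf; rewrite FE; exact: hull_subset.
have [Jf JP] := fano_face JJJ (fintype.subxx J); split=> // G Gf JG.
have [->|GP] := pselect (G = P); [by right|left].
have [J' [S [JJJ' SJ' GE]]] := fano_proper_face Gf GP.
rewrite GE in JG *; have JS := fano_hull_le JJJ' SJ' JG.
congr hull; apply/eqP; rewrite eq_sym eqEcard JS (fano_card JJJ) -(fano_card JJJ').
exact: subset_leq_card.
Qed.

Lemma fano_facet_vertices J : JJ J -> vertices (hull w J) = [set w k | k in [set` J]].
Proof.
move=> JJJ; apply/seteqP; split=> [x|_ [k kJ <-]].
  by rewrite -conv_fin; apply: vertices_conv.
have sk : [set k]%SET \subset J by rewrite finset.sub1set.
have [kf _] := fano_face JJJ sk.
have E : hull w [set k]%SET = [set w k].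
  by rewrite -conv_fin -conv1; congr conv; apply/seteqP;
    split=> [_ [l + <-]|_ ->]; rewrite /= ?inE; [move=> /eqP ->|exists k; rewrite //= inE].
rewrite /vertices /= -E; apply: face_subset kf _ _; first exact: hull_subset.
by apply: is_face_sub; case: (fano_face JJJ (fintype.subxx J)).
Qed.

Lemma fano_vertices : vertices P = range w.
Proof.
apply/seteqP; split=> [x|_ [k _ <-]]; first exact: vertices_conv.
have [J JJJ kJ] := fano_mem k.
have sk : [set k]%SET \subset J by rewrite finset.sub1set.
have [kf _] := fano_face JJJ sk.
have E : hull w [set k]%SET = [set w k].
  by rewrite -conv_fin -conv1; congr conv; apply/seteqP;
    split=> [_ [l + <-]|_ ->]; rewrite /= ?inE; [move=> /eqP ->|exists k; rewrite //= inE].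
by rewrite /vertices /= -E.
Qed.

Lemma fano_smooth : smooth_fano P.
Proof.
split; last 1 first.
- move=> F /fano_facet[J JJJ ->]; rewrite fano_facet_vertices //.
  apply: unibasis_Z_basis (fano_uni JJJ) => k l _ _; exact: fano_inj.
- exists (range w); split=> //; last by move=> _ [k _ <-]; apply: fano_Zlat.
  exact: finite_image.
- exact: fano_interior.
Qed.

End Fano.

(** * The fan of a labelled smooth Fano polytope *)

Lemma exists_max (R : realType) (I : finType) (P : I -> Prop) (f : I -> R) :
  (exists i, P i) -> exists2 i, P i & forall j, P j -> f j <= f i.
Proof.
move=> [i0 Pi0].
have [|i /asboolP Pi h] := @Order.TotalTheory.arg_maxP _ R I i0 (fun i => `[< P i >]) f.
  exact/asboolP.
by exists i => // j Pj; apply: h; apply/asboolP.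
Qed.

(** The pivot step of the simplex method, with pivot [dot (w p) (e k)]. *)
Lemma dual_exchange (R : realType) (m : nat) (K : finType) (w : K -> 'rV[R]_m)
    (J : {set K}) (e : K -> 'cV[R]_m) (k p : K) : dual w J e ->
  k \in J -> p \notin J -> dot (w p) (e k) != 0 ->
  exists e', dual w (p |: (J :\ k))%SET e'.
Proof.
move=> de kJ pJ a0; set a := dot (w p) (e k) in a0.
have pJk : p \notin (J :\ k)%SET by rewrite !inE negb_and pJ orbT.
pose e' i := if i == p then a^-1 *: e k else e i - (dot (w p) (e i) / a) *: e k.
have e'p : e' p = a^-1 *: e k by rewrite /e' eqxx.
have e'J i : i \in (J :\ k)%SET -> e' i = e i - (dot (w p) (e i) / a) *: e k.
  by move=> iJ; rewrite /e'; case: eqP => // ip; rewrite -ip iJ in pJk.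
have eJ i l : i \in J -> l \in J -> dot (w i) (e l) = (i == l)%:R by exact: de.2.
exists e'; split=> [y|i l].
  rewrite big_setU1 //= e'p (eq_bigr (fun i => dot y (e i) *: w i -
     (dot y (e k) / a) *: (dot (w p) (e i) *: w i))); last first.
    move=> i iJ; rewrite e'J // dotBr dotZr scalerBl scalerA; congr (_ - _ *: _).
    by ring.
  rewrite sumrB -scaler_sumr dotZr.
  have hy := de.1 y; have hp := de.1 (w p).
  rewrite (big_setD1 k) //= in hy; rewrite (big_setD1 k) //= -/a in hp.
  have -> : \sum_(i in (J :\ k)%SET) dot (w p) (e i) *: w i = w p - a *: w k.
    by apply: (addrI (a *: w k)); rewrite -hp [RHS]addrC subrK.
  rewrite scalerBr scalerA divfK // [_^-1 * _]mulrC.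
  by rewrite opprB addrC -addrA subrK addrC.
case/setU1P => [->|iJ] /setU1P[->|lJ].
- by rewrite e'p dotZr -/a mulVf // eqxx.
- rewrite e'J // dotBr dotZr -/a divfK // subrr.
  by case: eqP => // pl; rewrite pl lJ in pJk.
- have /setD1P[ik iJ'] := iJ; rewrite e'p dotZr eJ // (negPf ik) mulr0.
  by case: eqP => // pl; rewrite -pl iJ in pJk.
- have /setD1P[ik iJ'] := iJ; have /setD1P[lk lJ'] := lJ.
  by rewrite e'J // dotBr dotZr (eJ i l) // (eJ i k) // (negPf ik) mulr0 subr0.
Qed.

Section Labelled.
Context {R : realType} {n d : nat} (v : 'I_n -> 'rV[R]_d).
Hypotheses (d_gt0 : (0 < d)%N) (wl : well_labelled v) (sf : smooth_fano (vpoly v)).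
Local Notation P := (vpoly v).

Let v_inj : injective v. Proof. by case: wl. Qed.

Let P_conv : P = conv (range v). Proof. by []. Qed.

Let P_int : P° 0. Proof. by case: sf. Qed.

Let P_zero : P 0. Proof. exact: nbhs_singleton P_int. Qed.

Let vP k : P (v k). Proof. by apply: sub_conv; exists k. Qed.

(** A vertex of [P] on a facet is a vertex of that facet, so the lattice basis given by smoothness
    consists of all [v k] on the supporting hyperplane. This hyperplane misses the interior point 0
    and can be scaled to height 1. *)
Lemma labelled_facet F : is_facet P F -> exists J : {set 'I_n},
  [/\ unibasis v J, F = hull v J & exists2 u : 'cV[R]_d,
    forall k, k \in J -> dot (v k) u = 1 & forall k, k \notin J -> dot (v k) u < 1].
Proof.
move=> Ff; have [[u [b [hu FE]]] FP _] := Ff.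
pose J := [set k | dot (v k) u == b]%SET.
have FJ : F = hull v J.
  rewrite FE -conv_fin conv_face; last by move=> x xv; apply: hu; apply: sub_conv.
  congr conv; apply/seteqP; split=> [_ [[k _ <-] kb]|_ [k + <-]].
    by exists k => //=; rewrite inE kb eqxx.
  by rewrite /= inE => /eqP kb; split=> //; exists k.
have vF : vertices F = [set v k | k in [set` J]].
  apply/seteqP; split=> [x|_ [k kJ <-]].
    by rewrite FJ -conv_fin; apply: vertices_conv.
  have vk : vertices P (v k) by have [_ <- _] := wl; exists k.
  apply: face_subset vk _ _; last by rewrite FE => x [].
  by move=> _ ->; rewrite FJ; apply: hull_mem.
exists J; split=> //.
  apply: Z_basis_unibasis => [k l _ _|]; first exact: v_inj.
  by rewrite -vF; case: sf => _ _; apply.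
have b0 : b <= 0 by have := hu 0 P_zero; rewrite dot0l.
have bn : b != 0.
  apply/eqP => b_eq; apply: FP; rewrite FE b_eq.
  have -> : u = 0.
    by apply: interior_functional P_int _ => x /hu; rewrite b_eq.
  by apply/seteqP; split=> [x []//|x xP]; split=> //; rewrite dot0r.
have blt : b^-1 < 0 by rewrite invr_lt0 lt_neqAle bn.
exists (b^-1 *: u) => k; rewrite inE dotZr; first by move=> /eqP ->; rewrite mulVf.
move=> kb; rewrite -(mulVf bn) ltr_nM2l // lt_neqAle eq_sym kb; exact: hu.
Qed.

Lemma facet_index_data J : facet_index v J ->
  unibasis v J /\ exists2 u : 'cV[R]_d,
    forall k, k \in J -> dot (v k) u = 1 & forall k, k \notin J -> dot (v k) u < 1.
Proof.
move=> [cJ /labelled_facet[J' [uJ' E [u uJ u_out]]]].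
suff -> : J = J' by split=> //; exists u.
have [_ [e de _]] := uJ'.
apply/eqP; rewrite eqEcard cJ -(dual_card de) leqnn andbT.
apply/fintype.subsetP => k kJ.
have : hull v J' (v k) by rewrite -E; apply: sub_conv; exists k.
move=> [a [a0 a1 vk]]; apply: contraT => /u_out; rewrite vk dot_suml.
by rewrite (eq_bigr a) ?a1 ?ltxx // => l lJ; rewrite dotZl uJ // mulr1.
Qed.

Lemma facet_indexP J : facet_index v J <->
  exists2 u : 'cV[R]_d, forall k, k \in J -> dot (v k) u = 1 &
    (forall k, k \notin J -> dot (v k) u < 1) /\ exists e, dual v J e.
Proof.
split=> [/facet_index_data[[_ [e de _]] [u uJ u_out]]|[u uJ [u_out [e de]]]].
  by exists u => //; split=> //; exists e.
have cJ := dual_card de; split=> //.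
have u1 k : dot (v k) u <= 1 by have [/uJ ->|/u_out/ltW] := boolP (k \in J).
have E : vconv v J = [set x | P x /\ dot x (- u) = -1].
  rewrite /vconv conv_fin P_conv conv_face; last by move=> _ [k _ <-]; rewrite dotNr lerN2.
  rewrite -conv_fin; congr conv; apply/seteqP; split=> [_ [k kJ <-]|_ [[k _ <-] +]].
    by split; [exists k|rewrite dotNr uJ].
  rewrite dotNr => /oppr_inj k1; exists k => //=; apply: contraT => /u_out.
  by rewrite k1 ltxx.
rewrite E; apply: (facet_criterion de) => [x xP|||].
- by rewrite dotNr lerN2; apply: poly_le1 xP.
- by rewrite oppr_eq0 oner_eq0.
- by move=> k kJ; split; [exact: vP|rewrite dotNr uJ].
- by exists 0; rewrite // dot0l eq_sym oppr_eq0 oner_eq0.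
Qed.

Let facetE (J : {set 'I_n}) k (u u' : 'cV[R]_d) e : dual v J e -> k \in J ->
  (forall i, i \in (J :\ k)%SET -> dot (v i) u = dot (v i) u') ->
  forall y : 'rV[R]_d, dot y u' - dot y u = (dot (v k) u' - dot (v k) u) * dot y (e k).
Proof.
move=> de kJ h y; rewrite -dotBr -dotZr; congr (dot _ _).
apply: (dual_eq de) => i iJ; rewrite dotBr dotZr de.2 //.
have [->|ik] := eqVneq i k; first by rewrite mulr1.
by rewrite mulr0 h ?subrr // !inE ik.
Qed.

(* The supporting hyperplane of a facet is rotated about one of its ridges
   until it meets a further vertex. *)
Lemma facet_adjacent J e k : facet_index v J -> dual v J e -> k \in J ->
  exists p, [/\ p \notin J, facet_index v (p |: (J :\ k))%SET & dot (v p) (e k) < 0].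
Proof.
move=> fJ de kJ; have [_ [u uJ u_out]] := facet_index_data fJ.
have [p0 hp0] : exists p, dot (v p) (e k) < 0.
  apply: contrapT => h.
  have e0 : e k = 0.
    apply: interior_functional P_int _ => x; apply: conv_ge => _ [p _ <-].
    by rewrite leNgt; apply/negP => lt; apply: h; exists p.
  by have := de.2 k k kJ kJ; rewrite e0 dot0r eqxx => /eqP; rewrite eq_sym oner_eq0.
(* The rotated functionals are [u + t *: e k] with [t <= 0], and [r i] is the [t] at which the
   hyperplane reaches [v i]; the largest one is met first. *)
pose r i := (1 - dot (v i) u) / dot (v i) (e k).
have [p hp pmax] := @exists_max R _ (fun i => dot (v i) (e k) < 0) r
  (ex_intro _ p0 hp0).
have pJ : p \notin J.
  apply/negP => pJ; move: hp; rewrite de.2 //; case: eqP => _; rewrite ?ltxx //.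
  by rewrite ltr10.
have fp := u_out p pJ.
have rp : r p < 0 by rewrite /r pmulr_rlt0 ?invr_lt0 // subr_gt0.
pose u' := u + r p *: e k.
have u'E i : dot (v i) u' = dot (v i) u + r p * dot (v i) (e k).
  by rewrite dotDr dotZr.
have u'p : dot (v p) u' = 1.
  by rewrite u'E /r divfK ?lt_eqF // addrC subrK.
have u'J i : i \in (J :\ k)%SET -> dot (v i) u' = 1.
  case/setD1P => ik iJ; rewrite u'E uJ // de.2 // (negPf ik) mulr0 addr0 //.
have u'1 i : dot (v i) u' <= 1.
  have ui : dot (v i) u <= 1 by have [/uJ ->|/u_out/ltW] := boolP (i \in J).
  rewrite u'E; have [lt|ge] := ltP (dot (v i) (e k)) 0; last first.
    by have := ler_wpM2l ge (ltW rp); lra.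
  by have := pmax i lt; rewrite {1}/r ler_ndivrMr //; lra.
pose J' := (p |: (J :\ k))%SET.
have [e' de'] := dual_exchange de kJ pJ (ltr0_neq0 hp).
have Ff : is_facet P [set x | P x /\ dot x (- u') = -1].
  apply: (facet_criterion de') => [x xP|||].
  - by rewrite dotNr lerN2; apply: poly_le1 xP.
  - by rewrite oppr_eq0 oner_eq0.
  - by move=> i iJ; split=> //; rewrite dotNr; case/setU1P: iJ => [->|/u'J ->] //; rewrite u'p.
  - by exists 0; rewrite // dot0l eq_sym oppr_eq0 oner_eq0.
have [S [[_ [eS dS _]] FE [uS uS1 uS_out]]] := labelled_facet Ff.
have sub : J' \subset S.
  apply/fintype.subsetP => i iJ'; have : hull v S (v i).
    by rewrite -FE; split=> //; rewrite dotNr; case/setU1P: iJ' => [->|/u'J ->] //; rewrite u'p.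
  move=> [a [a0 a1 vi]]; apply: contraT => /uS_out; rewrite vi dot_suml.
  by rewrite (eq_bigr a) ?a1 ?ltxx // => l lJ; rewrite dotZl uS1 // mulr1.
have eS' : J' = S by apply/eqP; rewrite eqEcard sub (dual_card dS) /J' (dual_card de') leqnn.
exists p; split=> //; apply/facet_indexP; exists uS; rewrite -/J' eS' //.
by split=> //; exists eS.
Qed.

Lemma facet_index0 : facet_index v [set i : 'I_n | (i < d)%N]%SET.
Proof.
have [_ vv /labelled_facet[J [uJ FE [u u1 u_out]]]] := wl.
have sub1 : [set i : 'I_n | (i < d)%N]%SET \subset J.
  apply/fintype.subsetP => i iJ; have : hull v J (v i).
    by rewrite -FE; apply: sub_conv; exists i.
  move=> [a [a0 a1 vi]]; apply: contraT => /u_out; rewrite vi dot_suml.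
  by rewrite (eq_bigr a) ?a1 ?ltxx // => l lJ; rewrite dotZl u1 // mulr1.
have sub2 : J \subset [set i : 'I_n | (i < d)%N]%SET.
  apply/fintype.subsetP => k kJ.
  have vk : vertices P (v k) by rewrite -vv; exists k.
  have : vertices (vconv v [set i : 'I_n | (i < d)%N]%SET) (v k).
    apply: face_subset vk _ _; last by case: wl => _ _ [/is_face_sub].
    by move=> _ ->; rewrite FE; apply: hull_mem.
  by move/vertices_conv => [i iJ /v_inj <-].
have eJ : [set i : 'I_n | (i < d)%N]%SET = J by apply/eqP; rewrite finset.eqEsubset sub1.
have [_ [e de _]] := uJ.
by apply/facet_indexP; rewrite eJ; exists u => //; split=> //; exists e.
Qed.

(** In the cone over [J], the height of the lattice point [v k] is the sum of its nonnegative
    integral coordinates, hence at least 1, whereas vertices outside [J] have height less than 1. *)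
Let no_cone J k : facet_index v J -> k \notin J -> v k != 0 ->
  ~ cone_hull v J (v k).
Proof.
move=> fJ kJ vk0 h; have [[_ [e de eZ]] [u u1 u_out]] := facet_index_data fJ.
have vkZ : Zlat (v k).
  have [X [_ XZ XE]] : lattice_polytope P by case: sf.
  apply: XZ; have : vertices P (v k) by have [_ <- _] := wl; exists k.
  by rewrite XE; apply: vertices_conv.
have := u_out k kJ; rewrite {1}[v k](de.1) dot_suml (eq_bigr (fun i => dot (v k) (e i))).
  move=> s1; case/negP: vk0; rewrite [v k](de.1) big1 // => i iJ.
  move/(cone_hull_dual de): (h) => hi.
  have [->|ne] := eqVneq (dot (v k) (e i)) 0; first by rewrite scale0r.
  have : 1 <= dot (v k) (e i) by rewrite int_ge1 ?eZ // lt_neqAle eq_sym ne hi.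
  rewrite leNgt => /negP[]; apply: le_lt_trans s1.
  by rewrite (bigD1 i) //= lerDl sumr_ge0 // => l /andP[lJ _]; apply: hi.
by move=> i iJ; rewrite dotZl u1 // mulr1.
Qed.

Let facet_choice : exists uu : {set 'I_n} -> 'cV[R]_d, forall J, facet_index v J ->
  (forall k, k \in J -> dot (v k) (uu J) = 1) /\ forall k, k \notin J -> dot (v k) (uu J) < 1.
Proof.
have h J : exists u : 'cV[R]_d, facet_index v J -> (forall k, k \in J -> dot (v k) u = 1) /\
    forall k, k \notin J -> dot (v k) u < 1.
  have [/facet_index_data[_ [u u1 u2]]|nJ] := pselect (facet_index v J); first by exists u.
  by exists 0.
by have [uu huu] := choice h; exists uu.
Qed.

(** Take the facet whose functional is largest at [y]. If [y] had a negative coordinate there, the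
    facet across the corresponding ridge would have a larger value by [facetE]. *)
Lemma facets_cover y : exists2 J, facet_index v J & cone_hull v J y.
Proof.
have [uu huu] := facet_choice.
have [J fJ Jmax] := @exists_max R _ (facet_index v) (fun J => dot y (uu J))
  (ex_intro _ _ facet_index0).
exists J => //; have [[_ [e de _]] _] := facet_index_data fJ.
apply/(cone_hull_dual de) => k kJ; rewrite leNgt; apply/negP => lt.
have [p [pJ fJ' ep]] := facet_adjacent fJ de kJ.
have := Jmax _ fJ'; rewrite leNgt => /negP; apply; rewrite -subr_gt0.
have [u1 u2] := huu _ fJ; have [u1' u2'] := huu _ fJ'.
rewrite (@facetE J k _ _ e de kJ) => [|i iJ]; last first.
  by rewrite u1' ?u1 //; [case/setD1P: iJ|rewrite inE iJ orbT].
rewrite nmulr_rgt0 // u1 // subr_lt0 u2' // !inE eqxx /= orbF.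
by apply: contraNneq pJ => <-.
Qed.

Lemma vertex_neq0 k : v k != 0.
Proof.
apply/eqP => vk0; have : vertices P (v k) by have [_ <- _] := wl; exists k.
move=> [u [b [hu E]]]; have : [set v k] (v k) by [].
rewrite {1}E vk0 => -[_]; rewrite dot0l => b0.
have u0 : u = 0 by apply: interior_functional P_int _ => x /hu; rewrite -b0.
have fJ := facet_index0; have [_ [u' u1 _]] := facet_index_data fJ.
have [i iJ] : exists i, i \in [set i : 'I_n | (i < d)%N]%SET.
  by apply/card_gt0P; case: fJ => ->.
have : [set v k] (v i) by rewrite E; split=> //; rewrite u0 dot0r.
by move=> /= vi; have := u1 i iJ; rewrite vi vk0 dot0l => /eqP; rewrite eq_sym oner_eq0.
Qed.

Lemma fano_fan_labelled : fano_fan v (facet_index v).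
Proof.
split.
- by move=> J /facet_index_data[].
- by move=> J /facet_index_data[].
- move=> k; have [J fJ h] := facets_cover (v k); exists J => //.
  by apply: contraT => kJ; case: (no_cone fJ kJ (vertex_neq0 k) h).
- exact: facets_cover.
Qed.

(** * The sets SF and strict convexity *)

(** Strict convexity of the function that is linear on the cones over the facets and has the values
    [x] at the vertices: a global form of the inequalities for adjacent facets that define [SF]. *)
Definition sconvex (x : 'rV[R]_n.+1) : Prop :=
  forall J, facet_index v J -> exists2 l : 'cV[R]_d,
    forall i, i \in J -> dot (v i) l = x 0 (lift ord0 i) &
    forall k, k \notin J -> dot (v k) l < x 0 (lift ord0 k).

Lemma ridge_sign (I : {set 'I_n}) q p e :
  adjacent v I q p -> dual v (q |: I)%SET e -> dot (v p) (e q) < 0.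
Proof.
move=> [qI pI qp [fF fG]] de.
have [_ [u u1 u2]] := facet_index_data fF.
have [_ [u' u1' u2']] := facet_index_data fG.
have pF : p \notin (q |: I)%SET by rewrite !inE negb_or eq_sym qp.
have qG : q \notin (p |: I)%SET by rewrite !inE negb_or qp.
have qF : q \in (q |: I)%SET by rewrite setU11.
have pG : p \in (p |: I)%SET by rewrite setU11.
have h : dot (v p) u' - dot (v p) u = (dot (v q) u' - dot (v q) u) * dot (v p) (e q).
  apply: facetE de qF _ _ => i; rewrite setU1K // => iI.
  by rewrite u1 ?u1' // inE iI orbT.
rewrite (u1' p pG) (u1 q qF) in h.
have h1 := u2 p pF; have h2 := u2' q qG.
rewrite -subr_lt0 in h2; rewrite -(nmulr_rgt0 _ h2) -h subr_gt0 //.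
Qed.

Lemma ridge_coeffs_unique (I : {set 'I_n}) q p l0 (l : 'I_n -> R) e :
  adjacent v I q p -> dual v (q |: I)%SET e -> ridge_coeffs v I q p l0 l ->
  [/\ dot (v p) (e q) < 0, l p = (1 - dot (v p) (e q))^-1,
      l q = 1 - l p, forall i, i \in I -> l i = l p * dot (v p) (e i) &
      l0 = 1 - \sum_(i in I) l i].
Proof.
move=> adj de [E E1 E2]; have [qI _ _ _] := adj.
have qF : q \in (q |: I)%SET by rewrite setU11.
have eqp := ridge_sign adj de.
have IF i : i \in I -> i \in (q |: I)%SET by move=> iI; rewrite inE iI orbT.
have lq : l q = 1 - l p by rewrite -E1 addrK.
have Ee i : i \in (q |: I)%SET -> l q * (q == i)%:R + l p * dot (v p) (e i) =
    if i \in I then l i else 0.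
  move=> iF; have := congr1 (fun y => dot y (e i)) E.
  rewrite dotDl !dotZl de.2 // => ->; apply: (dual_coeff de) => //.
  exact: finset.subsetUr.
have lp : l p * (1 - dot (v p) (e q)) = 1.
  by have := Ee q qF; rewrite eqxx (negPf qI) mulr1 lq; lra.
split=> //.
- have ne : 1 - dot (v p) (e q) != 0 by rewrite gt_eqF // subr_gt0 (lt_trans eqp).
  by apply: (mulIf ne); rewrite lp mulVf.
- move=> i iI; have := Ee i (IF i iI); rewrite iI => <-.
  by case: eqP => [qi|_]; [rewrite qi iI in qI|rewrite mulr0 add0r].
- by rewrite -E2 addrK.
Qed.

(** When [x 0 ord0 = 0], this form measures, up to the factor [l p], how far the height at [p] lies
    above the linear function of the other facet. *)
Lemma phi_FGE (I : {set 'I_n}) q p l0 (l : 'I_n -> R) (f : 'cV[R]_d) (x : 'rV[R]_n.+1) :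
  ridge_coeffs v I q p l0 l ->
  (forall i, i \in (q |: I)%SET -> dot (v i) f = x 0 (lift ord0 i)) ->
  phi_FG I q p l0 l x = l p * (x 0 (lift ord0 p) - dot (v p) f) - l0 * x 0 ord0.
Proof.
move=> [E _ _] hf; have := congr1 (fun y => dot y f) E.
rewrite dotDl !dotZl dot_suml hf ?setU11 // [RHS](eq_bigr (fun i => l i * x 0 (lift ord0 i))).
  by rewrite /phi_FG => h; rewrite -h; ring.
by move=> i iI; rewrite dotZl hf // inE iI orbT.
Qed.

Lemma ridge_coeffs_exist (I : {set 'I_n}) q p :
  adjacent v I q p -> exists l0 l, ridge_coeffs v I q p l0 l.
Proof.
move=> adj; have [qI pI qp [fF fG]] := adj.
have [[_ [e de _]] _] := facet_index_data fF.
have pF : p \notin (q |: I)%SET by rewrite !inE negb_or eq_sym qp.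
set a := dot (v p) (e q).
have a0 : a < 0 := ridge_sign adj de.
pose b := (1 - a)^-1.
have b0 : b * (1 - a) = 1 by rewrite mulVf // gt_eqF // subr_gt0 (lt_trans a0).
pose l i := if i == p then b else if i == q then - a * b else b * dot (v p) (e i).
have lI i : i \in I -> l i = b * dot (v p) (e i).
  move=> iI; rewrite /l; case: eqP => [ip|_]; first by rewrite -ip iI in pI.
  by case: eqP => // iq; rewrite -iq iI in qI.
have lp : l p = b by rewrite /l eqxx.
have lq : l q = - a * b by rewrite /l (negPf qp) eqxx.
exists (1 - \sum_(i in I) l i), l; split; last by rewrite subrK.
- rewrite lp lq (eq_bigr (fun i => b *: (dot (v p) (e i) *: v i))); last first.
    by move=> i iI; rewrite lI // scalerA.
  rewrite -scaler_sumr {1}[v p](de.1) big_setU1 //= -/a scalerDr scalerA addrA.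
  by rewrite -scalerDl mulNr mulrC addNr scale0r add0r.
- by rewrite lp lq; lra.
Qed.

Lemma phi_FG_functional (I : {set 'I_n}) q p l0 (l : 'I_n -> R) :
  exists u : 'cV[R]_n.+1, forall x, phi_FG I q p l0 l x = dot x u.
Proof.
exists (l p *: delta_mx (lift ord0 p) 0 + l q *: delta_mx (lift ord0 q) 0
  - \sum_(i in I) l i *: delta_mx (lift ord0 i) 0 - l0 *: delta_mx ord0 0) => x.
have dE i : dot x (delta_mx i 0) = x 0 i.
  rewrite mxE (bigD1 i) //= mxE !eqxx mulr1 big1 ?addr0 // => j /negPf ji.
  by rewrite mxE ji mulr0.
rewrite !dotBr dotDr !dotZr !dE dot_sumr /phi_FG; congr (_ - _ - _).
by apply: eq_bigr => i _; rewrite dotZr dE.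
Qed.

(** Passage from local to global convexity. For a vertex [v k], take the facet whose linear function
    is largest there; if [k] were not in it, crossing a ridge would increase the value. *)
Lemma SF_sconvex (x : 'rV[R]_n.+1) : (SF v)° x -> x 0 ord0 = 0 -> sconvex x.
Proof.
move=> /nbhs_ballP[r /= r0 hr] x0.
(* Lowering the height at [p] by [r / 2] stays in [SF] and lowers the form by [r / 2 * l p], so the
   form was positive. *)
have pos I q p l0 l : adjacent v I q p -> ridge_coeffs v I q p l0 l ->
    0 < phi_FG I q p l0 l x.
  move=> adj hl; have [_ _ _ [fF _]] := adj.
  have [[_ [e de _]] _] := facet_index_data fF.
  have [eqp lp _ _ _] := ridge_coeffs_unique adj de hl.
  have lp0 : 0 < l p by rewrite lp invr_gt0 subr_gt0 (lt_trans eqp).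
  pose y : 'rV[R]_n.+1 := x - (r / 2) *: delta_mx 0 (lift ord0 p).
  have yS : SF v y.
    apply: hr; rewrite -ball_normE /= /y opprB addrC subrK.
    apply: norm_rV_lt => // k; rewrite !mxE eqxx /=.
    case: eqP => _; rewrite ?mulr0 ?normr0 // mulr1 gtr0_norm ?divr_gt0 //.
    by rewrite ltr_pdivrMr // ltr_pMr // ltr1n.
  have := yS I q p l0 l adj hl; have [u hu] := phi_FG_functional I q p l0 l.
  rewrite !hu /y dotBl dotZl -hu => h; apply: lt_le_trans (_ : r / 2 * l p <= _).
    by rewrite mulr_gt0 // divr_gt0.
  move: h; rewrite subr_ge0; congr (_ * _ <= _).
  rewrite -hu /phi_FG !mxE !eqxx !(inj_eq (@lift_inj _ _)).
  have [qI pI qp _] := adj; rewrite (negPf qp) (negPf (neq_lift _ _)) /= mulr1 !mulr0 addr0 subr0 big1 ?subr0 // => i iI.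
  have /negPf ip : i != p by apply: contraNneq pI => <-.
  by rewrite mxE (inj_eq (@lift_inj _ _)) ip andbF mulr0.
have hl J : exists l : 'cV[R]_d, facet_index v J ->
    forall i, i \in J -> dot (v i) l = x 0 (lift ord0 i).
  have [/facet_index_data[[_ [e de _]] _]|nJ] := pselect (facet_index v J); last by exists 0.
  exists (\sum_(k in J) x 0 (lift ord0 k) *: e k) => _ i iJ.
  exact: (dual_functional de (fun k => x 0 (lift ord0 k))).
have [l hl'] := choice hl.
have maxk k J : facet_index v J ->
    (forall J', facet_index v J' -> dot (v k) (l J') <= dot (v k) (l J)) -> k \in J.
  move=> fJ Jmax; apply: contraT => kJ.
  have [[_ [e de _]] _] := facet_index_data fJ.
  have [i iJ ei] : exists2 i, i \in J & dot (v k) (e i) < 0.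
    apply: contrapT => h; apply: (no_cone fJ kJ (vertex_neq0 k)).
    apply/(cone_hull_dual de) => i iJ; rewrite leNgt; apply/negP => lt.
    by apply: h; exists i.
  have [p [pJ fJ' ep]] := facet_adjacent fJ de iJ.
  have JE : (i |: (J :\ i))%SET = J by rewrite finset.setD1K.
  have adj : adjacent v (J :\ i)%SET i p.
    split; rewrite ?JE //; first by rewrite !inE eqxx.
      by rewrite !inE negb_and pJ orbT.
    by apply: contraNneq pJ => <-.
  have [l0 [c hc]] := ridge_coeffs_exist adj.
  have := pos _ _ _ _ _ adj hc.
  rewrite (phi_FGE (f := l J) hc) ?JE //; last exact: hl'.
  have de' := de; rewrite -JE in de'.
  have [_ cp _ _ _] := ridge_coeffs_unique adj de' hc.
  rewrite x0 mulr0 subr0 pmulr_rgt0; last by rewrite cp invr_gt0 subr_gt0 (lt_trans ep).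
  rewrite subr_gt0 => xp.
  have D := @facetE J i (l J) (l (p |: (J :\ i))%SET) e de iJ.
  have {}D := D (fun j jJ => etrans (hl' J fJ j (proj2 (elimT setD1P jJ)))
     (esym (hl' _ fJ' j (setU1r p jJ)))).
  have Dp := D (v p); rewrite (hl' _ fJ' p) ?setU11 // in Dp.
  have c0 : dot (v i) (l (p |: (J :\ i))%SET) - dot (v i) (l J) < 0.
    by rewrite -(nmulr_lgt0 _ ep) -Dp subr_gt0.
  have := Jmax _ fJ'; rewrite leNgt -subr_gt0 D => /negP[].
  by rewrite nmulr_rgt0.
move=> J fJ; exists (l J); first exact: hl'.
move=> k kJ; have [J' fJ' Jmax] := @exists_max R _ (facet_index v)
  (fun J => dot (v k) (l J)) (ex_intro _ _ facet_index0).
have kJ' := maxk k J' fJ' Jmax.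
rewrite -(hl' J' fJ' k kJ') lt_neqAle Jmax // andbT.
apply: contraNneq kJ => e; apply: maxk => // J'' fJ''; rewrite e; exact: Jmax.
Qed.

(** Finitely many strict linear inequalities hold in a neighbourhood. The coefficients of a ridge
    are quantified inside [SF]; by their uniqueness one neighbourhood per triple suffices. *)
Lemma sconvex_SF (x : 'rV[R]_n.+1) : x 0 ord0 = 0 -> sconvex x -> (SF v)° x.
Proof.
move=> x0 sx.
pose Q (t : {set 'I_n} * 'I_n * 'I_n) (y : 'rV[R]_n.+1) := forall l0 l,
  adjacent v t.1.1 t.1.2 t.2 -> ridge_coeffs v t.1.1 t.1.2 t.2 l0 l ->
  0 <= phi_FG t.1.1 t.1.2 t.2 l0 l y.
have : \forall y \near x, forall t, Q t y.
  apply: (@filter_forall _ _ Q (nbhs x)) => -[[I q] p]; rewrite /Q /=.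
  have [adj|nadj] := pselect (adjacent v I q p); last by apply: nearW => y l0 l.
  have [l0 [l hl]] := ridge_coeffs_exist adj.
  have [_ _ _ [fF _]] := adj.
  have [[_ [e de _]] _] := facet_index_data fF.
  have [eqp lp lq li l0E] := ridge_coeffs_unique adj de hl.
  have pos : 0 < phi_FG I q p l0 l x.
    have [f hf1 hf2] := sx _ fF; rewrite (phi_FGE hl hf1) x0 mulr0 subr0 mulr_gt0 //.
      by rewrite lp invr_gt0 subr_gt0 (lt_trans eqp).
    rewrite subr_gt0 hf2 // !inE negb_or; have [qI pI qp _] := adj.
    by rewrite eq_sym qp.
  have [u hu] := phi_FG_functional I q p l0 l.
  rewrite hu in pos.
  have /cvgrPdist_lt/(_ _ pos) := @functional_continuous R _ u x.
  apply: filterS => y; rewrite ltr_norml => /andP[_ hy] l0' l' _ hl'.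
  have [_ lp' lq' li' l0E'] := ridge_coeffs_unique adj de hl'.
  have ep : l' p = l p by rewrite lp lp'.
  have ei i : i \in I -> l' i = l i by move=> iI; rewrite li' // li // ep.
  have -> : phi_FG I q p l0' l' y = phi_FG I q p l0 l y.
    rewrite /phi_FG ep lq' lq ep l0E' l0E.
    rewrite (eq_bigr (fun i => l i * y 0 (lift ord0 i))); last by move=> i /ei ->.
    by congr (_ - (1 - _) * _); apply: eq_bigr => i /ei ->.
  by rewrite hu; lra.
by apply: filterS => y hy I q p l0 l adj hl; apply: (hy (I, q, p)) adj hl.
Qed.

(** The signs of the remaining heights come from strict convexity: the linear function of the first
    facet is zero on its vertices, hence zero, and the other heights lie above it. *)
Lemma SF0P (x : 'rV[R]_n.+1) : SF0 v x <-> [/\ x 0 ord0 = 0,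
  forall i : 'I_n, (i < d)%N -> x 0 (lift ord0 i) = 0 & sconvex x].
Proof.
split=> [[xS [x0 xi _]]|[x0 xi sx]]; first by split=> //; apply: SF_sconvex.
split; first exact: sconvex_SF.
split=> // k dk; have [l l1 l2] := sx _ facet_index0.
have [[_ [e de _]] _] := facet_index_data facet_index0.
have l0 : l = 0.
  apply: (dual_eq de) => i iJ; rewrite dot0r l1 // xi //.
  by move: iJ; rewrite inE.
by have := l2 k; rewrite inE -leqNgt dk l0 dot0r => /(_ isT)/ltW.
Qed.

End Labelled.

(** * Cones over complete unimodular complexes *)

Section AffineHull.
Context {R : realType} {m : nat} {K : finType}.
Implicit Types (w : K -> 'rV[R]_m) (S : {set K}).

Lemma affine_sum (A : set 'rV[R]_m) w S (a : K -> R) : is_affine A ->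
  (forall k, k \in S -> A (w k)) -> \sum_(k in S) a k = 1 ->
  A (\sum_(k in S) a k *: w k).
Proof.
move=> affA wA a1; have [S0|[k0 k0S]] := set_0Vmem S.
  by move: a1; rewrite S0 big_set0 => /eqP; rewrite eq_sym oner_eq0.
(* [is_affine] speaks of two points only. The directions at [w k0] are closed under scaling, and
   under sums by doubling a midpoint. *)
have AZ z t : A (w k0 + z) -> A (w k0 + t *: z).
  move=> hz; have := affA _ _ t hz (wA _ k0S); congr (A _).
  by rewrite scalerDr scalerBl scale1r addrAC addrCA subrr addr0.
have AD z z' : A (w k0 + z) -> A (w k0 + z') -> A (w k0 + (z + z')).
  move=> hz hz'; have := affA _ _ 2^-1 hz hz'.
  have -> : 2^-1 *: (w k0 + z) + (1 - 2^-1) *: (w k0 + z') = w k0 + 2^-1 *: (z + z').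
    have -> : 1 - 2^-1 = 2^-1 :> R by field.
    rewrite -scalerDr addrACA scalerDr; congr (_ + _).
    have -> : w k0 + w k0 = 2%:R *: w k0 by rewrite scaler_nat mulr2n.
    by rewrite scalerA mulVf ?scale1r // pnatr_eq0.
  by move/(AZ _ 2); rewrite scalerA divff ?scale1r // pnatr_eq0.
have -> : \sum_(k in S) a k *: w k = w k0 + \sum_(k in S) a k *: (w k - w k0).
  under [X in _ + X]eq_bigr do rewrite scalerBr.
  by rewrite sumrB -scaler_suml a1 scale1r addrC subrK.
apply: (big_ind (fun z => A (w k0 + z))) => [||k kS].
- by rewrite addr0; apply: wA.
- exact: AD.
- by apply: AZ; rewrite addrC subrK; apply: wA.
Qed.

Lemma aff_hull w S : S != finset.set0 ->
  aff (hull w S) = [set y | exists2 a : K -> R,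
    \sum_(k in S) a k = 1 & y = \sum_(k in S) a k *: w k].
Proof.
move=> S0; apply/seteqP; split.
  apply: smallest_sub.
    move=> x y t [a a1 ->] [b b1 ->].
    exists (fun k => t * a k + (1 - t) * b k).
      by rewrite big_split /= -!mulr_sumr a1 b1 !mulr1 addrC subrK.
    rewrite !scaler_sumr -big_split; apply: eq_bigr => k _ /=.
    by rewrite !scalerA scalerDl.
  by move=> y [a [_ a1 ->]]; exists a.
move=> _ [a a1 ->] B [affB hB]; apply: affine_sum => // k kS.
by apply: hB; apply: hull_mem.
Qed.

Lemma hull_image n (A : 'M[R]_(m, n)) w S :
  [set x *m A | x in hull w S] = hull (fun k => w k *m A) S.
Proof.
apply/seteqP; split=> [_ [_ [a [a0 a1 ->]] <-]|_ [a [a0 a1 ->]]].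
  exists a; split=> //; rewrite mulmx_suml; apply: eq_bigr => k _.
  by rewrite -scalemxAl.
exists (\sum_(k in S) a k *: w k); first by exists a.
by rewrite mulmx_suml; apply: eq_bigr => k _; rewrite -scalemxAl.
Qed.

Lemma hull_compact w S : compact (hull w S).
Proof.
pose A := [set a : 'rV[R]_#|K| | (forall i, a ord0 i \in `[0, 1]) /\
   \sum_(k in S) a 0 (enum_rank k) = 1].
pose W : 'M[R]_(#|K|, m) := \matrix_i ((enum_val i \in S)%:R *: w (enum_val i)).
have W_eq a : a *m W = \sum_(k in S) a 0 (enum_rank k) *: w k.
  rewrite mulmx_sum_row (reindex (@enum_rank K)) /=; last first.
    by exists enum_val => k _; [exact: enum_rankK|exact: enum_valK].
  rewrite [RHS]big_mkcond; apply: eq_bigr => k _; rewrite rowK enum_rankK.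
  by case: (k \in S); rewrite ?scale1r // scale0r scaler0.
have -> : hull w S = (fun a => a *m W) @` A.
  apply/seteqP; split=> [_ [a [a0 a1 ->]]|_ [a [a01 a1] <-]].
    have ale k : k \in S -> a k <= 1.
      by move=> kS; rewrite -a1 (bigD1 k) //= lerDl sumr_ge0.
    exists (\row_i if enum_val i \in S then a (enum_val i) else 0).
      split=> [i|]; first by rewrite mxE in_itv /=; case: ifP => [/ale ->|_]; rewrite ?a0 ?lexx ?ler01.
      by rewrite -a1; apply: eq_bigr => k kS; rewrite mxE enum_rankK kS.
    by rewrite W_eq; apply: eq_bigr => k kS; rewrite mxE enum_rankK kS.
  exists (fun k => a 0 (enum_rank k)); split=> //.
  by move=> k; have := a01 (enum_rank k); rewrite in_itv /= => /andP[].
apply: continuous_compact.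
  by apply: continuous_subspaceT => a; exact: mulmx_continuous.
have cA : compact [set a : 'rV[R]_#|K| | forall i, a ord0 i \in `[0, 1]].
  apply: (@rV_compact _ _ (fun=> `[0 : R, 1]%classic)) => i; exact: segment_compact.
have -> : A = [set a : 'rV[R]_#|K| | forall i, a ord0 i \in `[0, 1]] `&`
    (fun a => dot a (\col_i (enum_val i \in S)%:R)) @^-1` [set 1].
  apply/seteqP; split=> a [h1 h2]; split=> //.
    rewrite /= -[RHS]h2 mxE (reindex (@enum_rank K)) /=; last first.
      by exists enum_val => k _; [exact: enum_rankK|exact: enum_valK].
    rewrite [RHS]big_mkcond; apply: eq_bigr => k _; rewrite mxE enum_rankK.
    by case: (k \in S); rewrite ?mulr1 ?mulr0.
  rewrite -[RHS]h2 mxE (reindex (@enum_rank K)) /=; last first.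
    by exists enum_val => k _; [exact: enum_rankK|exact: enum_valK].
  rewrite [LHS]big_mkcond; apply: eq_bigr => k _; rewrite mxE enum_rankK.
  by case: (k \in S); rewrite ?mulr1 ?mulr0.
apply: compact_closedI => //.
apply: closed_comp => [a _|]; last exact: closed_eq.
exact: functional_continuous.
Qed.

End AffineHull.

Lemma hull_imset (R : realType) (m : nat) (K T : finType) (w : K -> 'rV[R]_m)
    (g : T -> K) (s : {set T}) : injective g ->
  hull w (g @: s)%SET = hull (w \o g) s.
Proof.
move=> gI; rewrite -!conv_fin; congr conv; apply/seteqP; split=> _ [k + <-].
  by move=> /imsetP[t ts ->]; exists t.
by move=> ks; exists (g k) => //=; apply: imset_f.
Qed.

Section Bottoms.
Context {R : realType} {m : nat} (C : set 'rV[R]_m).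
Hypothesis coneC : is_cone C.
Local Notation A := ((C `&` Zlat) `\ 0).

Lemma is_cone_add y z : C y -> C z -> C (y + z).
Proof.
have [[k [g [_ ->]]] _] := coneC; move=> [a [a0 ->]] [b [b0 ->]].
exists (fun i => a i + b i); split=> [i|]; first by rewrite addr_ge0.
by rewrite -big_split; apply: eq_bigr => i _; rewrite scalerDl.
Qed.

Lemma is_cone_scale t y : 0 <= t -> C y -> C (t *: y).
Proof.
have [[k [g [_ ->]]] _] := coneC; move=> t0 [a [a0 ->]].
exists (fun i => t * a i); split=> [i|]; first by rewrite mulr_ge0.
by rewrite scaler_sumr; apply: eq_bigr => i _; rewrite scalerA.
Qed.

(** Positive integral multiples of lattice points stay in the cone, so the functional is
    nonnegative; the value 0 on the facet would put a whole ray of multiples in it, against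
    compactness. So it can be scaled to height 1. *)
Lemma bottom_facet_functional F : bottom_facets C F -> F !=set0 ->
  exists2 V : 'cV[R]_m, forall x, A x -> 1 <= dot x V &
    F = [set x | conv A x /\ dot x V = 1].
Proof.
move=> [[[u [b [hu FE]]] _ _] Fc] F0.
have [z [zA zb]] : [set x | A x /\ dot x u = b] !=set0.
  apply: conv_nonempty; rewrite -conv_face -?FE // => x xA.
  by apply: hu; apply: sub_conv.
have mulA y n : A y -> A (n.+1%:R *: y).
  move=> [[yC yZ] y0]; split; last by move/eqP; rewrite scaler_eq0 pnatr_eq0 /= => /eqP.
  split; last by apply: ZlatZ => //; apply: rpred_nat.
  exact: is_cone_scale.
have u_ge0 y : A y -> 0 <= dot y u.
  move=> yA; rewrite leNgt; apply/negP => lt.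
  have hb n : b <= n.+1%:R * dot y u.
    by rewrite -dotZl; apply: hu; apply: sub_conv; apply: mulA.
  have := hb (Num.bound (b / dot y u)); rewrite leNgt => /negP; apply.
  rewrite -ltr_ndivrMr //; apply: lt_trans (unstable.ltr_bound _) _.
  by rewrite ltr_nat.
have b_gt0 : 0 < b.
  rewrite lt_neqAle -{2}zb u_ge0 // andbT; apply/eqP => b0.
  have : bounded_set F by apply: compact_bounded.
  move=> [M [_ hM]]; have z0 : 0 < `|z| by rewrite normr_gt0; apply/eqP; case: zA.
  have hz n : n.+1%:R * `|z| <= `|M| + 1.
    rewrite -[n.+1%:R]normr_nat -normrZ; apply: hM.
      by rewrite (le_lt_trans (ler_norm M)) // ltrDl.
    rewrite FE; split; first by apply: sub_conv; apply: mulA.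
    by rewrite dotZl zb -b0 mulr0.
  have := hz (Num.bound ((`|M| + 1) / `|z|)); rewrite leNgt => /negP; apply.
  rewrite -ltr_pdivrMr //; apply: lt_trans (unstable.ltr_bound _) _.
  by rewrite ltr_nat.
have bE (x : 'rV[R]_m) : dot x (b^-1 *: u) = dot x u / b by rewrite dotZr mulrC.
exists (b^-1 *: u) => [x xA|].
  by rewrite bE ler_pdivlMr // mul1r; apply: hu; apply: sub_conv.
rewrite FE; apply/seteqP; split=> x [xQ].
  by move=> xb; rewrite /= bE xb divff // gt_eqF.
rewrite bE => e; split=> //; rewrite -[LHS](divfK (x := b)) ?e ?mul1r // gt_eqF //.
Qed.

End Bottoms.

Section Standard.
Context {R : realType} {T : finType}.

Lemma std_simplexE (s : {set T}) : @std_simplex R T s =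
  hull (fun t => delta_mx 0 (enum_rank t)) s.
Proof. by rewrite -conv_fin. Qed.

Lemma delta_coord (s : {set T}) (a : T -> R) t :
  (\sum_(t in s) a t *: delta_mx 0 (enum_rank t) : 'rV[R]_#|T|) 0 (enum_rank t) =
  if t \in s then a t else 0.
Proof.
rewrite summxE (eq_bigr (fun t' => (t' == t)%:R *: a t)); last first.
  move=> t' _; rewrite !mxE eqxx /= (inj_eq enum_rank_inj) eq_sym mulrC.
  by case: eqP => [->|_]; rewrite ?scale0r ?mul0r.
case: ifP => ts; first exact: sum_indicator.
rewrite big1 // => t' t's; have [tt|] := eqVneq t' t; last by rewrite scale0r.
by rewrite -tt t's in ts.
Qed.

End Standard.

Section Cone.
Context {R : realType} {m : nat} {K : finType}.

(** The counterpart of [fano_fan] for a subdivided cone. The other generators are now above height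
    1, because the bottom is seen from the origin. *)
Definition cone_fan (w : K -> 'rV[R]_m) (JJ : {set K} -> Prop) (C : set 'rV[R]_m) :=
  [/\ forall J, JJ J -> unibasis w J,
      forall J, JJ J -> exists2 u : 'cV[R]_m, forall k, k \in J -> dot (w k) u = 1 &
        forall k, k \notin J -> 1 < dot (w k) u,
      forall k, exists2 J, JJ J & k \in J,
      forall y, C y <-> cone_hull w [set: K]%SET y &
      forall y, C y -> exists2 J, JJ J & cone_hull w J y].

Variables (w : K -> 'rV[R]_m) (JJ : {set K} -> Prop) (C : set 'rV[R]_m).
Hypotheses (m_gt0 : (0 < m)%N) (fan : cone_fan w JJ C).
Local Notation A := ((C `&` Zlat) `\ 0).
Local Notation Q := (conv A).

Lemma cone_uni J : JJ J -> unibasis w J.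
Proof. by case: fan => + _ _ _ _; apply. Qed.

Lemma cone_functional J : JJ J -> exists2 u : 'cV[R]_m,
  forall k, k \in J -> dot (w k) u = 1 & forall k, k \notin J -> 1 < dot (w k) u.
Proof. by case: fan => _ + _ _ _; apply. Qed.

Lemma cone_mem k : exists2 J, JJ J & k \in J.
Proof. by case: fan => _ _ + _ _; apply. Qed.

Lemma cone_fanE y : C y <-> cone_hull w [set: K]%SET y.
Proof. by case: fan => _ _ _ + _; apply. Qed.

Lemma cone_cover y : C y -> exists2 J, JJ J & cone_hull w J y.
Proof. by case: fan => _ _ _ _; apply. Qed.

Lemma cone_sub (S : {set K}) y : cone_hull w S y -> C y.
Proof. by move=> h; apply/cone_fanE; apply: cone_hull_subset h; apply: finset.subsetT. Qed.

Lemma cone_gen k : C (w k).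
Proof. by apply/cone_fanE; apply: cone_hull_mem; rewrite inE. Qed.

Lemma cone_ne : exists J, JJ J.
Proof. by have [J] := cone_cover (cone_sub (cone_hull0 w finset.set0)); exists J. Qed.

Lemma cone_Zlat k : Zlat (w k).
Proof. by have [J /cone_uni[wZ _] kJ] := cone_mem k; apply: wZ. Qed.

Lemma cone_card J : JJ J -> #|J| = m.
Proof. by move=> /cone_uni[_ [e de _]]; apply: dual_card de. Qed.

Lemma cone_functional_ge1 (J : {set K}) (u : 'cV[R]_m) :
  (forall k, k \in J -> dot (w k) u = 1) -> (forall k, k \notin J -> 1 < dot (w k) u) ->
  forall k, 1 <= dot (w k) u.
Proof. by move=> u1 u2 k; have [/u1 ->|/u2/ltW] := boolP (k \in J). Qed.

Lemma cone_inj : injective w.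
Proof.
move=> k l wkl; have [J JJJ kJ] := cone_mem k.
have [lJ|lJ] := boolP (l \in J); last first.
  have [u uJ u_out] := cone_functional JJJ.
  by have := u_out l lJ; rewrite -wkl uJ // ltxx.
have [_ [e de _]] := cone_uni JJJ.
have := de.2 k l kJ lJ; rewrite wkl de.2 // eqxx.
by case: eqP => // _ /eqP; rewrite oner_eq0.
Qed.

Lemma cone_neq0 k : w k != 0.
Proof.
have [J JJJ kJ] := cone_mem k; have [u uJ _] := cone_functional JJJ.
by apply/eqP => wk; have := uJ k kJ; rewrite wk dot0l => /eqP; rewrite eq_sym oner_eq0.
Qed.

Lemma cone_tight (V : 'cV[R]_m) (S : {set K}) : (forall k, 1 <= dot (w k) V) ->
  (forall k, k \in S -> dot (w k) V = 1) -> exists2 J, JJ J & S \subset J.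
Proof.
move=> V1 VS; apply: (@tight_subset _ _ _ w JJ 1 V S) => //.
- move=> J /cone_functional[u uJ u_out]; exists u => // k /u_out.
  by rewrite mul1r subr_gt0.
- by move=> k; rewrite mul1r subr_ge0.
apply: cone_cover; apply: (@cone_sub S); apply: cone_hull_sum => k; exact: cone_hull_mem.
Qed.

Lemma cone_is_cone : is_cone C.
Proof.
split.
  exists #|K|, (fun i => w (enum_val i)); split=> [i|]; first exact: cone_Zlat.
  apply/seteqP; split=> y; rewrite /= cone_fanE.
    move=> [a a0 ->]; exists (fun i => a (enum_val i)); split=> //.
    rewrite (reindex (@enum_val K K)) /=; last first.
      by exists enum_rank => k _; [exact: enum_valK|exact: enum_rankK].
    by apply: eq_bigl => i; rewrite inE.
  move=> [a [a0 ->]]; exists (fun k => a (enum_rank k)) => //.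
  rewrite [RHS](reindex (@enum_val K K)) /=; last first.
    by exists enum_rank => k _; [exact: enum_valK|exact: enum_rankK].
  by apply: eq_big => [i|i _]; rewrite ?inE // enum_valK.
move=> y hy; have [J JJJ] := cone_ne; have [u u1 u2] := cone_functional JJJ.
have uw := cone_functional_ge1 u1 u2.
have uC z : C z -> 0 <= dot z u.
  move=> /cone_fanE[a a0 ->]; rewrite dot_suml sumr_ge0 // => k _.
  by rewrite dotZl mulr_ge0 // (le_trans ler01).
have uy : dot y u = 0.
  have h1 := uC _ (hy 1); have h2 := uC _ (hy (-1)).
  by rewrite !dotZl mul1r mulN1r oppr_ge0 in h1 h2; apply/eqP; rewrite eq_le h1 h2.
have := hy 1; rewrite scale1r => /cone_fanE[a a0 yE].
have /eqP := uy; rewrite yE dot_suml psumr_eq0; last first.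
  by move=> k _; rewrite dotZl mulr_ge0 // (le_trans ler01).
move/allP => h; rewrite big1 // => k kT.
have := h k; rewrite mem_index_enum kT dotZl => /(_ isT); rewrite mulf_eq0.
by case/orP => /eqP; [move=> ->; rewrite scale0r|move=> e; have := uw k; rewrite e ler10].
Qed.

Lemma cone_lattice J y : JJ J -> cone_hull w J y -> Zlat y ->
  exists c : K -> nat, y = \sum_(k in J) (c k)%:R *: w k.
Proof.
move=> JJJ yC yZ; have [_ [e de eZ]] := cone_uni JJJ.
have h k : exists c : nat, k \in J -> dot y (e k) = c%:R.
  have [kJ|kJ] := boolP (k \in J); last by exists 0%N.
  have [c hc] := int_nat (eZ y yZ k kJ) ((cone_hull_dual de y).1 yC k kJ).
  by exists c.
have [c hc] := choice h; exists c.
by rewrite {1}[y](de.1); apply: eq_bigr => k kJ; rewrite hc.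
Qed.

Lemma nat_comb_eq0 (J : {set K}) (c : K -> nat) :
  \sum_(k in J) (c k)%:R *: w k != 0 -> exists2 k, k \in J & (0 < c k)%N.
Proof.
move=> ne; apply: contrapT => h; case/negP: ne; rewrite big1 // => k kJ.
have [->|ck] := posnP (c k); first by rewrite scale0r.
by case: h; exists k.
Qed.

Lemma nat_comb_split (J : {set K}) (c : K -> nat) k : k \in J -> (0 < c k)%N ->
  exists2 c' : K -> nat, \sum_(k in J) (c k)%:R *: w k =
    w k + \sum_(k in J) (c' k)%:R *: w k & forall k, (c' k <= c k)%N.
Proof.
move=> kJ ck; exists (fun l => if l == k then (c k).-1 else c l); last first.
  by move=> l; case: eqP => // ->; rewrite leq_pred.
rewrite (bigD1 k) //= [X in _ = _ + X](bigD1 k) //= eqxx addrA; congr (_ + _).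
  by rewrite -{1}(prednK ck) -[X in X%:R *: _ = _]addn1 natrD addrC scalerDl scale1r.
by apply: eq_bigr => l /andP[_ /negPf ->].
Qed.

Lemma nat_comb_Zlat (J : {set K}) (c : K -> nat) : Zlat (\sum_(k in J) (c k)%:R *: w k).
Proof. by apply: Zlat_sum => k _; apply: ZlatZ; [exact: rpred_nat|exact: cone_Zlat]. Qed.

Lemma nat_comb_cone (J : {set K}) (c : K -> nat) : cone_hull w J (\sum_(k in J) (c k)%:R *: w k).
Proof. by exists (fun k => (c k)%:R). Qed.

Lemma cone_lattice_gen y : A y -> exists k (c : K -> nat) J, [/\ JJ J, k \in J &
  y = w k + \sum_(k in J) (c k)%:R *: w k].
Proof.
move=> [[yC yZ] y0]; have [J JJJ yJ] := cone_cover yC.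
have [c yE] := cone_lattice JJJ yJ yZ.
have [|k kJ ck] := @nat_comb_eq0 J c; first by rewrite -yE; apply/eqP.
by have [c' E _] := nat_comb_split kJ ck; exists k, c', J; rewrite yE.
Qed.

Lemma cone_height_ge1 (V : 'cV[R]_m) : (forall k, 1 <= dot (w k) V) ->
  forall y, A y -> 1 <= dot y V.
Proof.
move=> V1 y /cone_lattice_gen[k [c [J [_ _ ->]]]].
rewrite dotDl; apply: le_trans (V1 k) _; rewrite lerDl dot_suml sumr_ge0 // => l _.
by rewrite dotZl mulr_ge0 // (le_trans ler01).
Qed.

(** Split off one generator: it already has height at least 1, and a nonzero remainder would add at
    least 1. *)
Lemma cone_height1 (V : 'cV[R]_m) : (forall k, 1 <= dot (w k) V) ->
  forall y, A y -> dot y V = 1 -> exists2 k, y = w k & dot (w k) V = 1.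
Proof.
move=> V1 y /cone_lattice_gen[k [c [J [_ _ yE]]]] Vy; exists k; last first.
  apply/eqP; rewrite eq_le V1 andbT -Vy yE dotDl lerDl dot_suml sumr_ge0 // => l _.
  by rewrite dotZl mulr_ge0 // (le_trans ler01).
have [z0|z0] := eqVneq (\sum_(k in J) (c k)%:R *: w k) 0; first by rewrite yE z0 addr0.
have : 1 <= dot (\sum_(k in J) (c k)%:R *: w k) V.
  apply: cone_height_ge1 => //; split; last exact/eqP.
  split; [exact: cone_sub (nat_comb_cone J c)|exact: nat_comb_Zlat].
move=> h; have := V1 k; move: Vy; rewrite yE dotDl => e h'.
have : 1 + 1 <= 1 :> R by rewrite -[leRHS]e lerD.
by rewrite leNgt ltrDl ltr01.
Qed.

Lemma gen_A k : A (w k).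
Proof. by split; [split; [exact: cone_gen|exact: cone_Zlat]|exact/eqP/cone_neq0]. Qed.

Lemma cone_faceE (J : {set K}) (u : 'cV[R]_m) : (forall k, k \in J -> dot (w k) u = 1) ->
  (forall k, k \notin J -> 1 < dot (w k) u) ->
  [set x | Q x /\ dot x u = 1] = hull w J.
Proof.
move=> u1 u2; have uw := cone_functional_ge1 u1 u2.
rewrite conv_face; last exact: cone_height_ge1.
rewrite -conv_fin; congr conv; apply/seteqP; split=> [y [yA yu]|_ [k kJ <-]].
  have [k -> ku] := cone_height1 uw yA yu; exists k => //=.
  by apply: contraT => /u2; rewrite ku ltxx.
by split; [exact: gen_A|exact: u1].
Qed.

Lemma cone_facet J : JJ J -> is_facet Q (hull w J).
Proof.
move=> JJJ; have [u u1 u2] := cone_functional JJJ.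
have uw := cone_functional_ge1 u1 u2.
have [_ [e de _]] := cone_uni JJJ.
rewrite -(cone_faceE u1 u2); apply: (facet_criterion de).
- by apply: conv_ge; apply: cone_height_ge1.
- exact: oner_neq0.
- by move=> k kJ; split; [apply: sub_conv; exact: gen_A|exact: u1].
have [k kJ] : exists k, k \in J by apply/card_gt0P; rewrite (cone_card JJJ).
(* A point of height 2 shows that the face is proper. *)
exists (2%:R *: w k); last by rewrite dotZl u1 // mulr1 -[1]/(1%:R) eqr_nat.
apply: sub_conv; have [[kC kZ] k0] := gen_A k; split.
  split; last by apply: ZlatZ => //; apply: rpred_nat.
  by apply/cone_fanE; apply: cone_hullZ => //; apply/cone_fanE.
by move/eqP; rewrite scaler_eq0 pnatr_eq0 /= => /eqP.
Qed.

(** The generators of height 1 on a compact facet lie in a common [J] by [cone_tight], and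
    maximality of facets gives equality. An empty facet is covered by any [J]. *)
Lemma cone_bottom_facets F :
  bottom_facets C F <-> exists2 J, JJ J & F = hull w J.
Proof.
split=> [[[Ff FQ Fmax] Fc]|[J JJJ ->]]; last first.
  by split; [exact: cone_facet|exact: hull_compact].
suff [J JJJ FJ] : exists2 J, JJ J & F `<=` hull w J.
  have [Jf JQ _] := cone_facet JJJ.
  by exists J => //; have [->//|] := Fmax _ Jf FJ.
have [F0|/set0P/negP/negPn/eqP F0] := pselect (F !=set0); last first.
  by have [J JJJ] := cone_ne; exists J; rewrite // F0.
have [V V1 FE] := bottom_facet_functional cone_is_cone (conj (And3 Ff FQ Fmax) Fc) F0.
have [J JJJ SJ] := @cone_tight V [set k | dot (w k) V == 1]%SET (fun k => V1 _ (gen_A k))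
  (fun k => ltac:(by rewrite inE => /eqP)).
exists J => //; rewrite FE conv_face // -conv_fin; apply: conv_mono => y [yA yV].
have [k -> ku] := cone_height1 (fun k => V1 _ (gen_A k)) yA yV; exists k => //=.
by apply: (fintype.subsetP SJ); rewrite inE ku.
Qed.

Lemma cone_bottom_complex G : bottom_complex C G <->
  exists J (S : {set K}), [/\ JJ J, S \subset J, S != finset.set0 & G = hull w S].
Proof.
split=> [[G0 [F /cone_bottom_facets[J JJJ ->] Gf]]|[J [S [JJJ SJ S0 ->]]]].
  have [_ [e de _]] := cone_uni JJJ.
  have [J0] : exists k, k \in J by apply/card_gt0P; rewrite (cone_card JJJ).
  move=> kJ; have Jne : J != finset.set0 by apply/set0Pn; exists J0.
  have [GE|[S SJ GE]] := (face_simplex de G).1 Gf; first by exists J, J; rewrite GE.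
  exists J, S; split=> //; apply/negP => /eqP S0.
  by case: G0 => x; rewrite GE S0 hull_set0.
split.
  by have /set0Pn[k kS] := S0; exists (w k); apply: hull_mem.
exists (hull w J); first by apply/cone_bottom_facets; exists J.
have [_ [e de _]] := cone_uni JJJ.
by apply/(face_simplex de); right; exists S.
Qed.

Lemma cone_bottom y : bottom C y <-> exists2 J, JJ J & hull w J y.
Proof.
split=> [[F /cone_bottom_facets[J JJJ ->] yF]|[J JJJ yJ]]; first by exists J.
by exists (hull w J) => //; apply/cone_bottom_facets; exists J.
Qed.

Lemma cone_facet_Hilb F : bottom_facets C F -> Hilb (pos_hull F) `<=` F.
Proof.
move=> /cone_bottom_facets[J JJJ ->] x [xC xZ x0 xind].
have J0 : J != finset.set0 by rewrite -card_gt0 (cone_card JJJ).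
move/(pos_hull_hull w x J0): xC => xJ.
have [c xE] := cone_lattice JJJ xJ xZ.
have [|k kJ ck] := @nat_comb_eq0 J c; first by rewrite -xE; apply/eqP.
have [c' E _] := nat_comb_split kJ ck; rewrite -xE in E.
have [||||/eqP|z0] := xind _ _ _ _ _ _ E.
- by apply/(pos_hull_hull w _ J0); apply: cone_hull_mem.
- exact: cone_Zlat.
- by apply/(pos_hull_hull w _ J0); apply: nat_comb_cone.
- exact: nat_comb_Zlat.
- by rewrite (negPf (cone_neq0 k)).
by rewrite E z0 addr0; apply: hull_mem.
Qed.

(** A generator has height 1 for the functional of a [J] that contains it, whereas a sum of two
    nonzero lattice points has height at least 2. *)
Lemma cone_Hilb : Hilb C = range w.
Proof.
apply/seteqP; split=> [x [xC xZ x0 xind]|_ [k _ <-]].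
  have [k [c [J [JJJ kJ E]]]] := cone_lattice_gen (conj (conj xC xZ) x0 : A x).
  have [||||/eqP|z0] := xind _ _ _ _ _ _ E.
  - exact: cone_gen.
  - exact: cone_Zlat.
  - exact: cone_sub (nat_comb_cone J c).
  - exact: nat_comb_Zlat.
  - by rewrite (negPf (cone_neq0 k)).
  by exists k; rewrite // E z0 addr0.
split; [exact: cone_gen|exact: cone_Zlat|exact/eqP/cone_neq0|].
move=> y z yC yZ zC zZ E; have [J JJJ kJ] := cone_mem k.
have [u u1 u2] := cone_functional JJJ; have uw := cone_functional_ge1 u1 u2.
have [->|y0] := eqVneq y 0; first by left.
have [->|z0] := eqVneq z 0; first by right.
have hy : 1 <= dot y u by apply: cone_height_ge1 => //; split=> //; apply/eqP.
have hz : 1 <= dot z u by apply: cone_height_ge1 => //; split=> //; apply/eqP.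
have := u1 k kJ; rewrite E dotDl => e.
have : 1 + 1 <= 1 :> R by rewrite -[leRHS]e lerD.
by rewrite leNgt ltrDl ltr01.
Qed.

(** The isomorphism of complexes is one linear map [M] on the whole space, which sends unit vectors
    to generators. Only its injectivity on the union of the simplices needs an argument. *)
Lemma cone_reduced_realization (T : finType) (g : T -> K) (Delta : {set {set T}}) :
  bijective g ->
  (forall s, s \in Delta <-> exists2 J, JJ J & (g @: s)%SET \subset J) ->
  reduced_realization Delta C.
Proof.
move=> gbij hD; split; [exact: cone_is_cone| |exact: cone_facet_Hilb].
have gI := bij_inj gbij.
pose dl (t : T) : 'rV[R]_#|T| := delta_mx 0 (enum_rank t).
have stdE s : @std_simplex R T s = hull dl s := std_simplexE s.
pose M : 'M[R]_(#|T|, m) := \matrix_i w (g (enum_val i)).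
have dlM t : dl t *m M = w (g t) by rewrite -rowE rowK enum_rankK.
have imM (s : {set T}) : [set x *m M | x in hull dl s] = hull w (g @: s)%SET.
  by rewrite hull_image hull_imset //; congr hull; apply/funext => t; exact: dlM.
have coord (s : {set T}) (a : T -> R) t :
    (\sum_(t in s) a t *: dl t) 0 (enum_rank t) = if t \in s then a t else 0.
  exact: delta_coord.
have coordE (x : 'rV[R]_#|T|) : x = \sum_t x 0 (enum_rank t) *: dl t.
  rewrite {1}[x]rowE_delta (reindex (@enum_rank T)) //.
  by exists enum_val => t _; [exact: enum_rankK|exact: enum_valK].
have supE x : support (realization R Delta) x <->
    exists s, [/\ s \in Delta, s != finset.set0 & hull dl s x].
  split=> [[_ [s /andP[sD s0] <-]]|[s [sD s0 xs]]].
    by rewrite stdE => xs; exists s.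
  by exists (@std_simplex R T s); [exists s; rewrite //= sD|rewrite stdE].
have im_supp (s : {set T}) x : s \in Delta -> s != finset.set0 -> hull dl s x ->
    support (bottom_complex C) (x *m M).
  move=> sD s0 xs; exists (hull w (g @: s)%SET).
    apply/cone_bottom_complex; have [J JJJ sJ] := (hD s).1 sD.
    exists J, (g @: s)%SET; split=> //; have /set0Pn[t ts] := s0.
    by apply/set0Pn; exists (g t); apply: imset_f.
  by rewrite -imM; exists x.
have from_cell G : bottom_complex C G ->
    exists s, [/\ s \in Delta, s != finset.set0 & G = hull w (g @: s)%SET].
  move=> /cone_bottom_complex[J [S [JJJ SJ S0 ->]]].
  have gS : (g @: (g @^-1: S))%SET = S.
    apply/setP => k; apply/imsetP/idP => [[t + ->]|kS]; first by rewrite inE.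
    by have [h hg gh] := gbij; exists (h k); rewrite ?inE gh.
  exists (g @^-1: S)%SET; rewrite gS; split=> //.
    by apply/hD; exists J; rewrite // gS.
  by apply: contraNneq S0 => e; rewrite -gS e imset0.
exists (fun x => x *m M); split.
- split.
  + by move=> x /supE[s [sD s0 xs]]; apply: im_supp xs.
  + move=> x x' /[!inE] /supE[s [sD s0 [a [a0 a1 xE]]]] /supE[s' [sD' s0' [a' [a0' a1' xE']]]] E.
    have [J JJJ sJ] := (hD s).1 sD.
    have [u u1 u2] := cone_functional JJJ; have uw := cone_functional_ge1 u1 u2.
    have [_ [e de _]] := cone_uni JJJ.
    have gJ t : t \in s -> g t \in J.
      by move=> ts; apply: (fintype.subsetP sJ); apply: imset_f.
    have xM (r : {set T}) (b : T -> R) (f : 'cV[R]_m) :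
        dot ((\sum_(t in r) b t *: dl t) *m M) f = \sum_(t in r) b t * dot (w (g t)) f.
      rewrite mulmx_suml dot_suml; apply: eq_bigr => t _.
      by rewrite -scalemxAl dlM dotZl.
    (* Equal points have equal height under [u], which is at least 1 on all generators and larger
       outside [J]; so no weight lies outside [J]. *)
    have z' t : t \in s' -> g t \notin J -> a' t = 0.
      have := congr1 (fun y => dot y u) E; rewrite xE xE' !xM.
      rewrite (eq_bigr a); last by move=> t' /gJ t'J; rewrite u1 // mulr1.
      move=> e1; have : \sum_(t in s') a' t * (dot (w (g t)) u - 1) = 0.
        under eq_bigr do rewrite mulrBr mulr1.
        by rewrite sumrB -e1 a1 a1' subrr.
      move/eqP; rewrite psumr_eq0; last by move=> t' _; rewrite mulr_ge0 // subr_ge0.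
      move=> /allP h ts gtJ; have := h t; rewrite mem_index_enum ts => /(_ isT).
      by rewrite mulf_eq0 => /orP[/eqP//|]; rewrite subr_eq0 gt_eqF // u2.
    have ext (r : {set T}) (b : T -> R) : (forall t, t \in r -> g t \notin J -> b t = 0) ->
        forall t, g t \in J -> dot ((\sum_(t in r) b t *: dl t) *m M) (e (g t)) =
        (\sum_(t in r) b t *: dl t) 0 (enum_rank t).
      move=> hb t tJ; rewrite xM coord.
      rewrite (eq_bigr (fun t' => (t' == t)%:R *: b t')); last first.
        move=> t' t'r; have [t'J|t'J] := boolP (g t' \in J).
          by rewrite de.2 // (inj_eq gI) mulrC.
        rewrite hb // mul0r; case: eqP => [tt|_]; last by rewrite scale0r.
        by rewrite tt tJ in t'J.
      case: ifP => tr; first exact: sum_indicator.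
      rewrite big1 // => t' t'r; case: eqP => [tt|_]; last by rewrite scale0r.
      by rewrite -tt t'r in tr.
    have hx : forall t, t \in s -> g t \notin J -> a t = 0.
      by move=> t /gJ ->.
    rewrite [x]coordE [x']coordE; apply: eq_bigr => t _; congr (_ *: _).
    have [tJ|tJ] := boolP (g t \in J).
      by have := congr1 (fun y => dot y (e (g t))) E; rewrite xE xE' !ext.
    rewrite xE xE' !coord; case: ifP => [/gJ|_]; first by rewrite (negPf tJ).
    by case: ifP => // ts'; rewrite z'.
  + move=> y [G /from_cell[s [sD s0 ->]]]; rewrite -imM => -[x xs <-].
    by exists x => //; apply/supE; exists s.
- apply/seteqP; split=> [_ [_ [s /andP[sD s0] <-] <-]|G /from_cell[s [sD s0 ->]]].
    rewrite stdE imM; apply/cone_bottom_complex; have [J JJJ sJ] := (hD s).1 sD.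
    exists J, (g @: s)%SET; split=> //; have /set0Pn[t ts] := s0.
    by apply/set0Pn; exists (g t); apply: imset_f.
  by exists (@std_simplex R T s); [exists s; rewrite //= sD|rewrite stdE imM].
- move=> _ [s /andP[sD s0] <-]; rewrite stdE; exists M, 0; split=> [x _|].
    by rewrite addr0.
  have [J JJJ sJ] := (hD s).1 sD; have [_ [e de eZ]] := cone_uni JJJ.
  have gs0 : (g @: s)%SET != finset.set0.
    by have /set0Pn[t ts] := s0; apply/set0Pn; exists (g t); apply: imset_f.
  have gsum (a : K -> R) (V : lmodType R) (F : K -> V) :
      \sum_(k in (g @: s)%SET) a k *: F k = \sum_(t in s) a (g t) *: F (g t).
    by rewrite big_imset //= => t t' _ _; apply: gI.
  rewrite imM !aff_hull //; apply/seteqP; split=> y.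
    move=> [_ [[a a1 ->] xZ] <-]; rewrite addr0.
    have aZ t : t \in s -> a t \is a Num.int.
      by move=> ts; move/ZlatP/(_ (enum_rank t)): xZ; rewrite coord ts.
    have [h hg gh] := gbij.
    have yE : (\sum_(t in s) a t *: dl t) *m M = \sum_(t in s) a t *: w (g t).
      by rewrite mulmx_suml; apply: eq_bigr => t _; rewrite -scalemxAl dlM.
    split; last first.
      rewrite yE; apply: Zlat_sum => t ts; apply: ZlatZ; [exact: aZ|exact: cone_Zlat].
    exists (a \o h).
      rewrite -a1 big_imset /=; last by move=> t t' _ _; apply: gI.
      by apply: eq_bigr => t _; rewrite hg.
    by rewrite yE gsum; apply: eq_bigr => t _; rewrite /= hg.
  move=> [[a a1 yE] yZ]; exists (\sum_(t in s) a (g t) *: dl t).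
    split.
      exists (a \o g) => //; rewrite -a1 [RHS]big_imset //=.
      by move=> t t' _ _; apply: gI.
    apply: Zlat_sum => t ts; apply: ZlatZ; last exact: Zlat_delta.
    have gtJ : g t \in J by apply: (fintype.subsetP sJ); apply: imset_f.
    by have := eZ y yZ _ gtJ; rewrite yE (dual_coeff de) // imset_f.
  rewrite addr0 yE gsum mulmx_suml; apply: eq_bigr => t _.
  by rewrite -scalemxAl dlM.
Qed.

End Cone.

(** * The cones of strictly convex height functions *)

Lemma some_inj (T : Type) : injective (@Some T).
Proof. by move=> x y []. Qed.

Section Boundary.
Context {R : realType} {d : nat} {K T : finType}.
Variables (w : K -> 'rV[R]_d) (JJ : {set K} -> Prop) (Sigma : {set {set T}}).
Hypotheses (d_gt0 : (0 < d)%N) (fan : fano_fan w JJ).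

Let face_of (S : {set K}) := exists2 J, JJ J & S \subset J.

Let hull_le (S S' : {set K}) : face_of S' -> hull w S `<=` hull w S' -> S \subset S'.
Proof. by move=> [J JJJ SJ]; exact: (fano_hull_le fan JJJ SJ). Qed.

Let face1 k : face_of [set k]%SET.
Proof. by have [J JJJ kJ] := fano_mem fan k; exists J; rewrite // finset.sub1set. Qed.

Let face0 : face_of finset.set0.
Proof. by have [J JJJ _] := fano_cover fan 0; exists J; rewrite // finset.sub0set. Qed.

Lemma boundary_equiv_vertices : simplicial_complex Sigma ->
  boundary_equiv Sigma (conv (range w)) -> exists g : T -> K, bijective g /\
  forall s, s \in Sigma <-> exists2 J, JJ J & (g @: s)%SET \subset J.
Proof.
move=> [S0 Sdown S1] [f [[fP fI fS] fle]].
have hS s : exists S : {set K}, s \in Sigma -> face_of S /\ f s = hull w S.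
  have [sS|sS] := boolP (s \in Sigma); last by exists finset.set0.
  have [/(fano_proper_face d_gt0 fan) h/h[J [S [JJJ SJ E]]]] := fP s sS.
  by exists S => _; split=> //; exists J.
have [V hV] := choice hS.
have onto S : face_of S -> exists2 s, s \in Sigma & V s = S.
  move=> [J JJJ SJ]; have [//|s sS fs] := fS (hull w S); first exact: (fano_face d_gt0 fan JJJ).
  exists s => //; have [Vf fV] := hV s sS.
  apply/eqP; rewrite finset.eqEsubset; apply/andP; split; apply: hull_le.
  - by exists J.
  - by rewrite -fV fs.
  - by [].
  - by rewrite -fV fs.
have le s t : s \in Sigma -> t \in Sigma -> (s \subset t) = (V s \subset V t).
  move=> sS tS; have [Vs fs] := hV s sS; have [Vt ft] := hV t tS.
  apply/idP/idP => [/(fle s t sS tS).1|h].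
    by rewrite fs ft => /(hull_le Vt).
  by apply/(fle s t sS tS); rewrite fs ft; apply: hull_subset.
have VI s t : s \in Sigma -> t \in Sigma -> V s = V t -> s = t.
  by move=> sS tS e; apply/eqP; rewrite finset.eqEsubset !le // e fintype.subxx.
have V0 : V finset.set0 = finset.set0.
  have [s sS Vs] := onto _ face0.
  by apply/eqP; rewrite -finset.subset0 -Vs -le // finset.sub0set.
have V1 t : exists k, V [set t]%SET = [set k]%SET.
  have [e|[k kV]] := set_0Vmem (V [set t]%SET).
    have : [set t]%SET = finset.set0 by apply: VI; rewrite // e V0.
    by move/setP/(_ t); rewrite !inE eqxx.
  have [s sS Vs] := onto _ (face1 k).
  have : s \subset [set t]%SET by rewrite le // Vs finset.sub1set.
  rewrite finset.subset1 => /orP[/eqP e|/eqP s0]; first by exists k; rewrite -e.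
  by move/setP/(_ k): Vs; rewrite s0 V0 !inE eqxx.
have [g hg] := choice V1.
have mem s t : s \in Sigma -> (t \in s) = (g t \in V s).
  by move=> sS; rewrite -!finset.sub1set -hg -le.
have gI : injective g.
  move=> t t' e; have : [set t]%SET = [set t']%SET by apply: VI; rewrite // !hg e.
  by move/setP/(_ t); rewrite !inE eqxx => /esym/eqP.
have gS k : exists t, g t = k.
  have [s sS Vs] := onto _ (face1 k).
  have [s0|[t ts]] := set_0Vmem s.
    by move/setP/(_ k): Vs; rewrite s0 V0 !inE eqxx.
  by exists t; move: ts; rewrite mem // Vs inE => /eqP.
have Vimg s : s \in Sigma -> V s = (g @: s)%SET.
  move=> sS; apply/setP => k; have [t <-] := gS k.
  by rewrite -mem // (finset.mem_imset _ _ gI).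
exists g; split.
  have [h hh] := choice gS; exists h => // t; apply: gI; exact: hh.
move=> s; split=> [sS|h]; first by rewrite -Vimg //; case: (hV s sS).
have [s' s'S Vs'] := onto _ h; rewrite Vimg // in Vs'.
by rewrite -(imset_inj gI Vs').
Qed.

Lemma fano_boundary_equiv (g : T -> K) : bijective g ->
  (forall s, s \in Sigma <-> exists2 J, JJ J & (g @: s)%SET \subset J) ->
  boundary_equiv Sigma (conv (range w)).
Proof.
move=> gbij hS; have gI := bij_inj gbij.
exists (fun s : {set T} => hull w (g @: s)%SET); split; last first.
  move=> s t /hS[J JJJ sJ] /hS[J' JJJ' tJ].
  split=> [st|/(fano_hull_le fan JJJ' tJ)/fintype.subsetP h].
    by apply: hull_subset; apply: imsetS.
  apply/fintype.subsetP => x xs; rewrite -(finset.mem_imset _ _ gI).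
  by apply: h; rewrite finset.mem_imset.
split.
- by move=> s /hS[J JJJ sJ]; apply: (fano_face d_gt0 fan JJJ).
- move=> s t /[!inE] /hS[J JJJ sJ] /hS[J' JJJ' tJ] /= e.
  apply: (imset_inj gI); apply/eqP; rewrite finset.eqEsubset.
  rewrite (fano_hull_le fan JJJ' tJ) ?e //=.
  by rewrite (fano_hull_le fan JJJ sJ) ?e.
- move=> F [/(fano_proper_face d_gt0 fan) h/h[J [S [JJJ SJ ->]]]].
  have gS : (g @: (g @^-1: S))%SET = S.
    apply/setP => k; apply/imsetP/idP => [[t + ->]|kS]; first by rewrite inE.
    by have [h' hg gh] := gbij; exists (h' k); rewrite ?inE gh.
  by exists (g @^-1: S)%SET; rewrite ?gS //=; apply/hS; exists J; rewrite ?gS.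
Qed.

End Boundary.

Section Pyramid.
Context {K T : finType}.

Definition apex_set (J : {set K}) : {set option K} := (None |: Some @: J)%SET.

Definition apex_sets (JJ : {set K} -> Prop) (S : {set option K}) :=
  exists2 J, JJ J & S = apex_set J.

Lemma None_apex J : None \in apex_set J.
Proof. by rewrite !inE eqxx. Qed.

Lemma Some_apex J k : (Some k \in apex_set J) = (k \in J).
Proof. by rewrite !inE /= (finset.mem_imset _ _ (@some_inj K)). Qed.

Lemma sum_apex (V : nmodType) J (F : option K -> V) :
  \sum_(k in apex_set J) F k = F None + \sum_(k in J) F (Some k).
Proof.
rewrite /apex_set big_setU1 /=; last by apply/imsetP => -[].
by rewrite big_imset //= => k l _ _ [].
Qed.

Lemma pyramidP (Sigma : {set {set T}}) (JJ : {set K} -> Prop) (g : T -> K) :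
  bijective g -> (forall s, s \in Sigma <-> exists2 J, JJ J & (g @: s)%SET \subset J) ->
  forall s, s \in pyramid Sigma <->
    exists2 S, apex_sets JJ S & (omap g @: s)%SET \subset S.
Proof.
move=> gbij hS s; have gI := bij_inj gbij; split.
  rewrite inE => /existsP[t /andP[/hS[J JJJ tJ] st]].
  exists (apex_set J); first by exists J.
  apply/fintype.subsetP => _ /imsetP[x xs ->]; case: x xs => [x|] xs; last exact: None_apex.
  rewrite Some_apex; apply: (fintype.subsetP tJ); apply: imset_f.
  move/(fintype.subsetP st): xs; rewrite !inE /=.
  by rewrite (finset.mem_imset _ _ (@some_inj T)).
move=> [S [J JJJ ->] sJ]; rewrite inE; apply/existsP; exists (g @^-1: J)%SET.
apply/andP; split.
  apply/hS; exists J => //; apply/fintype.subsetP => _ /imsetP[t + ->].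
  by rewrite inE.
apply/fintype.subsetP => -[x|] xs; rewrite !inE //= (finset.mem_imset _ _ (@some_inj T)) inE.
by rewrite -Some_apex; apply: (fintype.subsetP sJ); rewrite -[Some (g x)]/(omap g (Some x)) imset_f.
Qed.

Lemma omap_bij (g : T -> K) : bijective g -> bijective (omap g).
Proof.
by move=> [h hg gh]; exists (omap h) => -[x|] //=; rewrite ?hg ?gh.
Qed.

End Pyramid.

Section Heights.
Context {R : realType} {d : nat}.
Implicit Types (y z : 'rV[R]_d) (u : 'cV[R]_d).

Lemma dot_height y (t : R) u (s : R) :
  dot (at_height y t) (col_mx u (const_mx s)) = dot y u + t * s.
Proof. by rewrite mul_row_col mxE [X in _ + X]mxE big_ord1 !mxE. Qed.

Lemma at_heightD y z (s t : R) : at_height y s + at_height z t = at_height (y + z) (s + t).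
Proof.
rewrite /at_height add_row_mx; congr row_mx.
by apply/rowP => j; rewrite !mxE.
Qed.

Lemma at_heightZ (a : R) y (t : R) : a *: at_height y t = at_height (a *: y) (a * t).
Proof.
rewrite /at_height scale_row_mx; congr row_mx.
by apply/rowP => j; rewrite !mxE.
Qed.

Lemma at_height_sum (I : finType) (S : {set I}) (f : I -> 'rV[R]_d) (t : I -> R) :
  \sum_(i in S) at_height (f i) (t i) = at_height (\sum_(i in S) f i) (\sum_(i in S) t i).
Proof.
elim/big_rec3: _ => [|i x a b _ ->].
  2: by rewrite at_heightD.
rewrite /at_height (_ : const_mx 0 = 0) ?row_mx0.
  by [].
by apply/rowP => j; rewrite !mxE.
Qed.

Lemma heightE (y : 'rV[R]_(d + 1)) : y = at_height (lsubmx y) (rsubmx y 0 0).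
Proof.
rewrite -[LHS]hsubmxK /at_height; congr row_mx.
by apply/rowP => j; rewrite !mxE ord1.
Qed.

Lemma lsub_height y t : lsubmx (at_height y t) = y.
Proof. exact: row_mxKl. Qed.

Lemma rsub_height y t : rsubmx (at_height y t) 0 0 = t.
Proof. by rewrite row_mxKr mxE. Qed.

Lemma Zlat_height y t : Zlat y -> t \is a Num.int -> Zlat (at_height y t).
Proof.
move=> /ZlatP yZ tZ; apply/ZlatP => j; rewrite /at_height mxE.
by case: (fintype.split j) => k; rewrite ?mxE.
Qed.

Lemma Zlat_lsub (y : 'rV[R]_(d + 1)) : Zlat y -> Zlat (lsubmx y).
Proof. by move=> /ZlatP yZ; apply/ZlatP => j; rewrite mxE. Qed.

End Heights.

Section Lift.
Context {R : realType} {n d : nat} (v : 'I_n -> 'rV[R]_d).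

Definition lift_pt (x : 'rV[R]_n.+1) (k : option 'I_n) : 'rV[R]_(d + 1) :=
  if k is Some i then at_height (v i) (1 + x 0 (lift ord0 i)) else at_height 0 1.

Lemma Ccone_union (x : 'rV[R]_n.+1) y : x 0 ord0 = 0 ->
  Ccone v x y <-> exists2 S, apex_sets (facet_index v) S & cone_hull (lift_pt x) S y.
Proof.
move=> x0; pose b (k : option 'I_n) : 'rV[R]_(d + 1) :=
  if k is Some i then at_height (v i) (x 0 (lift ord0 i)) else at_height 0 (x 0 ord0).
have piece (J : {set 'I_n}) : at_height 0 (x 0 ord0) |`
      [set at_height (v i) (x 0 (lift ord0 i)) | i in [set` J]] =
    [set b k | k in [set` apex_set J]].
  apply/seteqP; split=> [z [->|[i iJ <-]]|_ [[i|] + <-]].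
  - by exists None => //=; apply: None_apex.
  - by exists (Some i) => //=; rewrite Some_apex; exact: iJ.
  - by rewrite /= Some_apex => iJ; right; exists i.
  - by left.
have bw k : b k + at_height 0 1 = lift_pt x k.
  case: k => [i|]; rewrite /b /lift_pt at_heightD addr0; first by rewrite addrC.
  by rewrite x0 add0r.
have shift (S : {set option 'I_n}) z : hull b S z <-> hull (lift_pt x) S (z + at_height 0 1).
  split=> [[a [a0 a1 ->]]|[a [a0 a1 E]]]; exists a; split=> //.
    rewrite -[X in _ + X]scale1r -[X in X *: at_height 0 1]a1 scaler_suml -big_split; apply: eq_bigr => k _.
    by rewrite -bw scalerDr.
  apply: (addIr (at_height 0 1)); rewrite E -[X in _ = _ + X]scale1r -[X in X *: at_height 0 1]a1 scaler_suml -big_split.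
  by apply: eq_bigr => k _; rewrite -bw scalerDr.
have ap0 (J : {set 'I_n}) : apex_set J != finset.set0.
  by apply/set0Pn; exists None; apply: None_apex.
split=> [[a [_ [z [J fJ zJ] <-] [a0 ->]]]|[S [J fJ ->] yS]].
  exists (apex_set J); first by exists J.
  apply/pos_hull_hull => //; exists a; exists (z + at_height 0 1); last by split.
  by apply/shift; move: zJ; rewrite piece conv_fin.
move/(pos_hull_hull (lift_pt x) y (ap0 J)): yS => [a [z zJ [a0 ->]]].
exists a; exists z; last by split.
exists (z - at_height 0 1); last by rewrite subrK.
exists J => //; rewrite piece conv_fin; apply/shift; by rewrite subrK.
Qed.

Hypotheses (d_gt0 : (0 < d)%N) (wl : well_labelled v) (sf : smooth_fano (vpoly v)).
Local Notation P := (vpoly v).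

Let fan : fano_fan v (facet_index v). Proof. exact: fano_fan_labelled. Qed.

Variable x : 'rV[R]_n.+1.
Hypotheses (x0 : x 0 ord0 = 0) (xZ : Zlat x) (sx : sconvex v x).

(** For the functional of a facet take the height minus [l]. For the apex coordinate take the height
    minus [u + l]: it vanishes on the lifted vertices of [J] and is nonnegative on all generators,
    by the Fano property for [u] and convexity for [l]. Hence every point of the cone lies above the
    lifted cone over the [J] that contains its projection. *)
Lemma cone_fan_lift :
  cone_fan (lift_pt x) (apex_sets (facet_index v)) (Ccone v x).
Proof.
have xi i : x 0 i \is a Num.int by move/ZlatP: xZ.
have wZ k : Zlat (lift_pt x k).
  case: k => [i|] /=; apply: Zlat_height; rewrite ?rpredD ?rpred1 ?xi //.
    exact: (fano_Zlat fan).
  exact: Zlat0.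
have top (J : {set 'I_n}) : facet_index v J -> exists e, [/\ dual (lift_pt x) (apex_set J) e,
    forall y, Zlat y -> forall k, k \in apex_set J -> dot y (e k) \is a Num.int &
    forall k, 0 <= dot (lift_pt x k) (e None)].
  move=> fJ; have [_ [e de eZ]] := fano_uni fan fJ.
  have [u u1 u2] := fano_functional fan fJ; have [l l1 l2] := sx fJ.
  pose e' (k : option 'I_n) : 'cV[R]_(d + 1) := if k is Some i then col_mx (e i) (const_mx 0)
    else col_mx (- (u + l)) (const_mx 1).
  have e'S (y : 'rV[R]_(d + 1)) i : dot y (e' (Some i)) = dot (lsubmx y) (e i).
    by rewrite {1}[y]heightE dot_height mulr0 addr0.
  have e'N (y : 'rV[R]_(d + 1)) : dot y (e' None) = rsubmx y 0 0 - dot (lsubmx y) (u + l).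
    by rewrite {1}[y]heightE dot_height dotNr mulr1 addrC.
  have ul i : i \in J -> dot (v i) (u + l) = 1 + x 0 (lift ord0 i).
    by move=> iJ; rewrite dotDr u1 // l1.
  have zul (z : 'rV[R]_d) : dot z (u + l) = \sum_(i in J) dot z (e i) * (1 + x 0 (lift ord0 i)).
    rewrite {1}[z](de.1) dot_suml; apply: eq_bigr => i iJ.
    by rewrite dotZl ul.
  exists e'; split.
  - split=> [y|k l'].
      rewrite sum_apex e'N (eq_bigr (fun i => at_height (dot (lsubmx y) (e i) *: v i)
        (dot (lsubmx y) (e i) * (1 + x 0 (lift ord0 i))))); last first.
        by move=> i _; rewrite e'S /= at_heightZ.
      rewrite at_height_sum -(de.1) at_heightZ scaler0 mulr1 at_heightD add0r -zul subrK.
      exact: heightE.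
    case: k => [i|]; case: l' => [j|]; rewrite ?Some_apex => hi hj.
    + by rewrite e'S /= lsub_height de.2.
    + by rewrite e'N /= lsub_height rsub_height ul // subrr.
    + by rewrite e'S /= lsub_height dot0l.
    + by rewrite e'N /= lsub_height rsub_height dot0l subr0.
  - move=> y yZ [i|]; rewrite ?Some_apex => hi.
      by rewrite e'S; apply: eZ => //; apply: Zlat_lsub.
    rewrite e'N rpredB //.
      by move/ZlatP: yZ => yZ; rewrite mxE.
    rewrite zul rpred_sum // => i iJ; rewrite rpredM ?rpredD ?rpred1 ?xi // eZ //.
    exact: Zlat_lsub.
  - case=> [i|]; rewrite e'N /= lsub_height rsub_height ?dot0l ?subr0 //.
    have [iJ|iJ] := boolP (i \in J); first by rewrite ul // subrr.
    by rewrite dotDr; have := u2 i iJ; have := l2 i iJ; lra.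
split.
- move=> _ [J fJ ->]; have [e [de eZ _]] := top J fJ.
  by split=> [k _|]; [exact: wZ|exists e].
- move=> _ [J fJ ->]; have [l l1 l2] := sx fJ.
  exists (col_mx (- l) (const_mx 1)) => -[i|]; rewrite ?Some_apex /= ?None_apex // => hi;
    rewrite dot_height dotNr mulr1 ?dot0l ?oppr0 ?add0r //.
    by rewrite l1 //; lra.
  by have := l2 i hi; lra.
- case=> [i|].
    have [J fJ iJ] := fano_mem fan i; exists (apex_set J); first by exists J.
    by rewrite Some_apex.
  have [J fJ _] := fano_cover fan 0; exists (apex_set J); first by exists J.
  exact: None_apex.
- move=> y; rewrite Ccone_union //; split=> [[S _]|yT].
    by apply: cone_hull_subset; apply: finset.subsetT.
  have [J fJ yJ] := fano_cover fan (lsubmx y).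
  have [_ [e0 de0 _]] := fano_uni fan fJ.
  have [e [de _ eN]] := top J fJ.
  exists (apex_set J); first by exists J.
  have [b b0 yE] := yJ.
  have [t yt] : exists t, y = at_height 0 t + \sum_(i in J) b i *: lift_pt x (Some i).
    exists (rsubmx y 0 0 - \sum_(i in J) b i * (1 + x 0 (lift ord0 i))).
    under [X in _ = _ + X]eq_bigr do rewrite /= at_heightZ.
    by rewrite at_height_sum -yE at_heightD add0r subrK -heightE.
  have t0 : 0 <= t.
    have : 0 <= dot y (e None).
      have [a a0 ->] := yT; rewrite dot_suml sumr_ge0 // => k _.
      by rewrite dotZl mulr_ge0.
    rewrite yt dotDl dot_suml [X in _ + X]big1 ?addr0; last first.
      by move=> i iJ; rewrite dotZl de.2 ?None_apex ?Some_apex // mulr0.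
    have -> : at_height 0 t = t *: lift_pt x None by rewrite /= at_heightZ scaler0 mulr1.
    by rewrite dotZl de.2 ?None_apex // eqxx mulr1.
  exists (fun k => if k is Some i then b i else t); first by case.
  by rewrite sum_apex /= at_heightZ scaler0 mulr1.
- by move=> y /(Ccone_union _ x0).
Qed.

Let cfan := cone_fan_lift.

Let m_gt0 : (0 < d + 1)%N. Proof. by rewrite addn1. Qed.

Lemma bottom_lift y : bottom (Ccone v x) y <->
  exists J (b : 'I_n -> R), [/\ facet_index v J, forall i, 0 <= b i, \sum_(i in J) b i <= 1 &
    y = at_height (\sum_(i in J) b i *: v i) (1 + \sum_(i in J) b i * x 0 (lift ord0 i))].
Proof.
have E (J : {set 'I_n}) (b : 'I_n -> R) (t : R) :
    t *: lift_pt x None + \sum_(i in J) b i *: lift_pt x (Some i) =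
    at_height (\sum_(i in J) b i *: v i)
      (t + \sum_(i in J) b i + \sum_(i in J) b i * x 0 (lift ord0 i)).
  under eq_bigr do rewrite /= at_heightZ mulrDr mulr1.
  by rewrite at_height_sum /= at_heightZ scaler0 mulr1 at_heightD add0r big_split addrA.
rewrite (cone_bottom m_gt0 cfan); split.
  move=> [_ [J fJ ->]] [a [a0 a1 ->]]; exists J, (fun i => a (Some i)).
  rewrite sum_apex in a1; split=> //.
    by rewrite -a1 lerDr.
  by rewrite sum_apex E a1.
move=> [J [b [fJ b0 b1 ->]]]; exists (apex_set J); first by exists J.
exists (fun k => if k is Some i then b i else 1 - \sum_(i in J) b i); split.
- by case=> [i|]; rewrite ?subr_ge0.
- by rewrite sum_apex subrK.
- by rewrite sum_apex E subrK.
Qed.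

(** The prism is the preimage of [P] under the projection, so its convexity and its faces come from
    [P]. The bottom is the graph of [1 + h] over [P], with [h] the maximum of finitely many linear
    functions; the graph map over the interior of [P] is the chart at the apex. *)
Lemma regular_lift : is_regular (Ccone v x).
Proof.
have PE z : P z <-> exists J (b : 'I_n -> R), [/\ facet_index v J, forall i, 0 <= b i,
    \sum_(i in J) b i <= 1 & z = \sum_(i in J) b i *: v i].
  split=> [zP|[J [b [fJ b0 b1 ->]]]]; last exact: (fano_poly_mem d_gt0 fan).
  have [J fJ [b b0 zE]] := fano_cover fan z; exists J, b; split=> //.
  have [u u1 u2] := fano_functional fan fJ.
  have u_le k : dot (v k) u <= 1 by have [/u1 ->|/u2/ltW] := boolP (k \in J).
  have := poly_le1 u_le zP; rewrite zE dot_suml (eq_bigr b) // => k kJ.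
  by rewrite dotZl u1 // mulr1.
have prismE y : prism (bottom (Ccone v x)) (at_height 0 1) y <-> P (lsubmx y).
  split=> [[z /bottom_lift[J [b [fJ b0 b1 ->]]] [t ->]]|/PE[J [b [fJ b0 b1 yE]]]].
    rewrite at_heightZ scaler0 at_heightD lsub_height addr0; apply/PE.
    by exists J, b.
  exists (at_height (\sum_(i in J) b i *: v i) (1 + \sum_(i in J) b i * x 0 (lift ord0 i))).
    by apply/bottom_lift; exists J, b.
  exists (rsubmx y 0 0 - (1 + \sum_(i in J) b i * x 0 (lift ord0 i))).
  by rewrite at_heightZ scaler0 at_heightD addr0 mulr1 addrC subrK -yE -heightE.
have hl J : exists l : 'cV[R]_d, facet_index v J ->
    (forall i, i \in J -> dot (v i) l = x 0 (lift ord0 i)) /\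
    forall i, dot (v i) l <= x 0 (lift ord0 i).
  have [/sx[l l1 l2]|nJ] := pselect (facet_index v J); last by exists 0.
  by exists l => _; split=> // i; have [/l1 ->|/l2/ltW] := boolP (i \in J).
have [l hl'] := choice hl.
have hJ z : exists J, facet_index v J /\ cone_hull v J z.
  by have [J fJ zJ] := fano_cover fan z; exists J.
have [Jz hJz] := choice hJ.
pose h z := dot z (l (Jz z)).
have h_max J z : facet_index v J -> dot z (l J) <= h z.
  move=> fJ; have [fz [a a0 zE]] := hJz z; rewrite /h.
  have [_ l2] := hl' _ fJ; have [l1 _] := hl' _ fz.
  rewrite {1}zE [X in _ <= dot X _]zE !dot_suml; apply: ler_sum => i iJ.
  by rewrite !dotZl (l1 i iJ) ler_wpM2l.
have h_eq J (b : 'I_n -> R) : facet_index v J -> (forall i, 0 <= b i) ->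
    h (\sum_(i in J) b i *: v i) = \sum_(i in J) b i * x 0 (lift ord0 i).
  move=> fJ b0; set z := \sum_(i in J) b i *: v i.
  have lz : dot z (l J) = \sum_(i in J) b i * x 0 (lift ord0 i).
    by rewrite dot_suml; apply: eq_bigr => i iJ; rewrite dotZl (hl' _ fJ).1.
  apply/eqP; rewrite eq_le -{2}lz h_max // andbT /h dot_suml; apply: ler_sum => i iJ.
  by rewrite dotZl ler_wpM2l // (hl' _ (hJz z).1).2.
pose L := 1 + \sum_(J : {set 'I_n}) \sum_j `|l J j 0|.
have L1 : 1 <= L by rewrite lerDl sumr_ge0 // => J _; rewrite sumr_ge0.
have h_half z z' : h z - h z' <= L * `|z - z'|.
  apply: le_trans (_ : dot (z - z') (l (Jz z)) <= _).
    by rewrite dotBl lerB // h_max //; case: (hJz z).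
  rewrite mxE; apply: le_trans (ler_norm _) _; apply: le_trans (ler_norm_sum _ _ _) _.
  apply: le_trans (_ : \sum_j `|l (Jz z) j 0| * `|z - z'| <= _).
    apply: ler_sum => j _; rewrite normrM mulrC ler_wpM2l //; exact: coord_le_norm.
  rewrite -mulr_suml ler_wpM2r // /L (bigD1 (Jz z)) //= addrCA lerDl addr_ge0 //.
  by rewrite sumr_ge0 // => J _; rewrite sumr_ge0.
have h_lip z z' : `|h z - h z'| <= L * `|z - z'|.
  by rewrite ler_norml h_half andbT lerNl opprB distrC h_half.
pose g z := at_height z (1 + h z).
have cg : continuous g.
  apply: (@lipschitz_continuous _ _ _ _ L) => z z'.
  have L0 : 0 <= L * `|z - z'| by rewrite mulr_ge0 // (le_trans ler01).
  apply: norm_rV_le => // j; rewrite /g /at_height !mxE; case: (fintype.split j) => k; rewrite ?mxE.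
    apply: le_trans (_ : `|z - z'| <= _).
      by have := coord_le_norm (z - z') k; rewrite !mxE.
    by rewrite -[X in X <= _]mul1r ler_wpM2r.
  by rewrite opprD addrACA subrr add0r.
have cf : continuous (fun y : 'rV[R]_(d + 1) => lsubmx y).
  apply: (@lipschitz_continuous _ _ _ _ 1) => y y'; rewrite mul1r.
  apply: norm_rV_le => // j; rewrite !mxE.
  by have := coord_le_norm (y - y') (lshift 1 j); rewrite !mxE.
have OE : at_height 0 1 = lift_pt x None by [].
have [J0 fJ0 _] := fano_cover fan 0.
have Ocell : bottom_complex (Ccone v x) [set at_height 0 1].
  apply/(cone_bottom_complex m_gt0 cfan); exists (apex_set J0), [set None]%SET; split.
  - by exists J0.
  - by rewrite finset.sub1set None_apex.
  - by apply/set0Pn; exists None; rewrite inE.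
  - rewrite -conv_fin -conv1; congr conv; apply/seteqP; split=> [_ ->|_ [k + <-]].
      by exists None; rewrite //= inE.
    by rewrite /= inE => /eqP ->.
exists (at_height 0 1); split; last 1 first.
- move=> G /(cone_bottom_complex m_gt0 cfan)[_ [S [[J fJ ->] SJ S0 GE]]] GO.
  have NS : None \notin S.
    by apply/negP => NS; apply: GO; rewrite GE OE; apply: hull_mem.
  pose S' := (Some @^-1: S)%SET.
  have SE : S = (Some @: S')%SET.
    apply/setP => -[i|]; first by rewrite (finset.mem_imset _ _ (@some_inj _)) inE.
    by rewrite (negPf NS); apply/esym/imsetP => -[].
  have S'J : S' \subset J.
    apply/fintype.subsetP => i; rewrite inE => /(fintype.subsetP SJ).
    by rewrite Some_apex.
  have [[u [b [hu FE]]] _] := fano_face d_gt0 fan fJ S'J.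
  have prG y : prism G (at_height 0 1) y <-> hull v S' (lsubmx y).
    rewrite GE SE hull_imset; last exact: some_inj.
    split=> [[z [a [a0 a1 ->]] [t ->]]|[a [a0 a1 yE]]].
      exists a; split=> //; under eq_bigr do rewrite /= at_heightZ.
      by rewrite at_height_sum at_heightZ scaler0 at_heightD addr0 lsub_height.
    exists (\sum_(i in S') a i *: lift_pt x (Some i)); first by exists a.
    exists (rsubmx y 0 0 - \sum_(i in S') a i * (1 + x 0 (lift ord0 i))).
    under eq_bigr do rewrite /= at_heightZ.
    rewrite at_height_sum at_heightZ scaler0 at_heightD addr0 mulr1 addrC subrK -yE.
    exact: heightE.
  have dE (y : 'rV[R]_(d + 1)) : dot y (col_mx u (const_mx 0)) = dot (lsubmx y) u.
    by rewrite {1}[y]heightE dot_height mulr0 addr0.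
  exists (col_mx u (const_mx 0)), b; split=> [y /prismE yP|].
    by rewrite dE; apply: hu.
  apply/seteqP; split=> [y /prG|y [/prismE yP]].
    by rewrite FE => -[yP yb]; split; [apply/prismE|rewrite dE].
  by rewrite dE => yb; apply/prG; rewrite FE.
- split=> //; split.
    apply/bottom_lift; exists J0, (fun=> 0); split=> //; first by rewrite big1.
    by rewrite !big1 ?addr0 // => i _; rewrite ?scale0r ?mul0r.
  exists [set y | P° (lsubmx y)], P°; split.
  + apply: open_comp; last exact: open_interior.
    by move=> y _; apply: cf.
  + by rewrite /= lsub_height; apply: (fano_interior d_gt0 fan).
  + exact: open_interior.
  exists (fun y => lsubmx y), g; split.
  + by apply: continuous_subspaceT.
  + by apply: continuous_subspaceT.
  + by move=> _ [y [_ yP] <-].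
  + move=> _ [z zP <-]; split; last by rewrite /= lsub_height.
    have /PE[J [b [fJ b0 b1 ->]]] := interior_subset zP.
    by apply/bottom_lift; exists J, b; split=> //; rewrite /g h_eq.
  + split=> [y [/bottom_lift[J [b [fJ b0 b1 ->]]] _]|z _]; last exact: lsub_height.
    by rewrite lsub_height /g h_eq.
- apply/is_convexP => y z t t01 /prismE yP /prismE zP; apply/prismE.
  rewrite linearD !linearZ /=.
  by move/is_convexP: (@conv_convex R d (range v)); apply.
Qed.

Lemma regular_realization_lift (T : finType) (Sigma : {set {set T}}) :
  simplicial_complex Sigma -> boundary_equiv Sigma P ->
  regular_realization Sigma (Ccone v x).
Proof.
move=> cS bS; have [g [gbij hg]] := boundary_equiv_vertices d_gt0 fan cS bS.
split; last exact: regular_lift.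
apply: (cone_reduced_realization m_gt0 cfan (omap_bij gbij)).
exact: pyramidP.
Qed.

End Lift.

(** * Lattice isomorphisms of cones *)

Section LatticeIso.
Context {R : realType}.

Lemma lattice_iso_refl m (C : set 'rV[R]_m) : lattice_iso C C.
Proof. by exists id; split=> //; split=> // y yC; exists y. Qed.

Lemma lattice_iso_sym m m' (C : set 'rV[R]_m) (D : set 'rV[R]_m') :
  is_cone C -> lattice_iso C D -> lattice_iso D C.
Proof.
move=> coneC [f [[ff fi fs] fD]].
have hg y : exists x, (D `&` Zlat) y -> (C `&` Zlat) x /\ f x = y.
  have [yD|nyD] := pselect ((D `&` Zlat) y); last by exists 0.
  by have [x xC <-] := fs y yD; exists x.
have [g hg'] := choice hg; exists g; split; last first.
  move=> x y xD xZ yD yZ.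
  have [[gxC gxZ] gx] := hg' x (conj xD xZ); have [[gyC gyZ] gy] := hg' y (conj yD yZ).
  have sC : (C `&` Zlat) (g x + g y) by split; [exact: is_cone_add|exact: ZlatD].
  have fxy : f (g x + g y) = x + y by rewrite fD // gx gy.
  have [sC' E] : (C `&` Zlat) (g (x + y)) /\ f (g (x + y)) = x + y.
    by apply: hg'; rewrite -fxy; apply: ff.
  by apply: fi; rewrite ?inE // E.
split=> [y /hg'[]//|y z /[!inE] yD zD E|x xC].
  by rewrite -(hg' y yD).2 E (hg' z zD).2.
exists (f x); first exact: ff.
have [gC E] := hg' (f x) (ff x xC).
by apply: fi; rewrite ?inE.
Qed.

Lemma lattice_iso_trans m m' m'' (C : set 'rV[R]_m) (D : set 'rV[R]_m')
    (E : set 'rV[R]_m'') : lattice_iso C D -> lattice_iso D E -> lattice_iso C E.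
Proof.
move=> [f [fb fD]] [g [gb gD]]; exists (g \o f); have [ff fi fs] := fb; have [gf gi gs] := gb; split.
  split=> [x /ff/gf //|x y /[!inE] xC yC /= e|z /gs[y /fs[x xC <-] <-]].
    by apply: fi; rewrite ?inE //; apply: gi; rewrite ?inE //; apply: ff.
  by exists x.
move=> x y xC xZ yC yZ /=.
have [fxD fxZ] := ff x (conj xC xZ); have [fyD fyZ] := ff y (conj yC yZ).
by rewrite fD // gD.
Qed.

Section Fans.
Context {m m' : nat} {K K' : finType}.
Variables (w : K -> 'rV[R]_m) (JJ : {set K} -> Prop) (C : set 'rV[R]_m).
Variables (w' : K' -> 'rV[R]_m') (JJ' : {set K'} -> Prop) (C' : set 'rV[R]_m').
Hypotheses (fan : cone_fan w JJ C) (fan' : cone_fan w' JJ' C').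

(** Lattice points of both cones are natural combinations of generators, so a bijection of
    generators gives the bijection of lattice points without integrality of [F]. *)
Lemma lattice_iso_of_linear (g : K -> K') (F : 'M[R]_(m, m')) : bijective g ->
  (forall k, w k *m F = w' (g k)) -> (forall y : 'rV[R]_m, y *m F = 0 -> y = 0) ->
  lattice_iso C C'.
Proof.
move=> [h hg gh] wF Finj; exists (fun y => y *m F); split; last first.
  by move=> x y _ _ _ _; rewrite mulmxDl.
have combF (J : {set K}) (c : K -> nat) : (\sum_(k in J) (c k)%:R *: w k) *m F =
    \sum_(k in (g @: J)%SET) (c (h k))%:R *: w' k.
  rewrite mulmx_suml big_imset /=; last by move=> k l _ _; exact: (can_inj hg).
  by apply: eq_bigr => k _; rewrite -scalemxAl wF hg.
split.
- move=> y [yC yZ]; have [J JJJ yJ] := cone_cover fan yC.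
  have [c ->] := cone_lattice fan JJJ yJ yZ; rewrite combF; split.
    exact: (cone_sub fan' (nat_comb_cone w' _ (c \o h))).
  exact: (nat_comb_Zlat fan' _ (c \o h)).
- move=> y z _ _ E; apply/eqP; rewrite -subr_eq0; apply/eqP; apply: Finj.
  by rewrite mulmxBl E subrr.
- move=> y [yC yZ]; have [J JJJ yJ] := cone_cover fan' yC.
  have [c ->] := cone_lattice fan' JJJ yJ yZ.
  exists (\sum_(k in (h @: J)%SET) (c (g k))%:R *: w k).
    split; first exact: (cone_sub fan (nat_comb_cone w _ (c \o g))).
    exact: (nat_comb_Zlat fan _ (c \o g)).
  rewrite combF -imset_comp (eq_imset (g := id)) => [|k /=]; last exact: gh.
  by rewrite imset_id; apply: eq_bigr => k _; rewrite gh.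
Qed.

(* Hilbert bases correspond under an isomorphism, and an additive map on the
   lattice points of a full-dimensional cone is the restriction of a linear
   one. *)
Lemma lattice_iso_linear : lattice_iso C C' -> exists (g : K -> K') (F : 'M[R]_(m, m')),
  bijective g /\ forall k, w k *m F = w' (g k).
Proof.
move=> [f [[ff fi fs] fD]].
have C0 : (C `&` Zlat) 0 by split; [exact: (cone_sub fan (cone_hull0 w finset.set0))|exact: Zlat0].
have f0 : f 0 = 0.
  have [c0 z0] := C0; have := fD 0 0 c0 z0 c0 z0; rewrite addr0 => e.
  by apply: (addrI (f 0)); rewrite addr0 -e.
have injf y z : (C `&` Zlat) y -> (C `&` Zlat) z -> f y = f z -> y = z.
  by move=> yC zC; apply: fi; rewrite inE.
have CZD y z : (C `&` Zlat) y -> (C `&` Zlat) z -> (C `&` Zlat) (y + z).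
  move=> [/(cone_fanE fan) yC yZ] [/(cone_fanE fan) zC zZ]; split; last exact: ZlatD.
  by apply/(cone_fanE fan); apply: cone_hullD.
have fHilb x : Hilb C x -> Hilb C' (f x).
  move=> [xC xZ x0 xind]; have [fxC fxZ] := ff x (conj xC xZ); split=> //.
    by move=> fx0; apply: x0; apply: injf => //; rewrite fx0 f0.
  move=> y z yC yZ zC zZ E.
  have [y' [y'C y'Z] fy] := fs y (conj yC yZ); have [z' [z'C z'Z] fz] := fs z (conj zC zZ).
  have xE : x = y' + z' by apply: injf; [|exact: CZD|rewrite fD // fy fz].
  have [y0|z0] := xind y' z' y'C y'Z z'C z'Z xE.
    by left; rewrite -fy y0 f0.
  by right; rewrite -fz z0 f0.
have hg k : exists k', f (w k) = w' k'.
  have : range w' (f (w k)).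
    by rewrite -(cone_Hilb fan'); apply: fHilb; rewrite (cone_Hilb fan); exists k.
  by move=> [k' _ <-]; exists k'.
have [g gE] := choice hg.
have wCZ k : (C `&` Zlat) (w k) by split; [exact: cone_gen fan k|exact: cone_Zlat fan k].
have gI : injective g.
  move=> k l e; apply: (cone_inj fan); apply: injf => //.
  by rewrite !gE e.
have gS k' : exists k, g k = k'.
  have w'H : Hilb C' (w' k') by rewrite (cone_Hilb fan'); exists k'.
  have [w'C w'Z w'0 w'ind] := w'H.
  have [x [xC xZ] fx] := fs (w' k') (conj w'C w'Z).
  have : Hilb C x.
    split=> //; first by move=> x0; apply: w'0; rewrite -fx x0 f0.
    move=> y z yC yZ zC zZ E.
    have [fyC fyZ] := ff y (conj yC yZ); have [fzC fzZ] := ff z (conj zC zZ).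
    have fE : w' k' = f y + f z by rewrite -fx E fD.
    have [y0|z0] := w'ind _ _ fyC fyZ fzC fzZ fE; [left|right].
      by apply: injf => //; rewrite y0 f0.
    by apply: injf => //; rewrite z0 f0.
  rewrite (cone_Hilb fan) => -[k _ wk]; exists k; apply: (cone_inj fan').
  by rewrite -gE wk.
have fcomb (S : {set K}) (c : K -> nat) :
    (C `&` Zlat) (\sum_(k in S) (c k)%:R *: w k) /\
    f (\sum_(k in S) (c k)%:R *: w k) = \sum_(k in S) (c k)%:R *: w' (g k).
  apply: (big_rec2 (fun y y' => (C `&` Zlat) y /\ f y = y')); first by [].
  move=> k y' y _ [yC <-].
  have [h1 h2] : (C `&` Zlat) ((c k)%:R *: w k) /\ f ((c k)%:R *: w k) = (c k)%:R *: w' (g k).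
    elim: (c k) => [|a [IH1 IH2]]; first by rewrite !scale0r.
    have E (V : lmodType R) (z : V) : a.+1%:R *: z = z + a%:R *: z.
      by rewrite -add1n natrD scalerDl scale1r.
    rewrite !E; split; first exact: CZD.
    have [w1 w2] := wCZ k; have [i1 i2] := IH1.
    by rewrite fD // IH2 gE.
  split; first exact: CZD.
  by have [h3 h4] := h1; have [h5 h6] := yC; rewrite fD // h2.
have [J0 JJJ0] := cone_ne fan; have [_ [e de eZ]] := cone_uni fan JJJ0.
pose F : 'M[R]_(m, m') := \sum_(k in J0) e k *m w' (g k).
have FE (y : 'rV[R]_m) : y *m F = \sum_(k in J0) dot y (e k) *: w' (g k).
  rewrite mulmx_sumr; apply: eq_bigr => k _.
  by rewrite mulmxA {1}[y *m e k]mx11_scalar mul_scalar_mx.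
exists g, F; split; first by have [h hh] := choice gS; exists h => // k; apply: gI; exact: hh.
move=> l.
(* [f] is additive only on lattice points of the cone, so integral coordinates are written as
   differences of natural numbers and the negative parts are moved to the other side. *)
have hpq k : exists pq : nat * nat, k \in J0 -> dot (w l) (e k) = pq.1%:R - pq.2%:R.
  have [kJ|kJ] := boolP (k \in J0); last by exists (0, 0)%N.
  have /intrP[z zE] := eZ _ (cone_Zlat fan l) k kJ.
  case: z zE => p zE; first by exists (p, 0)%N; rewrite subr0 zE.
  by exists (0, p.+1)%N; rewrite sub0r zE NegzE mulrNz.
have [pq hpq'] := choice hpq.
have [[q1 q2] fq] := fcomb J0 (fun k => (pq k).2).
have [[p1 p2] fp] := fcomb J0 (fun k => (pq k).1).
have E : w l + \sum_(k in J0) (pq k).2%:R *: w k = \sum_(k in J0) (pq k).1%:R *: w k.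
  rewrite {1}[w l](de.1) -big_split /=; apply: eq_bigr => k kJ.
  by rewrite -scalerDl hpq' // subrK.
have := congr1 f E; have [l1 l2] := wCZ l; rewrite fD // fq fp gE => fE.
apply: (addIr (\sum_(k in J0) (pq k).2%:R *: w' (g k))); rewrite fE FE -big_split /=.
apply: eq_bigr => k kJ. by rewrite -scalerDl hpq' // subrK.
Qed.

End Fans.

Lemma cone_fan_linear_unit m (K K' : finType) (w : K -> 'rV[R]_m) (w' : K' -> 'rV[R]_m)
    JJ' C' (g : K -> K') (F : 'M[R]_m) : cone_fan w' JJ' C' -> bijective g ->
  (forall k, w k *m F = w' (g k)) -> exists2 G : 'M[R]_m, F *m G = 1%:M &
    forall k, w' (g k) *m G = w k.
Proof.
move=> fan' [h hg gh] wF; have [J JJJ] := cone_ne fan'.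
have [_ [e de _]] := cone_uni fan' JJJ.
pose G := \sum_(k in J) e k *m w (h k).
have GF : G *m F = 1%:M.
  apply/row_matrixP => i; rewrite row1 row_mul rowE.
  rewrite mulmx_sumr mulmx_suml [RHS](de.1); apply: eq_bigr => k kJ.
  by rewrite mulmxA -mulmxA wF gh [_ *m e k]mx11_scalar mul_scalar_mx -mx11_scalar.
exists G; first exact: mulmx1C.
by move=> k; rewrite -wF -mulmxA (mulmx1C GF) mulmx1.
Qed.

(** Transport the functional of [J] by the inverse map: it is at least 1 on all generators, so by
    [cone_tight] the image of [J] lies in some facet, which has the same size. *)
Lemma cone_fan_facets m (K K' : finType) (w : K -> 'rV[R]_m) (w' : K' -> 'rV[R]_m)
    JJ JJ' C C' (g : K -> K') (F : 'M[R]_m) (J : {set K}) :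
  cone_fan w JJ C -> cone_fan w' JJ' C' -> bijective g ->
  (forall k, w k *m F = w' (g k)) -> JJ J -> JJ' (g @: J)%SET.
Proof.
move=> fan fan' gbij wF JJJ.
have [G FG w'G] := cone_fan_linear_unit fan' gbij wF.
have [u u1 u2] := cone_functional fan JJJ.
have uw := cone_functional_ge1 u1 u2.
have [h hg gh] := gbij.
have dE k : dot (w' k) (G *m u) = dot (w (h k)) u by rewrite mulmxA -{1}[k]gh w'G.
have [||J' JJJ' sub] := @cone_tight _ _ _ _ _ _ fan' (G *m u) (g @: J)%SET.
- by move=> k; rewrite dE.
- by move=> _ /imsetP[k kJ ->]; rewrite dE hg u1.
suff -> : (g @: J)%SET = J' by [].
apply/eqP; rewrite eqEcard sub (cone_card fan' JJJ') (card_imset _ (can_inj hg)).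
by rewrite (cone_card fan JJJ) leqnn.
Qed.

End LatticeIso.

Section LiftIso.
Context {R : realType} {n d : nat}.
Hypothesis d_gt0 : (0 < d)%N.
Implicit Types (v : 'I_n -> 'rV[R]_d) (x y z : 'rV[R]_n.+1).

Local Notation ht x i := (x 0 (lift ord0 i)).

Lemma facet_avoiding v i : fano_fan v (facet_index v) ->
  exists2 J, facet_index v J & i \notin J.
Proof.
move=> fan; have [J fJ yJ] := fano_cover fan (- v i); exists J => //.
have [_ [e de _]] := fano_uni fan fJ.
apply/negP => iJ; move/(cone_hull_dual de)/(_ i iJ): yJ.
by rewrite dotNl de.2 // eqxx oppr_ge0 ler10.
Qed.

(** The apex is fixed because it is in every facet, while each other vertex is avoided by one. A
    linear map that fixes the apex is given by its part [a] modulo the apex and a shear [l]. *)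
Lemma lift_iso_data v v' x x' :
  cone_fan (lift_pt v x) (apex_sets (facet_index v)) (Ccone v x) ->
  cone_fan (lift_pt v' x') (apex_sets (facet_index v')) (Ccone v' x') ->
  fano_fan v' (facet_index v') ->
  lattice_iso (Ccone v x) (Ccone v' x') ->
  exists (g : 'I_n -> 'I_n) (a : 'M[R]_d) (l : 'cV[R]_d), [/\ bijective g,
    forall i, v i *m a = v' (g i), forall i, ht x' (g i) = ht x i + dot (v i) l &
    forall J, facet_index v J -> facet_index v' (g @: J)%SET].
Proof.
move=> fan fan' pfan' /(lattice_iso_linear fan fan')[G [F [Gbij GF]]].
have [H GH HG] := Gbij.
have [F' FF' F'E] := cone_fan_linear_unit fan' Gbij GF.
have Hbij : bijective H by exists G.
have F'E' k : lift_pt v' x' k *m F' = lift_pt v x (H k) by rewrite -{1}[k]HG F'E.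
have GN : G None = None.
  case E: (G None) => [i|] //; have [J fJ iJ] := facet_avoiding i pfan'.
  have : apex_sets (facet_index v') (apex_set J) by exists J.
  move/(cone_fan_facets fan' fan Hbij F'E') => [J1 _ E1].
  have : None \in (H @: apex_set J)%SET by rewrite E1 None_apex.
  case/imsetP => k kJ HN; case/negP: iJ; rewrite -Some_apex -E HN HG //.
have GS i : exists j, G (Some i) = Some j.
  case E: (G (Some i)) => [j|]; first by exists j.
  by have : Some i = None by apply: (can_inj GH); rewrite E GN.
have [g gE] := choice GS.
have gbij : bijective g.
  apply: injF_bij => i j e; have : Some i = Some j by apply: (can_inj GH); rewrite !gE e.
  by case.
pose a := ulsubmx F; pose l : 'cV[R]_d := ursubmx F.
have FN : at_height (0 : 'rV[R]_d) 1 *m F = at_height 0 1 by have := GF None; rewrite GN.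
have hF (y : 'rV[R]_d) (t : R) : at_height y t *m F = at_height (y *m a) (dot y l + t).
  have -> : at_height y t = at_height y 0 + t *: at_height 0 1.
    by rewrite at_heightZ scaler0 at_heightD addr0 mulr1 add0r.
  rewrite mulmxDl -scalemxAl FN at_heightZ scaler0 mulr1.
  rewrite (_ : at_height y 0 *m F = at_height (y *m a) (dot y l)).
    by rewrite at_heightD addr0.
  rewrite /at_height -[F in LHS]submxK mul_row_block (_ : const_mx 0 = 0).
    rewrite !mul0mx !addr0; congr row_mx; apply/rowP => j; rewrite ord1 [RHS]mxE //.
  by apply/matrixP => i j; rewrite !mxE.
exists g, a, l; split=> //.
- move=> i; have := GF (Some i); rewrite gE /= hF => /(congr1 lsubmx).
  by rewrite !lsub_height.
- move=> i; have := GF (Some i); rewrite gE /= hF => /(congr1 (fun M => rsubmx M 0 0)).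
  by rewrite !rsub_height; lra.
- move=> J fJ; have : apex_sets (facet_index v) (apex_set J) by exists J.
  move/(cone_fan_facets fan fan' Gbij GF) => [J1 fJ1 E1].
  suff -> : (g @: J)%SET = J1 by [].
  apply/setP => j; rewrite -[RHS]Some_apex -E1; apply/imsetP/imsetP => [[i iJ ->]|[[i|]]].
  + by exists (Some i); rewrite ?Some_apex ?gE.
  + by rewrite Some_apex gE => iJ [->]; exists i.
  + by rewrite GN.
Qed.

(** The map and its inverse are sums of products [e k *m v' (g k)] of dual vectors that are integral
    on the lattice with lattice vectors. *)
Lemma fano_fan_linear v v' (g : 'I_n -> 'I_n) (a : 'M[R]_d) : 
  fano_fan v (facet_index v) -> fano_fan v' (facet_index v') -> bijective g ->
  (forall i, v i *m a = v' (g i)) ->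
  exists2 b : 'M[R]_d, a *m b = 1%:M & (forall i, v' (g i) *m b = v i) /\
    exists2 U : 'M[int]_d, U \in unitmx & a = map_mx intr U.
Proof.
move=> fan fan' [h hg gh] va.
have matrix_of (p q : 'I_n -> 'rV[R]_d) (r : 'I_n -> 'I_n) : fano_fan p (facet_index p) ->
    fano_fan q (facet_index q) ->
    exists2 J, facet_index p J & exists2 e, dual p J e & exists U : 'M[int]_d,
      \sum_(k in J) e k *m q (r k) = map_mx intr U.
  move=> fp fq; have [J fJ _] := fano_cover fp 0; exists J => //.
  have [_ [e de eZ]] := fano_uni fp fJ; exists e => //.
  have az i j : exists c : int, (\sum_(k in J) e k *m q (r k)) i j = c%:~R.
    apply/intrP; have /ZlatP : Zlat (row i (\sum_(k in J) e k *m q (r k))).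
      rewrite rowE mulmx_sumr; apply: Zlat_sum => k kJ.
      rewrite mulmxA [_ *m e k]mx11_scalar mul_scalar_mx; apply: ZlatZ.
        by apply: eZ => //; apply: Zlat_delta.
      exact: (fano_Zlat fq).
    by move=> /(_ j); rewrite mxE.
  have [c hc] := choice (fun ij : 'I_d * 'I_d => az ij.1 ij.2).
  by exists (\matrix_(i, j) c (i, j)); apply/matrixP => i j; rewrite (hc (i, j)) !mxE.
have [J fJ [e de [U UE]]] := matrix_of v v' g fan fan'.
have [J' fJ' [e' de' [U' UE']]] := matrix_of v' v h fan' fan.
have aE : a = map_mx intr U.
  apply/row_matrixP => i; rewrite !rowE -UE mulmx_sumr.
  rewrite {1}[delta_mx 0 i](de.1) mulmx_suml; apply: eq_bigr => k kJ.
  by rewrite -scalemxAl va mulmxA [_ *m e k]mx11_scalar mul_scalar_mx -mx11_scalar.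
pose b : 'M[R]_d := map_mx intr U'.
have ba : b *m a = 1%:M.
  apply/row_matrixP => i; rewrite row1 row_mul rowE /b -UE'.
  rewrite mulmx_sumr mulmx_suml [RHS](de'.1); apply: eq_bigr => k kJ.
  by rewrite mulmxA -mulmxA va gh [_ *m e' k]mx11_scalar mul_scalar_mx -mx11_scalar.
have ab := mulmx1C ba.
exists b => //; split; first by move=> i; rewrite -va -mulmxA ab mulmx1.
exists U => //; apply: (mulmx1_unit (B := U') _).1.
apply/matrixP => i j; apply: (intr_inj (R := R)).
have /matrixP/(_ i j) : map_mx intr (U *m U') = map_mx intr 1%:M :> 'M[R]_d.
  by rewrite map_mxM -aE ab map_mx1.
by rewrite mxE => ->; rewrite mxE.
Qed.

Lemma vpoly_image v v' (g : 'I_n -> 'I_n) (a : 'M[R]_d) : bijective g ->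
  (forall i, v i *m a = v' (g i)) -> [set y *m a | y in vpoly v] = vpoly v'.
Proof.
move=> [h hg gh] va; rewrite /vpoly !range_setT !conv_fin hull_image.
have -> : (fun k => v k *m a) = v' \o g by apply/funext => k; exact: va.
rewrite -hull_imset; last exact: can_inj hg.
by congr hull; apply/setP => k; rewrite !inE; apply/imsetP; exists (h k).
Qed.

Lemma unimodular_equiv_iso v v' x x' :
  cone_fan (lift_pt v x) (apex_sets (facet_index v)) (Ccone v x) ->
  cone_fan (lift_pt v' x') (apex_sets (facet_index v')) (Ccone v' x') ->
  fano_fan v (facet_index v) -> fano_fan v' (facet_index v') ->
  lattice_iso (Ccone v x) (Ccone v' x') -> unimodular_equiv (vpoly v) (vpoly v').
Proof.
move=> fan fan' pfan pfan' iso.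
have [g [a [l [gbij va _ _]]]] := lift_iso_data fan fan' pfan' iso.
have [b ab [_ [U Uu aE]]] := fano_fan_linear pfan pfan' gbij va.
exists U, 0; split=> //; rewrite -(vpoly_image gbij va) -aE.
have -> : map_mx intr (0 : 'rV[int]_d) = 0 :> 'rV[R]_d by apply/rowP => j; rewrite !mxE.
by apply/seteqP; split=> _ [y yP <-]; exists y; rewrite ?addr0.
Qed.

Lemma unimodular_equiv_refl (P : set 'rV[R]_d) : unimodular_equiv P P.
Proof.
exists 1%:M, 0; split; first exact: unitmx1.
have -> : map_mx intr (0 : 'rV[int]_d) = 0 :> 'rV[R]_d by apply/rowP => j; rewrite !mxE.
by rewrite map_mx1; apply/seteqP; split=> [y yP|_ [y yP <-]];
  [exists y; rewrite ?mulmx1 ?addr0|rewrite mulmx1 addr0].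
Qed.

(** * Orbits of automorphisms and isomorphism classes *)

Let bpt v x (k : option 'I_n) : 'rV[R]_(d + 1) :=
  if k is Some i then at_height (v i) (ht x i) else at_height 0 (x 0 ord0).

Lemma BgraphE v x : Bgraph v x = [set y | exists2 J, facet_index v J &
  hull (bpt v x) (apex_set J) y].
Proof.
have piece (J : {set 'I_n}) : at_height 0 (x 0 ord0) |`
      [set at_height (v i) (x 0 (lift ord0 i)) | i in [set` J]] =
    [set bpt v x k | k in [set` apex_set J]].
  apply/seteqP; split=> [z [->|[i iJ <-]]|_ [[i|] + <-]].
  - by exists None => //=; apply: None_apex.
  - by exists (Some i) => //=; rewrite Some_apex; exact: iJ.
  - by rewrite /= Some_apex => iJ; right; exists i.
  - by left.
by apply/seteqP; split=> y [J fJ yJ]; exists J => //; move: yJ; rewrite piece conv_fin.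
Qed.

Section Orbit.
Variable v : 'I_n -> 'rV[R]_d.
Hypotheses (wl : well_labelled v) (sf : smooth_fano (vpoly v)).

Let fan : fano_fan v (facet_index v). Proof. exact: fano_fan_labelled. Qed.

(** [act_eq] compares graphs as sets; this recovers the heights from them. A point of the graph over
    a vertex has all its weight on that vertex, by the functional of a facet through it. *)
Lemma Bgraph_vertex x k (t : R) : Bgraph v x (at_height (v k) t) <-> t = ht x k.
Proof.
rewrite BgraphE; split=> [[J fJ [c [c0 c1 E]]]|->]; last first.
  have [J fJ kJ] := fano_mem fan k; exists J => //.
  by apply: (@hull_mem _ _ _ (bpt v x) _ (Some k)); rewrite Some_apex.
rewrite sum_apex in c1; rewrite sum_apex /= at_heightZ scaler0 in E.
rewrite (eq_bigr (fun i => at_height (c (Some i) *: v i) (c (Some i) * ht x i))) in E; last first.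
  by move=> i _; rewrite /= at_heightZ.
rewrite at_height_sum at_heightD add0r in E.
have Ev := congr1 lsubmx E; rewrite !lsub_height in Ev.
have Et := congr1 (fun M => rsubmx M 0 0) E; rewrite /= !rsub_height in Et.
have [J' fJ' kJ'] := fano_mem fan k; have [u u1 u2] := fano_functional fan fJ'.
have u_le i : dot (v i) u <= 1 by have [/u1 ->|/u2/ltW] := boolP (i \in J').
have s1 : \sum_(i in J) c (Some i) = 1.
  apply/eqP; rewrite eq_le; apply/andP; split; first by rewrite -c1 lerDr.
  rewrite -[leLHS](u1 k kJ') Ev dot_suml; apply: ler_sum => i _.
  by rewrite dotZl ler_piMr.
have cN : c None = 0 by apply: (addIr (\sum_(i in J) c (Some i))); rewrite c1 add0r s1.
have kJ : k \in J.
  apply: (fano_hull_mem fan fJ (fintype.subxx J)).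
  by exists (fun i => c (Some i)); split.
have [_ [e de _]] := fano_uni fan fJ.
have cE i : i \in J -> c (Some i) = (i == k)%:R.
  move=> iJ; have := de.2 k i kJ iJ.
  by rewrite {1}Ev (dual_coeff de (fun i => c (Some i))) // iJ eq_sym.
rewrite Et cN mul0r add0r (eq_bigr (fun i => (i == k)%:R *: ht x i)); last first.
  by move=> i iJ; rewrite cE.
exact: sum_indicator.
Qed.

Lemma lift_linE (a : 'M[R]_d) (z : 'rV[R]_(d + 1)) : lift_lin a z = z *m block_mx a 0 0 1%:M.
Proof.
rewrite /lift_lin -[z in RHS]hsubmxK mul_row_block !mulmx0 mulmx1 addr0 add0r.
by [].
Qed.

Lemma Bgraph_image x y (g : 'I_n -> 'I_n) (a : 'M[R]_d) : bijective g ->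
  (forall i, v i *m a = v (g i)) ->
  (forall J, facet_index v J <-> facet_index v (g @: J)%SET) ->
  y 0 ord0 = x 0 ord0 -> (forall i, ht y (g i) = ht x i) ->
  Bgraph v y = [set lift_lin a z | z in Bgraph v x].
Proof.
move=> [h hg gh] va gJ y0 yg; have gI := can_inj hg.
have ptE k : bpt v x k *m block_mx a 0 0 1%:M = bpt v y (omap g k).
  case: k => [i|]; rewrite -lift_linE /lift_lin lsub_height /= /at_height row_mxKr.
    by rewrite va yg.
  by rewrite mul0mx y0.
have imJ (J : {set 'I_n}) : [set z *m block_mx a 0 0 1%:M | z in hull (bpt v x) (apex_set J)] =
    hull (bpt v y) (apex_set (g @: J)%SET).
  rewrite hull_image.
  have -> : (fun k => bpt v x k *m block_mx a 0 0 1%:M) = bpt v y \o omap g.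
    by apply/funext => k; exact: ptE.
  have oI : injective (omap g) by move=> [i|] [j|] //= [] /gI ->.
  rewrite -hull_imset //; congr hull; apply/setP => -[j|]; last first.
    by rewrite None_apex; apply/imsetP; exists None; rewrite ?None_apex.
  rewrite Some_apex; apply/imsetP/imsetP => [[[i|]]//|[i iJ ->]].
    by rewrite Some_apex => iJ [->]; exists i.
  by exists (Some i); rewrite ?Some_apex.
rewrite !BgraphE; apply/seteqP; split=> [z [J fJ zJ]|_ [z [J fJ zJ] <-]].
  have JE : J = (g @: (h @: J))%SET.
    by rewrite -imset_comp (eq_imset (g := id)) ?imset_id // => i /=; exact: gh.
  rewrite JE -imJ in zJ; have [z' z'J zE] := zJ.
  exists z'; last by rewrite lift_linE.
  by exists (h @: J)%SET => //; apply/gJ; rewrite -JE.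
exists (g @: J)%SET; first exact: (gJ J).1.
by rewrite -imJ lift_linE; exists z.
Qed.

Lemma aut_vertices (a : 'M[R]_d) : Aut v a -> exists g : 'I_n -> 'I_n, bijective g /\ forall i, v i *m a = v (g i).
Proof.
move=> [au aP].
have hg i : exists j, v i *m a = v j.
  have : range v (v i *m a); last by move=> [j _ <-]; exists j.
  rewrite -(fano_vertices d_gt0 fan).
  have : vertices (vpoly v) (v i) by rewrite (fano_vertices d_gt0 fan); exists i.
  move=> [u [b [hu E]]]; exists (invmx a *m u), b.
  have dE (z : 'rV[R]_d) : dot (z *m a) (invmx a *m u) = dot z u.
    by rewrite mulmxA -[z *m a *m _]mulmxA mulmxV // mulmx1.
  rewrite -[conv (range v)]aP; split=> [_ [z zP <-]|]; first by rewrite dE; apply: hu.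
  apply/seteqP; split=> [_ ->|_ [[z zP <-]]].
    have : [set v i] (v i) by []. rewrite {1}E => -[viP vib].
    by split; [exists (v i)|rewrite dE].
  by rewrite dE => zb; have : [set v i] z by [rewrite E]; move=> ->.
have [g gE] := choice hg; exists g; split=> //.
apply: injF_bij => i j e; apply: (fano_inj fan).
by rewrite -[v i](mulmxK au) -[v j](mulmxK au) !gE e.
Qed.

Lemma facet_linear (g h : 'I_n -> 'I_n) (a b : 'M[R]_d) (J : {set 'I_n}) :
  cancel g h -> cancel h g -> a *m b = 1%:M -> (forall i, v i *m a = v (g i)) ->
  facet_index v J -> facet_index v (g @: J)%SET.
Proof.
move=> hg gh ab va /(facet_indexP wl sf)[u u1 [u2 [e de]]].
have ba := mulmx1C ab.
have vb i : v i *m b = v (h i) by rewrite -{1}[i]gh -va -mulmxA ab mulmx1.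
have gJ j : (j \in (g @: J)%SET) = (h j \in J).
  by rewrite -{1}[j]gh (finset.mem_imset _ _ (can_inj hg)).
apply/(facet_indexP wl sf); exists (b *m u) => [j|].
  by rewrite gJ mulmxA vb; apply: u1.
split=> [j|]; first by rewrite gJ mulmxA vb; apply: u2.
exists (fun j => b *m e (h j)); split=> [y|j l].
  rewrite -[LHS]mulmx1 -ba mulmxA {1}[y *m b](de.1) mulmx_suml.
  rewrite big_imset /=; last by move=> i j _ _; exact: (can_inj hg).
  by apply: eq_bigr => i _; rewrite -scalemxAl va hg mulmxA.
rewrite !gJ => jJ lJ; rewrite mulmxA vb de.2 //.
by rewrite (can_eq gh).
Qed.

(** Applying [rho] adds a linear function [l] to the permuted heights, so an automorphism followed
    by this shear is a linear isomorphism of cones. Conversely an isomorphism has this shape, and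
    the vanishing of [z] on the first facet forces the shear to be that of [rho]. *)
Lemma aut_orbit_iso x z : SF0 v x -> Zlat x -> aut_orbit v x z <->
  [/\ SF0 v z, Zlat z & lattice_iso (Ccone v x) (Ccone v z)].
Proof.
move=> xSF xZ; have [x0 xd xsc] := (SF0P d_gt0 wl sf x).1 xSF.
have cfx := cone_fan_lift d_gt0 wl sf x0 xZ xsc.
have f0 : facet_index v [set i : 'I_n | (i < d)%N]%SET := facet_index0 wl sf.
have [_ [e de eZ]] := fano_uni fan f0.
have sumd (V : lmodType R) (c : 'I_n -> R) (F : 'I_n -> V) :
    \sum_(i in [set i : 'I_n | (i < d)%N]%SET) c i *: F i = \sum_(i < n | (i < d)%N) c i *: F i.
  by apply: eq_bigl => i; rewrite inE.
split=> [[a [y [aut [[ySF [y0 yge]] yB] [z0 zd zk]]]]|[zSF zZ iso]].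
  have [g [gbij va]] := aut_vertices aut; have [h hg gh] := gbij.
  have [b ab [vb [U _ aU]]] := fano_fan_linear fan fan gbij va.
  have yg i : ht y (g i) = ht x i.
    have : Bgraph v x (at_height (v i) (ht x i)) by apply/Bgraph_vertex.
    move=> xB; have : Bgraph v y (lift_lin a (at_height (v i) (ht x i))).
      by rewrite yB; exists (at_height (v i) (ht x i)).
    rewrite /lift_lin lsub_height va /at_height row_mxKr => yB'.
    by have := (Bgraph_vertex y (g i) (ht x i)).1 yB' => ->.
  pose l : 'cV[R]_d := \sum_(i in [set i : 'I_n | (i < d)%N]%SET) (- ht y i) *: e i.
  have lE i : i \in [set i : 'I_n | (i < d)%N]%SET -> dot (v i) l = - ht y i.
    exact: (dual_functional de (fun i => - ht y i)).
  have zE k : ht z k = ht y k + dot (v k) l.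
    have [kd|dk] := ltnP k d; first by rewrite zd // lE ?inE // subrr.
    have [c [vc ->]] := zk k dk.
    rewrite vc dot_suml -sumrN; congr (_ + _); apply: eq_bigr => i id.
    by rewrite dotZl lE ?inE // mulrN.
  have ysc := SF_sconvex d_gt0 wl sf ySF y0.
  have zsc : sconvex v z.
    move=> J /ysc[f f1 f2]; exists (f + l) => i iJ; rewrite dotDr zE.
      by rewrite f1.
    by rewrite ltrD2r f2.
  have xi i : x 0 i \is a Num.int by move/ZlatP: xZ.
  have yZ i : ht y i \is a Num.int by rewrite -[i]gh yg.
  have zZ : Zlat z.
    apply/ZlatP => i; case: (unliftP ord0 i) => [j ->|->]; last by rewrite z0 rpred0.
    rewrite zE rpredD // dot_sumr rpred_sum // => k kJ.
    by rewrite dotZr rpredM ?rpredN // eZ //; apply: (fano_Zlat fan).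
  split=> //; first by apply/(SF0P d_gt0 wl sf).
  have cfz := cone_fan_lift d_gt0 wl sf z0 zZ zsc.
  have FE (p : 'rV[R]_d) (t : R) : at_height p t *m block_mx a (a *m l) 0 1%:M =
      at_height (p *m a) (dot p (a *m l) + t).
    rewrite /at_height mul_row_block mulmx0 addr0 mulmx1; congr row_mx.
    by apply/rowP => j; rewrite ord1 mxE [RHS]mxE [X in _ + X]mxE.
  apply: (lattice_iso_of_linear cfx cfz (omap_bij gbij) (F := block_mx a (a *m l) 0 1%:M)).
    case=> [i|] /=; rewrite FE; last by rewrite !dot0l mul0mx add0r.
    by rewrite va mulmxA va zE yg addrCA [dot _ l + _]addrC.
  move=> p; rewrite [p]heightE FE => E.
  have E1 := congr1 lsubmx E; have E2 := congr1 (fun M => rsubmx M 0 0) E.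
  rewrite /= lsub_height linear0 in E1; rewrite /= rsub_height linear0 [RHS]mxE in E2.
  have p0 : lsubmx p = 0 by rewrite -[LHS]mulmx1 -ab mulmxA E1 mul0mx.
  rewrite p0 dot0l add0r in E2; rewrite p0 E2.
  by apply/rowP => j; rewrite /at_height !mxE; case: (fintype.split j) => k; rewrite mxE.
have [z0 zd zsc] := (SF0P d_gt0 wl sf z).1 zSF.
have cfz := cone_fan_lift d_gt0 wl sf z0 zZ zsc.
have [g [a [l [gbij va zg gJ]]]] := lift_iso_data cfx cfz fan iso.
have [h hg gh] := gbij.
have [b ab [vb [U Uu aU]]] := fano_fan_linear fan fan gbij va.
have gJ' J : facet_index v J <-> facet_index v (g @: J)%SET.
  split=> [|fJ]; first exact: gJ.
  have ba := mulmx1C ab; have vb' i : v i *m b = v (h i) by rewrite -{1}[i]gh vb.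
  have := facet_linear gh hg ba vb' fJ.
  by rewrite -imset_comp (eq_imset (g := id)) ?imset_id // => i /=; exact: hg.
pose y : 'rV[R]_n.+1 := \row_j if unlift ord0 j is Some i then ht x (h i) else 0.
have yS i : ht y i = ht x (h i) by rewrite mxE liftK.
have y0 : y 0 ord0 = 0 by rewrite mxE unlift_none.
have yg i : ht y (g i) = ht x i by rewrite yS hg.
exists a, y; split.
- split; last exact: vpoly_image gbij va.
  exact: (mulmx1_unit ab).1.
- split; last by apply: Bgraph_image gbij va gJ' _ yg; rewrite y0 x0.
  split; last first.
    split=> // i; rewrite yS; have [id|di] := ltnP (h i) d; first by rewrite xd.
    by case: xSF => _ [_ _]; apply.
  suff ysc : sconvex v y by exact: (sconvex_SF wl sf y0 ysc).
  move=> J fJ.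
  have JE : J = (g @: (h @: J))%SET.
    by rewrite -imset_comp (eq_imset (g := id)) ?imset_id // => i /=; exact: gh.
  have /xsc[f f1 f2] : facet_index v (h @: J)%SET by apply/gJ'; rewrite -JE.
  have hJ i : (i \in J) = (h i \in (h @: J)%SET).
    by rewrite (finset.mem_imset _ _ (can_inj gh)).
  have vb' i : v i *m b = v (h i) by rewrite -{1}[i]gh vb.
  by exists (b *m f) => i; rewrite hJ mulmxA vb' yS; [apply: f1|apply: f2].
- have zE k : ht z k = ht y k + dot (v k) (b *m l).
    by rewrite -[k]gh zg yg mulmxA vb.
  split=> // k dk; exists (fun i => dot (v k) (e i)); split.
    by rewrite -sumd -(de.1).
  rewrite zE; congr (_ + _); rewrite {1}[v k](de.1) dot_suml -sumrN.
  apply: eq_big => [i|i]; first by rewrite inE.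
  rewrite inE => id; rewrite dotZl -mulrN; congr (_ * _).
  by have := zE i; rewrite zd // => /esym/eqP; rewrite addrC addr_eq0 => /eqP.
Qed.

End Orbit.

End LiftIso.

(** * The complex of a reduced conic realization *)

Lemma hull_affine (R : realType) (m n : nat) (K : finType) (w : K -> 'rV[R]_m) (S : {set K})
    (A : 'M[R]_(m, n)) (b : 'rV[R]_n) f (a : K -> R) :
  (forall x, hull w S x -> f x = x *m A + b) -> (forall k, 0 <= a k) ->
  \sum_(k in S) a k = 1 ->
  f (\sum_(k in S) a k *: w k) = \sum_(k in S) a k *: f (w k).
Proof.
move=> fA a0 a1; rewrite fA; last by exists a.
rewrite -[b in LHS]scale1r -a1 scaler_suml mulmx_suml -big_split /=.
apply: eq_bigr => k kS; rewrite -scalemxAl -scalerDr fA //; exact: hull_mem.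
Qed.

Section Vertices.
Context {R : realType} {m : nat} {K : finType}.
Implicit Types (s : {set K}) (p : K -> 'rV[R]_m).

(** Injectivity of the map on the geometric realization that is affine on simplices and sends the
    vertices to the points [p k]. *)
Definition embeds p (Delta : {set {set K}}) : Prop :=
  forall s s' (a a' : K -> R), s \in Delta -> s' \in Delta ->
    (forall k, 0 <= a k) -> (forall k, 0 <= a' k) ->
    \sum_(k in s) a k = 1 -> \sum_(k in s') a' k = 1 ->
    \sum_(k in s) a k *: p k = \sum_(k in s') a' k *: p k ->
    forall k, (if k \in s then a k else 0) = (if k \in s' then a' k else 0).

Lemma embeds_subset p (Delta : {set {set K}}) s s' : embeds p Delta -> s \in Delta ->
  s' \in Delta -> hull p s `<=` hull p s' -> s \subset s'.
Proof.
move=> emb sD s'D sub; apply/fintype.subsetP => k ks.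
have [a [a0 a1 E]] := sub _ (hull_mem p ks).
have := emb s s' (fun l => (l == k)%:R) a sD s'D _ a0 (sum_indicator1 ks) a1 _ k.
rewrite sum_indicator // ks eqxx => /(_ _ E); case: ifP => // _ h.
by have /eqP := h (fun l => ler0n _ _); rewrite oner_eq0.
Qed.

(** Affine independence: a small multiple of the relation, added to the barycentre weights, gives
    the same point with other nonnegative weights. *)
Lemma embeds_indep p (Delta : {set {set K}}) s (c : K -> R) : embeds p Delta -> s \in Delta ->
  \sum_(k in s) c k = 0 -> \sum_(k in s) c k *: p k = 0 -> forall k, k \in s -> c k = 0.
Proof.
move=> emb sD c0 cp k ks.
have card_gt0 : (0 < #|s|)%N by rewrite card_gt0; apply/set0Pn; exists k.
pose b : R := #|s|%:R^-1.
have b_gt0 : 0 < b by rewrite invr_gt0 ltr0n.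
have sum_b : \sum_(k in s) b = 1.
  by rewrite sumr_const -mulr_natr mulVf // pnatr_eq0 -lt0n.
have [e e_gt0 he] := @exists_small R K predT (fun=> b) (fun k => - c k) (fun _ _ => b_gt0).
pose a l := Num.max (b + e * c l) 0.
have aE l : a l = b + e * c l.
  apply: max_idPl; have := ltW (he l isT).
  by rewrite mulrN lerNl -subr_ge0 opprK addrC.
have a0 l : 0 <= a l by rewrite le_max lexx orbT.
have a1 : \sum_(k in s) a k = 1.
  by rewrite (eq_bigr _ (fun l _ => aE l)) big_split /= sum_b -mulr_sumr c0 mulr0 addr0.
have ap : \sum_(k in s) a k *: p k = \sum_(k in s) b *: p k.
  under eq_bigr do rewrite aE scalerDl -scalerA.
  by rewrite big_split /= -!scaler_sumr cp scaler0 addr0.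
have := emb s s a (fun=> b) sD sD a0 (fun=> ltW b_gt0) a1 sum_b ap k.
rewrite ks aE -[RHS]addr0 => /addrI/eqP.
by rewrite mulf_eq0 gt_eqF //= => /eqP.
Qed.

(** Replaces an abstract isomorphism by the images [p] of the vertices. The last clause is what
    remains of the compatibility with affine lattices. *)
Lemma realization_vertices (Delta : {set {set K}}) (C : set 'rV[R]_m) :
  simplicial_complex Delta -> complex_iso (realization R Delta) (bottom_complex C) ->
  exists p, [/\ embeds p Delta,
    forall G, bottom_complex C G <-> exists s, [/\ s \in Delta, s != finset.set0 & G = hull p s],
    forall k, Zlat (p k) &
    forall s y (c : K -> R), s \in Delta -> Zlat y -> \sum_(k in s) c k = 1 ->
      y = \sum_(k in s) c k *: p k -> forall k, k \in s -> c k \is a Num.int].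
Proof.
move=> [D0 Dsub D1] [f [[ff fi fs] fK fA]].
pose dl (t : K) : 'rV[R]_#|K| := delta_mx 0 (enum_rank t).
have stdE s : @std_simplex R K s = hull dl s := std_simplexE s.
have coord s (a : K -> R) t :
    (\sum_(t in s) a t *: dl t) 0 (enum_rank t) = if t \in s then a t else 0.
  exact: delta_coord.
pose p t := f (dl t).
have cell s : s \in Delta -> s != finset.set0 -> realization R Delta (hull dl s).
  by move=> sD s0; exists s; rewrite ?stdE //= sD.
have ne s (a : K -> R) : \sum_(k in s) a k = 1 -> s != finset.set0.
  by move=> a1; apply: contraPneq a1 => ->; rewrite big_set0 => /esym/eqP; rewrite oner_eq0.
have fE s (a : K -> R) : s \in Delta -> (forall k, 0 <= a k) -> \sum_(k in s) a k = 1 ->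
    f (\sum_(k in s) a k *: dl k) = \sum_(k in s) a k *: p k.
  move=> sD a0 a1; have [A [b [hA _]]] := fA _ (cell s sD (ne _ _ a1)).
  exact: hull_affine hA a0 a1.
have fhull s : s \in Delta -> [set f x | x in hull dl s] = hull p s.
  move=> sD; apply/seteqP; split=> [_ [_ [a [a0 a1 ->]] <-]|_ [a [a0 a1 ->]]].
    by exists a; split=> //; rewrite fE.
  by exists (\sum_(k in s) a k *: dl k); [exists a|rewrite fE].
have emb : embeds p Delta.
  move=> s s' a a' sD s'D a0 a'0 a1 a'1 E k; rewrite -!coord.
  have supp r (b : K -> R) : r \in Delta -> (forall k, 0 <= b k) -> \sum_(k in r) b k = 1 ->
      \sum_(k in r) b k *: dl k \in support (realization R Delta).
    by move=> rD b0 b1; rewrite inE; exists (hull dl r); [exact: cell (ne _ _ b1)|exists b].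
  by rewrite (fi _ _ (supp s a sD a0 a1) (supp s' a' s'D a'0 a'1)) // !fE.
have set1_ne (k : K) : [set k]%SET != finset.set0 by apply/set0Pn; exists k; rewrite inE.
exists p; split=> //.
- move=> G; rewrite -fK; split=> [[_ [s /andP[sD s0] <-] <-]|[s [sD s0 ->]]].
    by exists s; rewrite stdE fhull.
  by exists (hull dl s); [exact: cell|rewrite fhull].
- move=> k; have [A [b [hA EA]]] := fA _ (cell _ (D1 k) (set1_ne k)).
  suff : (aff (f @` hull dl [set k]%SET) `&` Zlat) (p k) by case.
  have hk : hull dl [set k]%SET (dl k) by apply: hull_mem; rewrite inE.
  rewrite -EA /p (hA _ hk); exists (dl k) => //; split; last exact: Zlat_delta.
  exact: sub_gen_smallest.
- move=> s y c sD yZ c1 yE k ks; have s0 := ne _ _ c1.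
  have [A [b [hA EA]]] := fA _ (cell _ sD s0).
  have : (aff (f @` hull dl s) `&` Zlat) y by split; rewrite // fhull // aff_hull //; exists c.
  rewrite -EA aff_hull // => -[x [[a a1 xE] xZ] xy].
  have yE' : y = \sum_(k in s) a k *: p k.
    rewrite -xy xE -[b]scale1r -a1 scaler_suml mulmx_suml -big_split /=.
    apply: eq_bigr => l ls; rewrite -scalemxAl -scalerDr -hA //; exact: hull_mem.
  have -> : c k = a k.
    apply/eqP; rewrite -subr_eq0; apply/eqP.
    apply: (embeds_indep (c := fun k => c k - a k) emb sD) ks; first by rewrite sumrB c1 a1 subrr.
    by under eq_bigr do rewrite scalerBl; rewrite sumrB -yE -yE' subrr.
  by move/ZlatP/(_ (enum_rank k)): xZ; rewrite xE coord ks.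
Qed.

End Vertices.

(** * Regular reduced conic realizations *)

Lemma line_quotient (F : fieldType) (d : nat) (O : 'rV[F]_(d + 1)) : O != 0 ->
  exists2 M : 'M[F]_(d + 1, d), O *m M = 0 &
  forall y : 'rV[F]_(d + 1), y *m M = 0 -> exists a, y = a *: O.
Proof.
move=> O0; have rk : \rank (cokermx O) = d by rewrite mxrank_coker rank_rV O0 addnK.
(* The dimension is made a variable, so that the rank can be rewritten to [d] in the types. *)
pose P r := exists2 M : 'M[F]_(d + 1, r), O *m M = 0 &
  forall y : 'rV[F]_(d + 1), y *m M = 0 -> exists a, y = a *: O.
suff : P (\rank (cokermx O)) by rewrite rk.
exists (col_base (cokermx O)) => [|y y0].
  apply: (row_free_injr (row_base_free (cokermx O))).
  by rewrite /mulmxr -mulmxA mulmx_base mulmx_coker mul0mx.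
by apply/sub_rVP; rewrite submxE -(mulmx_base (cokermx O)) mulmxA y0 mul0mx.
Qed.

Lemma nbhs0_scale (R : realType) (m : nat) (S : set 'rV[R]_m) y :
  nbhs (0 : 'rV[R]_m) S -> exists2 a : R, 0 < a & S (a *: y).
Proof.
move=> /nbhs_ballP[r /= r0 hr]; have y1 : 0 < 1 + `|y| by rewrite ltr_wpDr.
exists (r / (1 + `|y|)); first by rewrite divr_gt0.
apply: hr; rewrite -ball_normE /= sub0r normrN normrZ gtr0_norm ?divr_gt0 //.
by rewrite mulrAC ltr_pdivrMr // ltr_pM2l // ltrDr.
Qed.

Lemma span_indep_dual (R : realType) (m : nat) (K : finType) (w : K -> 'rV[R]_m) (S : {set K}) :
  (forall y, exists c : K -> R, y = \sum_(k in S) c k *: w k) ->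
  (forall c : K -> R, \sum_(k in S) c k *: w k = 0 -> forall k, k \in S -> c k = 0) ->
  exists e, dual w S e.
Proof.
move=> span indep.
have [c cE] := choice (fun i : 'I_m => span (delta_mx 0 i)).
pose e k : 'cV[R]_m := \col_i c i k.
have eE y k : dot y (e k) = \sum_i y 0 i * c i k.
  by rewrite mxE; apply: eq_bigr => i _; rewrite mxE.
have ext y : y = \sum_(k in S) dot y (e k) *: w k.
  rewrite {1}[y]rowE_delta; under eq_bigr do rewrite cE scaler_sumr.
  rewrite exchange_big /=; apply: eq_bigr => k kS; rewrite eE scaler_suml.
  by apply: eq_bigr => i _; rewrite scalerA.
exists e; split=> // k l kS lS; apply/eqP; rewrite -subr_eq0; apply/eqP.
apply: (indep (fun l => dot (w k) (e l) - (k == l)%:R)) lS.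
under eq_bigr do rewrite scalerBl eq_sym.
by rewrite sumrB -ext sum_indicator // subrr.
Qed.

Lemma dual_replace (R : realType) (m : nat) (K : finType) (w w' : K -> 'rV[R]_m)
    (J : {set K}) (e : K -> 'cV[R]_m) (k : K) : dual w J e -> k \in J ->
  dot (w' k) (e k) != 0 -> (forall l, l != k -> w' l = w l) -> exists e', dual w' J e'.
Proof.
move=> de kJ ak ww'; apply: span_indep_dual => [y|c c0].
  pose b := dot y (e k) / dot (w' k) (e k).
  exists (fun l => if l == k then b else dot y (e l) - b * dot (w' k) (e l)).
  have bE : b * dot (w' k) (e k) = dot y (e k) by rewrite divfK.
  rewrite (bigD1 k) //= eqxx.
  under eq_bigr => l /andP[_ lk] do rewrite (negPf lk) (ww' _ lk) scalerBl -scalerA.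
  rewrite sumrB -scaler_sumr addrCA -scalerBr.
  have sumE x : \sum_(l in J | l != k) dot x (e l) *: w l = x - dot x (e k) *: w k.
    apply/eqP; rewrite eq_sym subr_eq addrC; apply/eqP.
    by have E := de.1 x; rewrite (bigD1 k) //= in E.
  by rewrite !sumE opprB [w' k + _]addrCA subrr addr0 scalerA bE subrK.
have wE l : l \in J -> l != k -> c k * dot (w' k) (e l) + c l = 0.
  move=> lJ lk; have := congr1 (fun y => dot y (e l)) c0; rewrite /= dot0l (bigD1 k) //= dotDl dotZl.
  rewrite dot_suml (bigD1 l) ?lJ //= big1 => [|l' /andP[/andP[l'J l'k] l'l]].
    by rewrite addr0 dotZl (ww' l lk) de.2 // eqxx mulr1.
  by rewrite dotZl (ww' l' l'k) de.2 // (negPf l'l) mulr0.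
have ck : c k = 0.
  have := congr1 (fun y => dot y (e k)) c0; rewrite /= dot0l (bigD1 k) //= dotDl dotZl.
  rewrite dot_suml big1 => [|l /andP[lJ lk]].
    by rewrite addr0 => /eqP; rewrite mulf_eq0 (negPf ak) orbF => /eqP.
  by rewrite dotZl (ww' l lk) de.2 // (negPf lk) mulr0.
move=> l lJ; have [->//|lk] := eqVneq l k.
by have := wE l lJ lk; rewrite ck mul0r add0r.
Qed.

Lemma compact_conv_lattice (R : realType) (m : nat) (S : set 'rV[R]_m) (b : R) :
  S `<=` Zlat -> (forall x j, S x -> `|x 0 j| <= b) -> compact (conv S).
Proof.
move=> SZ Sb; pose N := Num.bound b.
pose w (c : {ffun 'I_m -> 'I_(N + N).+1}) : 'rV[R]_m := \row_j ((c j)%:R - N%:R).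
have -> : S = [set w c | c in [set` [set c | `[< S (w c) >]]%SET]].
  apply/seteqP; split=> [x Sx|_ [c + <-]]; last by rewrite /= inE => /asboolP.
  have hc j : exists c : 'I_(N + N).+1, x 0 j = c%:R - N%:R.
    have xj : `|x 0 j| < N%:R.
      exact: le_lt_trans (Sb x j Sx) (unstable.ltr_bound _).
    have : x 0 j + N%:R \is a Num.int.
      by rewrite rpredD ?rpred_nat //; move/ZlatP: (SZ _ Sx).
    move=> /int_nat[|c cE]; first by move: xj; rewrite ltr_norml => /andP[h _]; lra.
    have cN : (c < (N + N).+1)%N.
      rewrite ltnS -(ler_nat R) -cE natrD lerD2r.
      by move: xj; rewrite ltr_norml => /andP[_ /ltW].
    by exists (Ordinal cN); rewrite /= -cE addrK.
  have [c cE] := choice hc.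
  have xE : w [ffun j => c j] = x by apply/rowP => j; rewrite mxE ffunE -cE.
  by exists [ffun j => c j]; rewrite //= inE xE; apply/asboolP.
by rewrite conv_fin; exact: hull_compact.
Qed.

(* Pairs [(m x, j x)] with a ratio at most that of [x0] are bounded by
   [(m x0, j x0)]. *)
Lemma min_ratio (R : realType) (X : Type) (P : X -> Prop) (m j : X -> R) x0 : P x0 ->
  (forall x, P x -> exists k l : nat, m x = k.+1%:R /\ j x = l.+1%:R) ->
  (forall x, P x -> m x0 * j x <= m x * j x0) ->
  exists2 x1, P x1 & forall x, P x -> (m x1 - 1) / j x1 <= (m x - 1) / j x.
Proof.
move=> P0 hnat hle; have [k0 [l0 [m0 j0]]] := hnat x0 P0.
pose r (c : 'I_k0.+1 * 'I_l0.+1) : R := c.1%:R / c.2.+1%:R.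
have [|[k1 l1] [x1 Px1 [m1 j1]] max1] := @exists_max R ('I_k0.+1 * 'I_l0.+1)%type
    (fun c => exists2 x, P x & m x = c.1.+1%:R /\ j x = c.2.+1%:R) (fun c => - r c).
  by exists (ord_max, ord_max), x0.
have rE x (k l : nat) : m x = k.+1%:R -> j x = l.+1%:R -> (m x - 1) / j x = k%:R / l.+1%:R.
  by move=> -> ->; rewrite -natr1 addrK.
exists x1 => // x Px; have [k [l [mx jx]]] := hnat x Px.
have pos n : 0 < n.+1%:R :> R by rewrite ltr0n.
have le0 : (m x1 - 1) / j x1 <= k0%:R / l0.+1%:R.
  rewrite (rE _ _ _ m1 j1).
  have := max1 (ord_max, ord_max); rewrite lerN2; apply; by exists x0.
have [lt|ge] := ltP (k0%:R / l0.+1%:R) ((m x - 1) / j x); first exact: le_trans le0 (ltW lt).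
have h1 := hle x Px; rewrite m0 mx j0 jx -!natrM ler_nat in h1.
rewrite (rE _ _ _ mx jx) ler_pdivrMr // mulrAC ler_pdivlMr // -!natrM ler_nat in ge.
have ll0 : (l < l0.+1)%N by nia.
have kk0 : (k < k0.+1)%N by nia.
rewrite (rE _ _ _ m1 j1) (rE _ _ _ mx jx).
by have := max1 (Ordinal kk0, Ordinal ll0); rewrite lerN2; apply; exists x.
Qed.

Lemma simplicial_complex_pyramid (T : finType) (Sigma : {set {set T}}) :
  simplicial_complex Sigma -> simplicial_complex (pyramid Sigma).
Proof.
move=> [S0 Ssub S1]; split.
- rewrite inE; apply/existsP; exists finset.set0; rewrite S0.
  by apply/fintype.subsetP => x; rewrite inE.
- move=> s t /[!inE] /existsP[r /andP[rS sr]] ts; apply/existsP; exists r.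
  by rewrite rS (fintype.subset_trans ts).
- move=> [x|]; rewrite inE; apply/existsP.
    exists [set x]%SET; rewrite S1; apply/fintype.subsetP => y /[!inE] /eqP ->.
    by rewrite /= (finset.mem_imset _ _ (@some_inj T)) inE.
  exists finset.set0; rewrite S0; apply/fintype.subsetP => y /[!inE] /eqP ->.
  by [].
Qed.

Section Pyramid.
Context {T : finType} (Sigma : {set {set T}}).
Hypothesis scS : simplicial_complex Sigma.

Lemma apex_pyramid t : (apex_set t \in pyramid Sigma) = (t \in Sigma).
Proof.
have [_ Ssub _] := scS; rewrite inE; apply/existsP/idP => [[r /andP[rS tr]]|tS]; last first.
  by exists t; rewrite tS /apex_set fintype.subxx.
apply: Ssub rS _; apply/fintype.subsetP => x xt.
by rewrite -Some_apex; apply: (fintype.subsetP tr); rewrite Some_apex.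
Qed.

Lemma pyramid_apex s : s \in pyramid Sigma -> exists2 t, t \in Sigma & s \subset apex_set t.
Proof. by rewrite inE => /existsP[t /andP[tS st]]; exists t. Qed.

Lemma apex_subset (s t : {set T}) : (apex_set s \subset apex_set t) = (s \subset t).
Proof.
apply/fintype.subsetP/fintype.subsetP => h; last first.
  by case=> [x|]; rewrite ?None_apex // !Some_apex; exact: h.
by move=> x xs; have := h (Some x); rewrite !Some_apex; exact.
Qed.

End Pyramid.

Section Regular.
Context {R : realType} {T : finType} {d : nat}.
Variables (Sigma : {set {set T}}) (C : set 'rV[R]_(d + 1)) (O : 'rV[R]_(d + 1)).
Variable p : option T -> 'rV[R]_(d + 1).
Hypotheses (d_gt0 : (0 < d)%N) (scS : simplicial_complex Sigma) (coneC : is_cone C).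
Hypotheses (emb : embeds p (pyramid Sigma)) (pZ : forall k, Zlat (p k)).
Hypothesis cells : forall G, bottom_complex C G <->
  exists s, [/\ s \in pyramid Sigma, s != finset.set0 & G = hull p s].
Hypothesis pInt : forall s y (c : option T -> R), s \in pyramid Sigma -> Zlat y ->
  \sum_(k in s) c k = 1 -> y = \sum_(k in s) c k *: p k -> forall k, k \in s -> c k \is a Num.int.
Hypothesis hilb : forall F, bottom_facets C F -> Hilb (pos_hull F) `<=` F.
Hypothesis intO : interior_vertex d C O.
Hypothesis faces : forall G, bottom_complex C G -> ~ G O ->
  is_face (prism (bottom C) O) (prism G O).
Local Notation A := ((C `&` Zlat) `\ 0).
Local Notation Q := (conv A).
Implicit Types (F G : set 'rV[R]_(d + 1)) (y : 'rV[R]_(d + 1)).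

Let emb_sub (s s' : {set option T}) : s \in pyramid Sigma -> s' \in pyramid Sigma ->
  hull p s `<=` hull p s' -> s \subset s'.
Proof. exact: embeds_subset emb. Qed.

Let facet_sub F : bottom_facets C F -> F `<=` Q.
Proof. by move=> [[Ff _ _] _]; exact: is_face_sub Ff. Qed.

Let bottom_sub y : bottom C y -> Q y.
Proof. by move=> [F bF Fy]; exact: facet_sub bF _ Fy. Qed.

Let facet_ne F : bottom_facets C F -> F !=set0.
Proof.
move=> [[Ff FQ Fmax] Fc]; have [[_ [F' [[F'f F'Q _] _] F'O]] _] := intO.
apply/set0P/negP => /eqP F0.
have OF' : F' O by apply: (is_face_sub F'O).
have [] := Fmax F' F'f; first by rewrite F0.
  by move=> E; rewrite E F0 in OF'.
by [].
Qed.

Let facet_cell F : bottom_facets C F -> bottom_complex C F.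
Proof. by move=> bF; split; [exact: facet_ne|exists F; [|exact: is_face_refl]]. Qed.

Let cell_bottom G : bottom_complex C G -> G `<=` bottom C.
Proof. by move=> [_ [F bF GF]] y Gy; exists F; [|exact: is_face_sub GF _ Gy]. Qed.

Let p_bottom (s : {set option T}) y : s \in pyramid Sigma -> hull p s y -> bottom C y.
Proof.
move=> sD sy; apply: (cell_bottom (G := hull p s)) => //; apply/cells; exists s; split=> //.
by apply: contraPneq sy => ->; rewrite hull_set0.
Qed.

Let single k : [set k]%SET \in pyramid Sigma.
Proof. by have [_ _] := simplicial_complex_pyramid scS; exact. Qed.

Let bottom_vertex k : bottom C (p k).
Proof. by apply: (p_bottom (single k)); apply: hull_mem; rewrite inE. Qed.

Let O_bottom : bottom C O. Proof. by case: intO => _ []. Qed.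

Let vertex_gen k : A (p k).
Proof.
have : bottom_complex C (hull p [set k]%SET).
  by apply/cells; exists [set k]%SET; split=> //; apply/set0Pn; exists k; rewrite inE.
move=> [_ [F [[Ff _ _] _] GF]].
have [B BA FE] := face_conv Ff; rewrite FE in GF; have [B' B'B GE] := face_conv GF.
have [y yB'] : B' !=set0.
  by apply: conv_nonempty; rewrite -GE; exists (p k); apply: hull_mem; rewrite inE.
suff -> : p k = y by apply/BA/B'B.
have : hull p [set k]%SET y by rewrite GE; exact: sub_conv.
by move=> [a [_]]; rewrite !big_set1 => -> ->; rewrite scale1r.
Qed.

(** The functional of a facet through [z] is at least 1 on the whole hull, in particular at [O], so
    the bottom cannot be met again by moving from [z] in the direction of [- O]. *)
Lemma bottom_mod y (a : R) : bottom C y -> bottom C (y + a *: O) -> a = 0.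
Proof.
have dirO z b : bottom C z -> bottom C (z + b *: O) -> 0 <= b.
  move=> [F bF Fz] /bottom_sub zb; have [V V1 FE] := bottom_facet_functional coneC bF (facet_ne bF).
  have VQ := conv_ge V1; move: Fz; rewrite FE => -[_ Vz].
  have := VQ _ zb; rewrite dotDl Vz dotZl lerDl pmulr_lge0 //.
  exact: lt_le_trans (VQ _ (bottom_sub O_bottom)).
move=> by_ bya; apply/eqP; rewrite eq_le -oppr_ge0 (dirO _ _ by_ bya) andbT.
by apply: (dirO (y + a *: O)); rewrite // scaleNr addrK.
Qed.

Let O_neq0 : O != 0.
Proof.
have [F bF FO] := O_bottom; have [V V1 FE] := bottom_facet_functional coneC bF (facet_ne bF).
move: FO; rewrite FE => -[_]; apply: contra_eqN => /eqP ->.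
by rewrite dot0l eq_sym oner_eq0.
Qed.

(* A chart of the bottom at [O], followed by the projection along [O], is an
   open map by invariance of domain. *)
Lemma prism_absorbs y : exists2 a : R, 0 < a & prism (bottom C) O (a *: y).
Proof.
have [_ [_ [U [W [oU UO oW [f [g [fc gc fW gB [gf fg]]]]]]]]] := intO.
have [M OM kerM] := line_quotient O_neq0.
rewrite (continuous_open_subspace _ oW) in gc.
have fO : W (f O) by apply: fW; exists O.
have gfO : g (f O) = O by apply: gf; split.
have gWB z : W z -> bottom C (g z) by move=> Wz; have [] : (bottom C `&` U) (g z) by apply: gB; exists z.
have : nbhs (g (f O) *m M) ((fun z => g z *m M) @` W).
  apply: (@invariance_of_domain R d W (fun z => g z *m M)) => [|z Wz|z z' /[!inE] Wz Wz' E].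
  - exact: open_nbhs_nbhs.
  - apply: (@continuous_comp _ _ _ g (fun y => y *m M)); last exact: mulmx_continuous.
    by apply: gc; rewrite inE.
  - have [a aE] : exists a, g z - g z' = a *: O by apply: kerM; rewrite mulmxBl E subrr.
    have zE : g z = g z' + a *: O by rewrite -aE addrC subrK.
    have a0 : a = 0 by apply: (bottom_mod (gWB _ Wz')); rewrite -zE; exact: gWB.
    by rewrite -(fg _ Wz) -(fg _ Wz') zE a0 scale0r addr0.
rewrite gfO OM => /(nbhs0_scale (y *m M))[a a0 [z Wz E]]; exists a => //; exists (g z); first exact: gWB.
have [b bE] : exists b, a *: y - g z = b *: O by apply: kerM; rewrite mulmxBl -scalemxAl E subrr.
by exists b; rewrite -bE addrC subrK.
Qed.

Definition apex_facet (s : {set T}) : Prop := s \in Sigma /\ bottom_facets C (hull p (apex_set s)).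

Let apexD (s : {set T}) : apex_facet s -> apex_set s \in pyramid Sigma.
Proof. by move=> [sS _]; rewrite apex_pyramid. Qed.

Lemma apex_facet_cover s : s \in pyramid Sigma -> exists2 t, apex_facet t & s \subset apex_set t.
Proof.
move=> /(pyramid_apex)[t tS st].
have tD : apex_set t \in pyramid Sigma by rewrite apex_pyramid.
have : bottom_complex C (hull p (apex_set t)).
  by apply/cells; exists (apex_set t); split=> //; apply/set0Pn; exists None; rewrite None_apex.
move=> [_ [F bF tF]]; have /cells[s' [s'D _ FE]] := facet_cell bF.
have ts' : apex_set t \subset s' by apply: emb_sub; rewrite // -FE; exact: is_face_sub tF.
have [t' t'S s't'] := pyramid_apex s'D.
have E : s' = apex_set [set x | Some x \in s']%SET.
  apply/setP => -[x|]; first by rewrite Some_apex inE.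
  by rewrite None_apex; apply: (fintype.subsetP ts'); rewrite None_apex.
exists [set x | Some x \in s']%SET; last by rewrite -E (fintype.subset_trans st).
by split; [rewrite -apex_pyramid // -E|rewrite -E -FE].
Qed.

Lemma apex_facetP F : bottom_facets C F -> exists2 s, apex_facet s & F = hull p (apex_set s).
Proof.
move=> bF; have /cells[s [sD s0 FE]] := facet_cell bF.
have [t tf st] := apex_facet_cover sD; exists t => //.
have [[_ FQ Fmax] _] := bF; have [_ [[tF tQ _] _]] := tf.
by have [|->|] := Fmax _ tF; first by rewrite FE; exact: hull_subset.
Qed.

Lemma apex_facet_eq s t : apex_facet s -> apex_facet t -> s \subset t -> s = t.
Proof.
move=> sf tf st; have [_ [[_ _ Fmax] _]] := sf; have [_ [[tF tQ _] _]] := tf.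
have [||//] := Fmax _ tF; first by apply: hull_subset; rewrite apex_subset.
move=> E; apply/eqP; rewrite finset.eqEsubset st -apex_subset.
by apply: emb_sub; rewrite ?apexD // E.
Qed.

(* The point [O] of the bottom is, modulo [R O], in the interior of a segment
   that joins the apex to another point of a simplex. *)
Lemma apexO : p None = O.
Proof.
have [/cells[s [sD s0 OE]] _] := intO.
have pO k : k \in s -> p k = O.
  by move=> ks; have : [set O] (p k) by rewrite OE; exact: hull_mem.
have /set0Pn[[x|] xs] := s0; last exact: pO.
have [a a_gt0 [y [F bF Fy] [b E]]] := prism_absorbs (- p None).
have [t tf FE] := apex_facetP bF; rewrite FE in Fy; have [c [c0 c1 yE]] := Fy.
(* The convex combination of [y] and the apex in the ratio [1 : a] is a multiple of [O] in the
   bottom, hence [O] itself. It has positive weight at the apex, which is impossible if [O] is the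
   vertex [Some x]. *)
pose e := (1 + a)^-1; have a1 : 0 < 1 + a by rewrite ltr_wpDr // ltW.
have e_gt0 : 0 < e by rewrite invr_gt0.
have eE : e + e * a = 1 by rewrite -{1}[e]mulr1 -mulrDr mulVf // gt_eqF.
pose c' (k : option T) : R := e * c k + e * a * (k == None)%:R.
have c'0 k : 0 <= c' k by rewrite addr_ge0 // mulr_ge0 // ?mulr_ge0 // ltW.
have tN : None \in apex_set t by exact: None_apex.
have c'1 : \sum_(k in apex_set t) c' k = 1.
  by rewrite big_split /= -!mulr_sumr c1 sum_indicator1 // !mulr1.
have c'E : \sum_(k in apex_set t) c' k *: p k = - (e * b) *: O.
  under eq_bigr do rewrite scalerDl -2!scalerA.
  rewrite big_split /= -!scaler_sumr -yE sum_indicator // -scalerA -scalerDr scaleNr -scalerA.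
  rewrite -scalerN; congr (_ *: _); apply/eqP; rewrite -subr_eq0 opprK addrAC -E.
  by rewrite scalerN addNr.
have zb : bottom C (\sum_(k in apex_set t) c' k *: p k).
  by apply: p_bottom (apexD tf) _; exists c'.
have EO : \sum_(k in apex_set t) c' k *: p k = \sum_(k in [set Some x]%SET) (fun=> 1) k *: p k.
  have := bottom_mod O_bottom (a := - (e * b) - 1); rewrite scalerBl scale1r addrC subrK -c'E.
  move=> /(_ zb)/eqP; rewrite subr_eq0 => /eqP eb.
  by rewrite big_set1 scale1r pO // c'E eb scale1r.
have := emb (apexD tf) (single (Some x)) c'0 (fun=> ler01) c'1 _ EO None.
rewrite big_set1 tN !inE => /(_ erefl)/eqP; rewrite gt_eqF //.
by rewrite ltr_wpDl ?mulr1 ?mulr_gt0 // mulr_ge0 // ltW.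
Qed.

Let vertex_mem (s : {set option T}) k : s \in pyramid Sigma -> hull p s (p k) -> k \in s.
Proof.
move=> sD sk; rewrite -finset.sub1set; apply: emb_sub (single k) sD _ => y [a [_]].
by rewrite !big_set1 => -> ->; rewrite scale1r.
Qed.

(* The supporting functional of the prism over a face of the link of the apex. *)
Lemma link_functional (s : {set T}) : s \in Sigma -> s != finset.set0 ->
  exists V : 'cV[R]_(d + 1), [/\ dot O V = 0, forall t, t \in s -> dot (p (Some t)) V = 1 &
    forall t, t \notin s -> dot (p (Some t)) V < 1].
Proof.
move=> sS /set0Pn[t0 t0s]; pose S : {set option T} := (Some @: s)%SET.
have SE t : (Some t \in S) = (t \in s) by rewrite (finset.mem_imset _ _ (@some_inj T)).
have SD : S \in pyramid Sigma.
  have [_ psub _] := simplicial_complex_pyramid scS.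
  apply: (psub (apex_set s)); first by rewrite apex_pyramid.
  exact: finset.subsetUr.
have cS : bottom_complex C (hull p S).
  by apply/cells; exists S; split=> //; apply/set0Pn; exists (Some t0); rewrite SE.
have nSO : ~ hull p S O.
  by rewrite -apexO => /(vertex_mem SD) /imsetP[].
have [u [b [hu E]]] := faces cS nSO.
have Sp y a : hull p S y -> dot (y + a *: O) u = b.
  move=> Sy; have : prism (hull p S) O (y + a *: O) by exists y => //; exists a.
  by rewrite E => -[].
have t0S : hull p S (p (Some t0)) by apply: hull_mem; rewrite SE.
have uO : dot O u = 0.
  have := Sp _ 1 t0S; rewrite -(Sp _ 0 t0S) !dotDl !dotZl mul1r mul0r.
  by move=> /addrI.
have Sb y : hull p S y -> dot y u = b by move=> /(Sp y 0); rewrite dotDl dotZl uO mulr0 addr0.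
(* [0 = O - O] lies in the prism, so [b <= 0]; equality would put 0 in the prism over the face, and
   then [O] in the face. *)
have b_lt0 : b < 0.
  have P0 : prism (bottom C) O 0 by exists O => //; exists (-1); rewrite scaleN1r subrr.
  rewrite lt_neqAle; have := hu _ P0; rewrite dot0l => ->; rewrite andbT.
  apply/eqP => b0; have : prism (hull p S) O 0 by rewrite E; split; rewrite // dot0l b0.
  move=> [x Sx [a xE]]; have xO : x = O + (- a - 1) *: O.
    by rewrite scalerBl scale1r addrC subrK scaleNr; apply/eqP; rewrite -addr_eq0 -xE.
  have := bottom_mod O_bottom (a := - a - 1); rewrite -xO => /(_ (p_bottom SD Sx)) a1.
  by apply: nSO; rewrite a1 scale0r addr0 in xO; rewrite -xO.
have VE y : dot y (b^-1 *: u) = dot y u / b by rewrite dotZr mulrC.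
exists (b^-1 *: u); split=> [|t ts|t ts]; rewrite VE.
- by rewrite uO mul0r.
- by rewrite Sb ?divff ?lt_eqF //; apply: hull_mem; rewrite SE.
have Pt : prism (bottom C) O (p (Some t)).
  by exists (p (Some t)); [exact: bottom_vertex|exists 0; rewrite scale0r addr0].
rewrite lt_neqAle ler_ndivrMr // mul1r hu // andbT; apply/eqP => e.
have : prism (hull p S) O (p (Some t)).
  by rewrite E; split=> //; rewrite -[LHS](divfK (x := b)) ?e ?mul1r // lt_eqF.
move=> [x Sx [a xE]]; have a0 : a = 0.
  by apply: bottom_mod (p_bottom SD Sx) _; rewrite -xE.
rewrite a0 scale0r addr0 in xE; rewrite -xE in Sx.
by move: ts; rewrite -SE (vertex_mem SD Sx).
Qed.

Lemma link_cover y : exists (s : {set T}) (c : T -> R) (a : R), [/\ apex_facet s,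
  forall t, 0 <= c t & y = \sum_(t in s) c t *: p (Some t) + a *: O].
Proof.
have [a a0 [x [F bF Fx] [b E]]] := prism_absorbs y.
have [s sf FE] := apex_facetP bF; rewrite FE in Fx; have [c [c0 c1 xE]] := Fx.
exists s, (fun t => a^-1 * c (Some t)), (a^-1 * (c None + b)); split=> //.
  by move=> t; rewrite mulr_ge0 // invr_ge0 ltW.
rewrite -[LHS]scale1r -(mulVf (lt0r_neq0 a0)) -scalerA E xE sum_apex apexO.
under [in RHS]eq_bigr do rewrite -scalerA.
rewrite -scaler_sumr -[in RHS]scalerA -scalerDr scalerDl [in RHS]addrA; congr (_ *: (_ + _)).
exact: addrC.
Qed.

(** If [s] were empty, it would be the only apex facet, and the whole space would be the line of
    [O], against [0 < d]. *)
Lemma apex_facet_neq0 (s : {set T}) : apex_facet s -> s != finset.set0.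
Proof.
move=> sf; apply/eqP => s0; pose i : 'I_(d + 1) := lshift 1 (Ordinal d_gt0).
pose j : 'I_(d + 1) := rshift d ord0.
have line y : exists a, y = a *: O.
  have [t [c [a [tf c0 ->]]]] := link_cover y; exists a.
  have <- : s = t by apply: apex_facet_eq; rewrite // s0 finset.sub0set.
  by rewrite s0 big_set0 add0r.
have [a aE] := line (delta_mx 0 i); have [b bE] := line (delta_mx 0 j).
have ij : (j == i) = false by apply/eqP => /(congr1 val) /=; have := d_gt0; lia.
have := congr1 (fun v : 'rV[R]_(d + 1) => v 0 i) aE; rewrite !mxE !eqxx /= => ai.
have := congr1 (fun v : 'rV[R]_(d + 1) => v 0 j) aE; rewrite !mxE ij /= => /esym/eqP.
have := congr1 (fun v : 'rV[R]_(d + 1) => v 0 j) bE; rewrite !mxE !eqxx /= => bj.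
rewrite mulf_eq0 => /orP[/eqP a0|/eqP Oj].
  by move: ai; rewrite a0 mul0r => /eqP; rewrite oner_eq0.
by move: bj; rewrite Oj mulr0 => /eqP; rewrite oner_eq0.
Qed.

Let apex_functional (s : {set T}) : apex_facet s -> exists V : 'cV[R]_(d + 1),
  [/\ forall y, A y -> 1 <= dot y V, forall k, k \in apex_set s -> dot (p k) V = 1 &
    hull p (apex_set s) = [set y | Q y /\ dot y V = 1]].
Proof.
move=> [sS bF]; have [V V1 FE] := bottom_facet_functional coneC bF (facet_ne bF).
exists V; split=> // k ks; have : hull p (apex_set s) (p k) by exact: hull_mem.
by rewrite FE => -[].
Qed.

(* If a small perturbation of the centroid of [s] were in the cone of another
   [t], the functional of [t] would be larger there than that of [s]. *)
Lemma apex_span (s : {set T}) w : apex_facet s ->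
  exists c : option T -> R, w = \sum_(k in apex_set s) c k *: p k.
Proof.
move=> sf; have hV (t : {set T}) : exists V : 'cV[R]_(d + 1), apex_facet t ->
    [/\ dot O V = 0, forall x, x \in t -> dot (p (Some x)) V = 1 &
     forall x, x \notin t -> dot (p (Some x)) V < 1].
  have [tf|] := pselect (apex_facet t); last by exists 0.
  by have [V VP] := link_functional tf.1 (apex_facet_neq0 tf); exists V.
have [V VP] := choice hV; have [VO V1 V2] := VP s sf.
have V_le (t : {set T}) x : apex_facet t -> dot (p (Some x)) (V t) <= 1.
  by move=> /VP[_ h1 h2]; have [/h1 ->|/h2/ltW] := boolP (x \in t).
pose y0 := \sum_(x in s) p (Some x).
have [|e e0 he] := @exists_small R {set T} (fun t => `[< apex_facet t >] && ~~ (s \subset t))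
    (fun t => dot y0 (V s) - dot y0 (V t)) (fun t => dot w (V t) - dot w (V s)).
  move=> t /andP[/asboolP tf /subsetPn[x xs xt]].
  rewrite !dot_suml -sumrB (bigD1 x) //= V1 // ltr_pwDl //.
    by have [_ _ h] := VP t tf; rewrite subr_gt0 h.
  by apply: sumr_ge0 => z /andP[zs _]; rewrite V1 // subr_ge0 V_le.
have [t [c [a [tf c0 yE]]]] := link_cover (y0 + e *: w).
have dE (r : {set T}) : apex_facet r -> dot (y0 + e *: w) (V r) =
    \sum_(x in t) c x * dot (p (Some x)) (V r).
  move=> /VP[rO _ _]; rewrite yE dotDl dotZl rO mulr0 addr0 dot_suml.
  by apply: eq_bigr => x _; rewrite dotZl.
have st : s \subset t.
  apply: contraT => nst; have := he t; rewrite nst andbT => /(_ (introT (asboolP _) tf)).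
  have : dot (y0 + e *: w) (V s) <= dot (y0 + e *: w) (V t).
    rewrite !dE //; apply: ler_sum => x xt; rewrite ler_wpM2l //.
    by have [_ h _] := VP t tf; rewrite (h x xt) V_le.
  rewrite !dotDl !dotZl mulrBr => h1 h2.
  suff: false by []. lra.
have tE := apex_facet_eq sf tf st; rewrite -tE in yE.
exists (fun k => if k is Some x then e^-1 * (c x - 1) else e^-1 * a).
rewrite sum_apex /= apexO.
transitivity (e^-1 *: (e *: w)); first by rewrite scalerA mulVf ?scale1r ?lt0r_neq0.
have -> : e *: w = \sum_(x in s) c x *: p (Some x) + a *: O - y0 by rewrite -yE addrAC subrr add0r.
under [in RHS]eq_bigr do rewrite -scalerA scalerBl scale1r.
rewrite -scaler_sumr -[in RHS]scalerA -scalerDr sumrB -/y0; congr (_ *: _).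
by rewrite addrAC addrC.
Qed.

Lemma apex_dual (s : {set T}) : apex_facet s -> exists e, dual p (apex_set s) e.
Proof.
move=> sf; apply: span_indep_dual => [w|c c0]; first exact: apex_span.
apply: (embeds_indep emb (apexD sf)) => //.
have [V [_ V1 _]] := apex_functional sf.
have := congr1 (fun y => dot y V) c0; rewrite /= dot0l dot_suml => E.
by rewrite -[RHS]E; apply: eq_bigr => k ks; rewrite dotZl V1 // mulr1.
Qed.

Let apex_cone (s : {set option T}) y : cone_hull p s y -> C y.
Proof.
move=> [a a0 ->]; elim/big_ind: _ => [|x z|k _].
- by have := is_cone_scale coneC (lexx 0) (vertex_gen None).1.1; rewrite scale0r.
- exact: is_cone_add.
- by apply: is_cone_scale => //; exact: (vertex_gen k).1.1.
Qed.

(* Lattice points of the cone are sums of elements of its Hilbert basis, and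
   these are vertices of the unimodular simplex. *)
Lemma apex_unibasis (s : {set T}) : apex_facet s -> unibasis p (apex_set s).
Proof.
move=> sf; split=> //; have [e de] := apex_dual sf; exists e => //.
have [V [V1 Vp FE]] := apex_functional sf; have [_ bF] := sf.
have J0 : apex_set s != finset.set0 by apply/set0Pn; exists None; exact: None_apex.
(* Induction on a bound for the height: both parts of a decomposition have height at least 1, hence
   a smaller bound. *)
have cone_int n : forall y, cone_hull p (apex_set s) y -> Zlat y -> dot y V <= n%:R ->
    forall k, k \in apex_set s -> dot y (e k) \is a Num.int.
  elim: n => [|n IH] y yJ yZ yn k kJ.
    have [->|/eqP y0] := eqVneq y 0; first by rewrite dot0l.
    have : A y by split=> //; split=> //; exact: apex_cone yJ.
    by move=> /V1 /le_trans/(_ yn); rewrite ler10.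
  have [->|/eqP y0] := eqVneq y 0; first by rewrite dot0l.
  have [yH|nyH] := pselect (Hilb (pos_hull (hull p (apex_set s))) y).
    have [c [c0 c1 yE]] := hilb bF yH.
    by rewrite yE (dual_coeff de) // kJ; exact: pInt (apexD sf) yZ c1 yE k kJ.
  have [[y' z'] [[y'J y'Z y'0] [z'J z'Z z'0] yE]] : exists yz : 'rV[R]_(d + 1) * 'rV[R]_(d + 1),
      [/\ [/\ cone_hull p (apex_set s) yz.1, Zlat yz.1 & yz.1 <> 0],
        [/\ cone_hull p (apex_set s) yz.2, Zlat yz.2 & yz.2 <> 0] & y = yz.1 + yz.2].
    apply: contrapT => h; apply: nyH; split=> //; first exact/pos_hull_hull.
    move=> y' z' /(pos_hull_hull _ _ J0) y'J y'Z /(pos_hull_hull _ _ J0) z'J z'Z E.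
    have [|y'0] := pselect (y' = 0); first by left.
    have [|z'0] := pselect (z' = 0); first by right.
    by case: h; exists (y', z').
  have y'1 : 1 <= dot y' V by apply: V1; split=> //; split=> //; exact: apex_cone y'J.
  have z'1 : 1 <= dot z' V by apply: V1; split=> //; split=> //; exact: apex_cone z'J.
  have : dot y' V + dot z' V <= n%:R + 1 by rewrite -dotDl -yE natr1.
  move=> sum_le; rewrite yE dotDl rpredD //; apply: IH => //.
    by rewrite -(lerD2r 1); apply: le_trans sum_le; rewrite lerD2l.
  by rewrite -(lerD2l 1) [leRHS]addrC; apply: le_trans sum_le; rewrite lerD2r.
move=> y yZ k kJ; pose N := Num.bound (\sum_(l in apex_set s) `|dot y (e l)|).
have hN l : l \in apex_set s -> 0 <= dot y (e l) + N%:R.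
  move=> lJ; rewrite -lerBlDl sub0r; apply: le_trans (ltW (unstable.ltr_bound _)).
  rewrite (bigD1 l) //= -normrN; apply: le_trans (ler_norm _) _.
  by rewrite lerDl sumr_ge0.
(* A large multiple of the sum of the vertices moves any lattice point into the cone and changes its
   coordinates by an integer. *)
pose y' := y + \sum_(l in apex_set s) N%:R *: p l.
have y'E l : l \in apex_set s -> dot y' (e l) = dot y (e l) + N%:R.
  by move=> lJ; rewrite dotDl (dual_coeff de (fun=> N%:R)) // lJ.
have y'J : cone_hull p (apex_set s) y'.
  by apply/(cone_hull_dual de) => l lJ; rewrite y'E // hN.
have y'Z : Zlat y'.
  by apply: ZlatD => //; apply: Zlat_sum => l _; apply: ZlatZ => //; exact: rpred_nat.
have := cone_int _ y' y'J y'Z (ltW (unstable.ltr_bound _)) k kJ.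
by rewrite y'E // => h; rewrite -[dot y (e k)](addrK N%:R) rpredB // rpred_nat.
Qed.

(* Otherwise the supporting hyperplane of the facet of [s], rotated about
   the face opposite to the apex, would support a bottom facet without apex. *)
Lemma apex_coord_ge0 (s : {set T}) e y : apex_facet s -> dual p (apex_set s) e ->
  (forall y, Zlat y -> forall k, k \in apex_set s -> dot y (e k) \is a Num.int) ->
  C y -> 0 <= dot y (e None).
Proof.
move=> sf de eZ yC; rewrite leNgt; apply/negP => y_lt0.
have sN : None \in apex_set s := None_apex s.
have [V [V1 Vp FE]] := apex_functional sf.
have VE : V = \sum_(k in apex_set s) 1 *: e k.
  by apply: (dual_eq de) => k ks; rewrite Vp // (dual_functional de (fun=> 1)).
have VZ x : Zlat x -> dot x V \is a Num.int.
  by move=> xZ; rewrite VE dot_sumr rpred_sum // => k ks; rewrite scale1r eZ.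
have [[n [g [gZ CE]]] _] := coneC.
have gC i : C (g i).
  rewrite CE; exists (fun j => (j == i)%:R); split=> [j|]; first by rewrite ler0n.
  rewrite (bigD1 i) //= eqxx scale1r big1 ?addr0 // => j ji.
  by rewrite (negPf ji) scale0r.
have gA i : g i <> 0 -> A (g i) by move=> gi0; split=> //; split.
have nz (x : 'rV[R]_(d + 1)) : dot x (e None) < 0 -> x <> 0.
  by move=> + x0; rewrite x0 dot0l ltxx.
(* The extremal ratio among the finitely many generators of [C] bounds the ratio on all of [C]; this
   is what makes the minimum over infinitely many lattice points exist below. *)
have [i0 gi0 max0] := @exists_max R 'I_n (fun i => dot (g i) (e None) < 0)
    (fun i => dot (g i) V / dot (g i) (e None)) (ltac:(
  move: yC y_lt0; rewrite CE => -[a [a0 ->]]; rewrite dot_suml => lt;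
  apply: contrapT => h; move: lt; rewrite ltNge sumr_ge0 // => i _;
  rewrite dotZl mulr_ge0 // leNgt; apply/negP => lt; apply: h; by exists i)).
have gV0 i : 0 <= dot (g i) V.
  by have [->|/eqP/gA/V1/(le_trans ler01)//] := eqVneq (g i) 0; rewrite dot0l.
have ratio x : C x -> dot (g i0) V * - dot x (e None) <= dot x V * - dot (g i0) (e None).
  rewrite CE => -[a [a0 ->]]; rewrite !dot_suml -sumrN mulr_sumr mulr_suml.
  apply: ler_sum => i _; rewrite !dotZl -mulrN mulrCA -mulrA ler_wpM2l //.
  have [ge|lt] := lerP 0 (dot (g i) (e None)).
    apply: (@le_trans _ _ 0); last by rewrite mulr_ge0 // oppr_ge0 ltW.
    by rewrite mulrN oppr_le0 mulr_ge0.
  have := max0 i lt; rewrite ler_ndivrMr // mulrAC ler_ndivrMr // => h.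
  by rewrite !mulrN lerN2.
have [|x xP|x [xA _]|a1 [a1A a1e] min1] := @min_ratio R 'rV[R]_(d + 1)
    (fun x => A x /\ dot x (e None) < 0) (fun x => dot x V) (fun x => - dot x (e None)) (g i0).
- by split=> //; apply/gA/nz.
- have [xA xe] := xP; have xZ := xA.1.2.
  have pnat (b : R) : b \is a Num.int -> 0 < b -> exists k : nat, b = k.+1%:R.
    move=> bZ b0; have [[|k] bE] := int_nat bZ (ltW b0); last by exists k.
    by rewrite bE ltxx in b0.
  have [k kE] := pnat _ (VZ x xZ) (lt_le_trans ltr01 (V1 x xA)).
  have [||l lE] := pnat (- dot x (e None)); first by rewrite rpredN eZ.
    by rewrite oppr_gt0.
  by exists k, l.
- exact: ratio xA.1.1.
(* The largest rotation that keeps every lattice point of [A] at height at least 1; it is attained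
   at [a1], which takes the place of the apex in the basis. *)
pose th := (dot a1 V - 1) / - dot a1 (e None); pose V' := V + th *: e None.
have a1e' : 0 < - dot a1 (e None) by rewrite oppr_gt0.
have a1V : 1 < dot a1 V.
  rewrite lt_neqAle V1 // andbT; apply/negP => /eqP E.
  have : hull p (apex_set s) a1 by rewrite FE; split; [exact: sub_conv|].
  by move=> /hull_cone/(cone_hull_dual de)/(_ _ sN); rewrite leNgt a1e.
have th0 : 0 < th by rewrite divr_gt0 // subr_gt0.
have V'E (x : 'rV[R]_(d + 1)) : dot x V' = dot x V + th * dot x (e None) by rewrite dotDr dotZr.
have V'1 x : A x -> 1 <= dot x V'.
  move=> xA; rewrite V'E; have [ge|lt] := lerP 0 (dot x (e None)).
    by rewrite ler_wpDr ?V1 // mulr_ge0 // ltW.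
  have := min1 x (conj xA lt); rewrite -/th ler_pdivlMr ?oppr_gt0 // mulrN lerBrDl => h.
  by rewrite -lerBlDr.
have V'a1 : dot a1 V' = 1.
  rewrite V'E -[dot a1 (e None)]opprK mulrN divfK ?gt_eqF //.
  by rewrite opprB addrC subrK.
pose w' k := if k is Some t then p (Some t) else a1.
have [|[t|]//|e' de'] := @dual_replace _ _ _ p w' (apex_set s) e None de sN.
  by rewrite /= lt_eqF.
have O1 : dot O V' != 1.
  by rewrite V'E -apexO Vp // de.2 // eqxx mulr1 -subr_eq0 addrC addKr gt_eqF.
have V'Q := conv_ge V'1.
have F'f : is_facet Q [set x | Q x /\ dot x V' = 1].
  apply: (facet_criterion de') => //.
    case=> [t|] ks; last by split; [exact: sub_conv|].
    split; first by apply: sub_conv; exact: vertex_gen.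
    by rewrite V'E Vp // de.2 // mulr0 addr0.
  by exists O => //; exact: bottom_sub O_bottom.
(* [V'] is at least 1 on the nonzero generators of [C], so a point of height 1 has coefficients at
   most 1 there, and only finitely many lattice points qualify. *)
have F'c : compact [set x | Q x /\ dot x V' = 1].
  rewrite conv_face //; apply: (@compact_conv_lattice _ _ _ (\sum_i `|g i|)).
    by move=> x [[[_ xZ] _] _].
  move=> x j [[[xC _] _]]; move: xC; rewrite CE => -[a [a0 ->]]; rewrite dot_suml => sum1.
  rewrite summxE; apply: le_trans (ler_norm_sum _ _ _) _; apply: ler_sum => i _.
  rewrite mxE; have [->|/eqP gn0] := eqVneq (g i) 0; first by rewrite mxE mulr0 normr0.
  have g1 : 1 <= dot (g i) V' := V'1 _ (gA i gn0).
  have V'g0 k : 0 <= a k * dot (g k) V'.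
    rewrite mulr_ge0 //; have [->|/eqP/gA/V'1/(le_trans ler01)//] := eqVneq (g k) 0.
    by rewrite dot0l.
  have ai : a i <= 1.
    rewrite -sum1 (bigD1 i) //= dotZl -[leLHS]addr0 lerD //.
      by rewrite ler_peMr.
    by apply: sumr_ge0 => k _; rewrite dotZl.
  rewrite normrM ger0_norm //; apply: le_trans (coord_le_norm _ j).
  by rewrite ler_piMl.
have [t tf tE] := apex_facetP (conj F'f F'c).
have : hull p (apex_set t) O by rewrite -apexO; apply: hull_mem; exact: None_apex.
by rewrite -tE => -[_ /eqP]; rewrite (negPf O1).
Qed.

(** [link_cover] decomposes a point up to a multiple of [O]; [apex_coord_ge0] shows that this
    multiple is nonnegative for points of [C]. *)
Lemma regular_cone_fan : cone_fan p (apex_sets apex_facet) C.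
Proof.
have cover y : C y -> exists2 S, apex_sets apex_facet S & cone_hull p S y.
  move=> yC; have [s [c [a [sf c0 yE]]]] := link_cover y.
  exists (apex_set s); first by exists s.
  have [_ [e de eZ]] := apex_unibasis sf.
  exists (fun k => if k is Some t then c t else a); last by rewrite sum_apex apexO addrC.
  case=> // ; have := apex_coord_ge0 sf de eZ yC.
  have yE' : y = \sum_(k in apex_set s) (if k is Some t then c t else a) *: p k.
    by rewrite sum_apex apexO addrC.
  by rewrite yE' (dual_coeff de) // None_apex.
split=> //.
- by move=> _ [s sf ->]; exact: apex_unibasis.
- move=> _ [s sf ->]; have [V [V1 Vp FE]] := apex_functional sf.
  exists V => // k ks; rewrite lt_neqAle (V1 _ (vertex_gen k)) andbT; apply/negP => /eqP E; move/negP: ks; apply; apply: (vertex_mem (apexD sf)).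
  by rewrite FE; split=> //; apply: sub_conv; exact: vertex_gen.
- move=> k; have [t tf kt] := apex_facet_cover (single k).
  by exists (apex_set t); [exists t|rewrite -finset.sub1set].
- move=> y; split=> [/cover[S _ yS]|]; last exact: apex_cone.
  exact: cone_hull_subset (finset.subsetT S) _ yS.
Qed.

(** A projection along [O] together with a linear section, both compatible with the lattices. *)
Definition projection (M : 'M[R]_(d + 1, d)) (N : 'M[R]_(d, d + 1)) : Prop :=
  [/\ forall y : 'rV[R]_(d + 1), Zlat y -> Zlat (y *m M),
      forall z : 'rV[R]_d, Zlat z -> Zlat (z *m N), N *m M = 1%:M, O *m M = 0 &
      forall y, exists a, y = y *m M *m N + a *: O].

Lemma exists_projection : exists M N, projection M N.
Proof.
have [s0 sf _] := apex_facet_cover (single None).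
have [_ [e de eZ]] := apex_unibasis sf.
have cs : d = #|s0|.
  have nN : None \notin (Some @: s0)%SET by apply/imsetP => -[].
  have := dual_card de; rewrite /apex_set cardsU1 nN card_imset; last exact: some_inj.
  by rewrite addn1 add1n => -[].
pose b (i : 'I_d) : T := enum_val (cast_ord cs i).
have bs i : Some (b i) \in apex_set s0 by rewrite Some_apex; exact: enum_valP.
have bI : injective b by move=> i j /enum_val_inj/cast_ord_inj.
have sumb (F : T -> 'rV[R]_(d + 1)) : \sum_(t in s0) F t = \sum_i F (b i).
  rewrite big_enum_val (reindex (cast_ord cs)) //=.
  by exists (cast_ord (esym cs)) => i _; rewrite ?cast_ordK ?cast_ordKV.
pose M : 'M[R]_(d + 1, d) := \matrix_(i, j) e (Some (b j)) i 0.
pose N : 'M[R]_(d, d + 1) := \matrix_i p (Some (b i)); exists M, N.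
have ME y j : (y *m M) 0 j = dot y (e (Some (b j))).
  by rewrite !mxE; apply: eq_bigr => i _; rewrite !mxE.
have NE (z : 'rV[R]_d) : z *m N = \sum_i z 0 i *: p (Some (b i)).
  by rewrite mulmx_sum_row; apply: eq_bigr => i _; rewrite rowK.
split=> [y yZ|z zZ|||y].
- by apply/ZlatP => j; rewrite ME eZ.
- by rewrite NE; apply: Zlat_sum => i _; apply: ZlatZ => //; move/ZlatP: zZ.
- apply/row_matrixP => i; rewrite row_mul rowK row1; apply/rowP => j.
  by rewrite ME de.2 // mxE eqxx (inj_eq (@some_inj T)) (inj_eq bI) eq_sym.
- apply/rowP => j; rewrite ME -apexO de.2 ?None_apex // mxE.
  by rewrite eq_sym.
- exists (dot y (e None)); rewrite {1}(de.1 y) sum_apex apexO addrC NE sumb.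
  by congr (_ + _); apply: eq_bigr => i _; rewrite ME.
Qed.

Lemma project_fan M N : projection M N ->
  fano_fan (fun t => p (Some t) *m M) apex_facet.
Proof.
move=> [MZ NZ NM OM ker]; split.
- move=> s sf; have [_ [e de eZ]] := apex_unibasis sf.
  split=> [t _|]; first exact: MZ.
  exists (fun t => N *m e (Some t)); last first.
    by move=> z zZ t ts; rewrite mulmxA eZ ?Some_apex //; exact: NZ.
  split=> [z|t t' ts ts'].
    rewrite -[LHS]mulmx1 -NM mulmxA {1}[z *m N](de.1) sum_apex mulmxDl apexO -scalemxAl OM.
    rewrite scaler0 add0r mulmx_suml; apply: eq_bigr => t ts.
    by rewrite -scalemxAl mulmxA.
  have [a aE] := ker (p (Some t)).
  have -> : p (Some t) *m M *m (N *m e (Some t')) = (p (Some t) - a *: O) *m e (Some t').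
    by rewrite mulmxA {2}aE addrK.
  rewrite dotBl dotZl -apexO !de.2 ?Some_apex ?None_apex // mulr0 subr0.
  by rewrite (inj_eq (@some_inj T)).
- move=> s sf; have [V [VO V1 V2]] := link_functional sf.1 (apex_facet_neq0 sf).
  have E t : dot (p (Some t) *m M) (N *m V) = dot (p (Some t)) V.
    have [a aE] := ker (p (Some t)).
    by rewrite mulmxA [in RHS]aE dotDl dotZl VO mulr0 addr0.
  by exists (N *m V) => t ts; rewrite E; [exact: V1|exact: V2].
- move=> t; have [s sf ts] := apex_facet_cover (single (Some t)).
  by exists s => //; rewrite -Some_apex -finset.sub1set.
- move=> z; have [s [c [a [sf c0 zE]]]] := link_cover (z *m N).
  exists s => //; exists c => //.
  rewrite -[LHS]mulmx1 -NM mulmxA zE mulmxDl -scalemxAl OM scaler0 addr0 mulmx_suml.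
  by apply: eq_bigr => t _; rewrite scalemxAl.
Qed.

(** Heights are measured by the functional [U] of the facet that corresponds to the first [d]
    labels, which makes these heights 0. For another facet with functional [V], the difference
    [U - V] vanishes at [O] and descends to the linear function required by [sconvex]. *)
Lemma realization_lift n (v : 'I_n -> 'rV[R]_d) M N (g : T -> 'I_n) :
  well_labelled v -> smooth_fano (vpoly v) -> projection M N -> bijective g ->
  (forall t, p (Some t) *m M = v (g t)) ->
  exists x, [/\ SF0 v x, Zlat x & lattice_iso C (Ccone v x)].
Proof.
move=> wl sf pr [h hg gh] pv; have gI := can_inj hg.
have fanv := fano_fan_labelled d_gt0 wl sf.
have fanp := project_fan pr; have [MZ NZ NM OM ker] := pr.
have vE : (fun t => p (Some t) *m M) = v \o g by apply/funext.
have rangeE : range (v \o g) = range v.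
  apply/seteqP; split=> [_ [t _ <-]|_ [i _ <-]]; first by exists (g t).
  by exists (h i); rewrite //= gh.
rewrite vE in fanp.
have facet J : facet_index v J -> exists2 s, apex_facet s & J = (g @: s)%SET.
  move=> fJ; have : is_facet (conv (range v)) (hull v J) by apply/(fano_facet d_gt0 fanv); exists J.
  rewrite -rangeE => /(fano_facet d_gt0 fanp)[s fs E]; exists s => //.
  apply/eqP; rewrite eq_sym eqEcard (fano_card fanv fJ) card_imset // (fano_card fanp fs) leqnn andbT.
  by apply: (fano_hull_le fanv fJ (fintype.subxx J)); rewrite hull_imset // -E.
have [s1 fs1 s1E] := facet _ (facet_index0 wl sf).
have [_ [e de eZ]] := apex_unibasis fs1.
pose U := \sum_(k in apex_set s1) 1 *: e k.
have UZ y : Zlat y -> dot y U \is a Num.int.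
  by move=> yZ; rewrite dot_sumr rpred_sum // => k ks; rewrite scale1r eZ.
have U1 k : k \in apex_set s1 -> dot (p k) U = 1 by exact: (dual_functional de (fun=> 1)).
have UO : dot O U = 1 by rewrite -apexO U1 // None_apex.
pose x : 'rV[R]_n.+1 := \row_j if unlift ord0 j is Some i then dot (p (Some (h i))) U - 1 else 0.
have x0 : x 0 ord0 = 0 by rewrite mxE unlift_none.
have xE i : x 0 (lift ord0 i) = dot (p (Some (h i))) U - 1 by rewrite mxE liftK.
have xZ : Zlat x.
  apply/ZlatP => j; case: (unliftP ord0 j) => [i ->|->]; last by rewrite x0 rpred0.
  by rewrite xE rpredB ?rpred1 // UZ.
have xd (i : 'I_n) : (i < d)%N -> x 0 (lift ord0 i) = 0.
  move=> id; have : i \in (g @: s1)%SET by rewrite -s1E inE.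
  by move=> /imsetP[t ts ->]; rewrite xE hg U1 ?subrr // Some_apex.
have kerE (V : 'cV[R]_(d + 1)) : dot O V = 0 -> forall t, dot (v (g t)) (N *m V) = dot (p (Some t)) V.
  move=> VO t; have [a aE] := ker (p (Some t)).
  by rewrite -pv mulmxA [in RHS]aE dotDl dotZl VO mulr0 addr0.
have xs : sconvex v x.
  move=> J /facet[s fs ->]; have [V [V1 Vp FE]] := apex_functional fs.
  have VO : dot O (U - V) = 0 by rewrite dotBr UO -apexO Vp ?subrr ?None_apex.
  have E i : dot (v i) (N *m (U - V)) = dot (p (Some (h i))) U - dot (p (Some (h i))) V.
    by rewrite -{1}[i]gh kerE // dotBr.
  exists (N *m (U - V)) => i; rewrite E xE.
    by move=> /imsetP[t ts ->]; rewrite hg Vp ?Some_apex.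
  move=> iJ; rewrite ltrD2l ltrN2 lt_neqAle (V1 _ (vertex_gen _)) andbT.
  apply/negP => /eqP E1; move/negP: iJ; apply; rewrite -[i]gh imset_f // -Some_apex.
  apply: (vertex_mem (apexD fs)); rewrite FE; split=> //.
  by apply: sub_conv; exact: vertex_gen.
exists x; split=> //; first exact/(SF0P d_gt0 wl sf).
have cfan := cone_fan_lift d_gt0 wl sf x0 xZ xs.
have FE (y : 'rV[R]_(d + 1)) : y *m row_mx M U = at_height (y *m M) (dot y U).
  by rewrite mul_mx_row /at_height; congr row_mx; apply/rowP => j; rewrite ord1 [RHS]mxE.
apply: (lattice_iso_of_linear regular_cone_fan cfan (g := omap g) (F := row_mx M U)).
- by apply: omap_bij; exists h.
- case=> [t|]; rewrite FE /=; last by rewrite apexO OM UO.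
  by rewrite pv xE hg [1 + _]addrC subrK.
- move=> y; rewrite FE => E; have [a aE] := ker y.
  have yM : y *m M = 0 by have := congr1 lsubmx E; rewrite lsub_height linear0.
  have yU : dot y U = 0.
    by have := congr1 (fun z : 'rV[R]_(d + 1) => rsubmx z 0 0) E; rewrite /= rsub_height linear0 [RHS]mxE.
  rewrite yM mul0mx add0r in aE.
  by move: yU; rewrite aE dotZl UO mulr1 => ->; rewrite scale0r.
Qed.

End Regular.

(** * Orbits, representatives and the bijection *)

Section Bijection.
Context {R : realType} {d n : nat} {T : finType}.
Variables (Sigma : {set {set T}}) (V : set ('I_n -> 'rV[R]_d)).
Hypotheses (d_gt0 : (0 < d)%N) (scS : simplicial_complex Sigma).
Hypothesis reps : fano_representatives Sigma V.

Lemma Zlat_map_mx m k (U : 'M[int]_(m, k)) (y : 'rV[R]_m) :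
  Zlat y -> Zlat (y *m map_mx intr U).
Proof.
move=> /ZlatP yZ; apply/ZlatP => j; rewrite mxE rpred_sum // => i _.
by rewrite rpredM // mxE rpred_int.
Qed.

(* The translation part of the equivalence vanishes: the only interior lattice
   point of a smooth Fano polytope is the origin. *)
Lemma unimodular_equiv_fano (K : finType) (w : K -> 'rV[R]_d) JJ (v : 'I_n -> 'rV[R]_d) :
  fano_fan w JJ -> fano_fan v (facet_index v) ->
  unimodular_equiv (conv (range w)) (vpoly v) ->
  exists2 U : 'M[int]_d, U \in unitmx & vpoly v = conv (range (fun k => w k *m map_mx intr U)).
Proof.
move=> fanw fanv [U [b [Uu vE]]]; exists U => //.
pose A : 'M[R]_d := map_mx intr U; pose c : 'rV[R]_d := map_mx intr b.
have AK : A *m map_mx intr (invmx U) = 1%:M by rewrite -map_mxM mulmxV // map_mx1.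
suff c0 : c = 0.
  rewrite vE !range_setT !conv_fin -hull_image.
  by apply/seteqP; split=> _ [y yP <-]; exists y; rewrite // -/c c0 addr0.
have cP : vpoly v c by rewrite vE; exists 0; [exact: fano_zero fanw|rewrite mul0mx add0r].
have cZ : Zlat c by apply/ZlatP => j; rewrite mxE rpred_int.
have [J fJ cJ] := fano_cover fanv c; have [_ [e de eZ]] := fano_uni fanv fJ.
have [u u1 u2] := fano_functional fanv fJ.
have vu k : dot (v k) u <= 1 by have [/u1 ->|/u2/ltW] := boolP (k \in J).
have u_le := poly_le1 vu.
have e0 k : k \in J -> 0 <= dot c (e k) by move/(cone_hull_dual de): cJ; apply.
(* If [c] were at height 1, [A *m u] would be nonpositive on a polytope around the origin, hence
   zero. Below height 1, the nonnegative integral coordinates of [c] must all vanish. *)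
have [cu|cu] := eqVneq (dot c u) 1.
  have : A *m u = 0.
    apply/eqP; rewrite -oppr_eq0; apply/eqP; have fi := fano_interior d_gt0 fanw; apply: (interior_functional fi) => y yP.
    have : vpoly v (y *m A + c) by rewrite vE; exists y.
    by move=> /u_le; rewrite dotDl cu gerDr dotNr mulmxA oppr_ge0.
  move=> /(congr1 (mulmx (map_mx intr (invmx U)))); rewrite mulmxA (mulmx1C AK) mul1mx mulmx0 => u0.
  by move: cu; rewrite u0 dot0r => /esym/eqP; rewrite oner_eq0.
rewrite [c](de.1) big1 // => k kJ; suff -> : dot c (e k) = 0 by rewrite scale0r.
apply/eqP; apply: contraNT cu => ek; rewrite eq_le u_le //=.
have ek1 : 1 <= dot c (e k) by rewrite int_ge1 ?eZ // lt_def ek e0.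
apply: le_trans ek1 _; rewrite {2}[c](de.1) dot_suml (bigD1 k) //= dotZl u1 // mulr1 lerDl.
by apply: sumr_ge0 => l /andP[lJ _]; rewrite dotZl u1 // mulr1 e0.
Qed.

Lemma regular_realization_fano (C : set 'rV[R]_(d + 1)) : regular_realization Sigma C ->
  exists v x, [/\ V v, SF0 v x, Zlat x & lattice_iso C (Ccone v x)].
Proof.
move=> [[coneC iso hilb] [apex [intO _ faces]]].
have [p [emb cells pZ pInt]] := realization_vertices (simplicial_complex_pyramid scS) iso.
have [M [N pr]] := exists_projection d_gt0 scS coneC emb pZ cells pInt hilb intO faces.
have fan M' N' pr' := @project_fan _ _ _ _ _ _ _ d_gt0 scS coneC emb pZ cells pInt hilb intO faces M' N' pr'.
have fanq := fan M N pr.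
have be : boundary_equiv Sigma (conv (range (fun t => p (Some t) *m M))).
  apply: (fano_boundary_equiv d_gt0 fanq (g := id)) => [|s]; first by exists id.
  rewrite imset_id; split=> [sS|[J [JS _] sJ]].
    have [|t tf] := apex_facet_cover scS emb cells intO (s := apex_set s).
      by rewrite apex_pyramid.
    by rewrite apex_subset; exists t.
  by have [_ Ssub _] := scS; exact: Ssub JS sJ.
have [v [[Vv /unimodular_equiv_fano eqv] _]] := reps.2 _ (fano_smooth d_gt0 fanq) be.
have [wl sf _] := reps.1 v Vv; have fanv := fano_fan_labelled d_gt0 wl sf.
have [U Uu vE] := eqv _ fanq fanv.
have [MZ NZ NM OM ker] := pr.
have UK : map_mx intr (invmx U) *m map_mx intr U = 1%:M :> 'M[R]_d by rewrite -map_mxM mulVmx // map_mx1.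
have KU := mulmx1C UK.
(* The projection is composed with the unimodular equivalence, so that the projected vertices become
   those of the chosen representative. *)
have pr' : projection apex (M *m map_mx intr U) (map_mx intr (invmx U) *m N).
  split.
  - by move=> y yZ; rewrite mulmxA; apply: Zlat_map_mx; exact: MZ.
  - by move=> z zZ; rewrite mulmxA; apply: NZ; exact: Zlat_map_mx.
  - by rewrite -mulmxA [N *m _]mulmxA NM mul1mx.
  - by rewrite mulmxA OM mul0mx.
  - move=> y; have [a aE] := ker y; exists a.
    by rewrite !mulmxA -[_ *m map_mx intr U *m _]mulmxA KU mulmx1.
have fanq' := fan _ _ pr'.
have rangeE : range v = range (fun t => p (Some t) *m (M *m map_mx intr U)).
  rewrite -(fano_vertices d_gt0 fanv) -(fano_vertices d_gt0 fanq'); congr vertices.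
  rewrite -/(vpoly v) vE; congr (Defs.conv (_ @` _)).
  by apply/funext => t; rewrite mulmxA.
have hg t : exists i, p (Some t) *m (M *m map_mx intr U) = v i.
  have : range v (p (Some t) *m (M *m map_mx intr U)) by rewrite rangeE; exists t.
  by move=> [i _ <-]; exists i.
have [g gE] := choice hg.
have hh i : exists t, g t = i.
  have : range (fun t => p (Some t) *m (M *m map_mx intr U)) (v i) by rewrite -rangeE; exists i.
  by move=> [t _ E]; exists t; apply: (fano_inj fanv); rewrite -gE.
have [h gh] := choice hh.
have gbij : bijective g.
  by exists h => // t; apply: (fano_inj fanq'); rewrite !gE gh.
have [x [xSF xZ xiso]] := realization_lift d_gt0 scS coneC emb pZ cells pInt hilb intO faces
  wl sf pr' gbij gE.
by exists v, x.
Qed.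

Lemma iso_class_eq (C D : set 'rV[R]_(d + 1)) : regular_realization Sigma C ->
  regular_realization Sigma D ->
  iso_class Sigma C = iso_class Sigma D <-> lattice_iso C D.
Proof.
move=> rC rD; have [[cC _ _] _] := rC; have [[cD _ _] _] := rD; split=> [E|CD].
  have : iso_class Sigma D D by split; [|exact: lattice_iso_refl].
  by rewrite -E => -[].
apply/seteqP; split=> E [rE iE]; split=> //; last exact: lattice_iso_trans CD iE.
exact: lattice_iso_trans (lattice_iso_sym cC CD) iE.
Qed.

Lemma realization_Ccone v x : V v -> SF0 v x -> Zlat x -> regular_realization Sigma (Ccone v x).
Proof.
move=> /(reps.1 v)[wl sf be] /(SF0P d_gt0 wl sf)[x0 _ xs] xZ.
exact: regular_realization_lift.
Qed.

Lemma aut_orbit_eq v x z : V v -> SF0 v x -> Zlat x -> SF0 v z -> Zlat z ->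
  aut_orbit v x = aut_orbit v z <-> lattice_iso (Ccone v x) (Ccone v z).
Proof.
move=> Vv xSF xZ zSF zZ; have [wl sf _] := reps.1 v Vv.
have orbE x' z' x'SF x'Z := @aut_orbit_iso _ _ _ d_gt0 v wl sf x' z' x'SF x'Z.
have [[cx _ _] _] := realization_Ccone Vv xSF xZ.
split=> [E|xz].
  have : aut_orbit v z z by apply/orbE => //; split=> //; exact: lattice_iso_refl.
  by rewrite -E => /orbE[].
apply/seteqP; split=> y /orbE[] // ySF yZ i; apply/orbE => //; split=> //.
  exact: lattice_iso_trans (lattice_iso_sym cx xz) i.
exact: lattice_iso_trans xz i.
Qed.

Lemma representative_eq v v' x x' : V v -> SF0 v x -> Zlat x -> V v' -> SF0 v' x' -> Zlat x' ->
  lattice_iso (Ccone v x) (Ccone v' x') -> v = v'.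
Proof.
move=> Vv xSF xZ Vv' x'SF x'Z i; have [wl sf be] := reps.1 v Vv; have [wl' sf' _] := reps.1 v' Vv'.
have [x0 _ xs] := (SF0P d_gt0 wl sf x).1 xSF; have [x'0 _ x's] := (SF0P d_gt0 wl' sf' x').1 x'SF.
have [u [_ uniq]] := reps.2 _ sf be.
have <- : u = v by apply: uniq; split=> //; exact: unimodular_equiv_refl.
apply: uniq; split=> //.
apply: unimodular_equiv_iso i; try exact: cone_fan_lift; exact: fano_fan_labelled.
Qed.

End Bijection.

Unset Implicit Arguments.

Theorem theorem5p3 (R : realType) (d n : nat) (T : finType)
    (Sigma : {set {set T}}) (V : set ('I_n -> 'rV[R]_d)) :
  (0 < d)%N -> #|T| = n ->
  simplicial_sphere R Sigma d ->
  fano_representatives Sigma V ->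
  exists f : ('I_n -> 'rV[R]_d) * set 'rV[R]_n.+1 ->
             set (set 'rV[R]_(d + 1)),
    (forall v x, V v -> SF0 v x -> Zlat x ->
       f (v, aut_orbit v x) = iso_class Sigma (Ccone v x)) /\
    set_bij
      [set w | exists v x, [/\ V v, SF0 v x, Zlat x & w = (v, aut_orbit v x)]]
      [set K | exists2 C, regular_realization Sigma C & K = iso_class Sigma C]
      f.
Proof.
move=> d_gt0 _ [scS _] reps.
(* The value is a union over all integral points with the given orbit, so no point is chosen; [fE]
   shows that they all contribute the same class. *)
pose f (w : ('I_n -> 'rV[R]_d) * set 'rV[R]_n.+1) : set (set 'rV[R]_(d + 1)) :=
  [set C | exists x, [/\ SF0 w.1 x, Zlat x, w.2 = aut_orbit w.1 x &
     iso_class Sigma (Ccone w.1 x) C]].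
have real_v := realization_Ccone d_gt0 scS reps.
have fE v x : V v -> SF0 v x -> Zlat x -> f (v, aut_orbit v x) = iso_class Sigma (Ccone v x).
  move=> Vv xSF xZ; apply/seteqP; split=> C; last by exists x.
  move=> [z /= [zSF zZ /(aut_orbit_eq d_gt0 scS reps Vv xSF xZ zSF zZ) xz]].
  by rewrite (_ : iso_class Sigma (Ccone v x) = iso_class Sigma (Ccone v z)) //;
    apply/iso_class_eq => //; exact: real_v.
exists f; split=> //; split.
- move=> w [v [x [Vv xSF xZ ->]]]; exists (Ccone v x); last exact: fE.
  exact: real_v.
- move=> _ _ /[!inE] [[v [x [Vv xSF xZ ->]]]] [v' [x' [Vv' x'SF x'Z ->]]].
  rewrite !fE // iso_class_eq; try exact: real_v.
  move=> i; have vv' := representative_eq d_gt0 reps Vv xSF xZ Vv' x'SF x'Z i.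
  by subst v'; congr (_, _); apply/(aut_orbit_eq d_gt0 scS reps).
- move=> _ [C rC ->].
  have [v [x [Vv xSF xZ i]]] := regular_realization_fano d_gt0 scS reps rC.
  exists (v, aut_orbit v x); first by exists v, x.
  by rewrite fE //; apply/esym/iso_class_eq => //; exact: real_v.
Qed.
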